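(* Let $\Omega$ be a simply connected bounded Jordan domain in the $xy$-plane, let $\psi\colon\Omega\to\mathbb{R}$ be a smooth function whose graph $\Sigma=\mathrm{graph}(\psi)\subset\mathbb{L}^3$ is a maximal graph, and let $L\subset\partial\Sigma$ be a lightlike line segment with endpoints $a\neq b$ which has shrinking singularities at its endpoints $a,b$. Then $\Sigma$ extends to a surface with zero mean curvature across $L$. Further, the extended surface is invariant under the point symmetry $p\mapsto 2c-p$ with respect to the midpoint $c=(a+b)/2$ of $L$. In particular, the extended surface is maximal (i.e. spacelike with zero mean curvature), except along $L$.
   Context: $\mathbb{L}^3$ is Lorentz-Minkowski 3-space, i.e. $\mathbb{R}^3$ with coordinates $(x,y,t)$ and the inner product of signature $(+,+,-)$. The graph of a smooth function $\psi$ over a domain of the $xy$-plane is a maximal graph if it is spacelike ($\psi_x^2+\psi_y^2<1$) and has vanishing mean curvature, i.e. $(1-\psi_y^2)\psi_{xx}+2\psi_x\psi_y\psi_{xy}+(1-\psi_x^2)\psi_{yy}=0$. A line segment is lightlike if its direction $v\neq0$ satisfies $\langle v,v\rangle=0$. $\partial\Sigma=\overline{\Sigma}\setminus\Sigma$ (closure in $\mathbb{R}^3$). Shrinking singularities at the endpoints: let $X\colon\mathbb{D}\to\Sigma$ be an isothermal (conformal) parametrization from the unit disk $\mathbb{D}$. Since $\Sigma$ is bounded, $X$ is a bounded harmonic map and is the Poisson integral $$X(w)=\frac1{2\pi}\int_0^{2\pi}\frac{1-|w|^2}{|e^{it}-w|^2}\,\widehat X(e^{it})\,dt$$ of a bounded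 map $\widehat X\colon\partial\mathbb{D}\to\mathbb{L}^3$, determined up to sets of measure zero. The lightlike segment $L\subset\partial\Sigma$ with endpoints $a\ne b$ has shrinking singularities at its endpoints if there are $w_0=e^{it_0}\in\partial\mathbb{D}$ and $\varepsilon,\delta>0$ such that, after modifying $\widehat X$ on a null set, $\widehat X(e^{it})=a$ for all $t\in(t_0-\varepsilon,t_0)$ and $\widehat X(e^{it})=b$ for all $t\in(t_0,t_0+\delta)$. Extension across $L$: $\Sigma$ extends to a surface with zero mean curvature across $L$ if there are a connected smooth 2-manifold $M$ (without boundary), a smooth immersion $F\colon M\to\mathbb{L}^3$, an open subset $M^+\subset M$ mapped by $F$ diffeomorphically onto $\Sigma$, and an embedded curve $\ell\subset M$ contained in the boundary of $M^+$ in $M$ and mapped by $F$ homeomorphically onto $L\setminus\{a,b\}$, such that $F$ is locally a graph $t=\phi(x,y)$ of a function satisfying $(1-\phi_y^2)\phi_{xx}+2\phi_x\phi_y\phi_{xy}+(1-\phi_x^2)\phi_{yy}=0$. The extended surface is $F$ (with image $F(M)$); invariance under the point symmetry means $2c-F(M)=F(M)$, and ''maximal except along $L$'' means that $F$ is spacelike on $M\setminus\ell$. *)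

(* Defs.v *)
From HB Require Import structures.
From mathcomp Require Import all_boot all_order all_algebra.
From mathcomp Require Import all_classical all_reals all_analysis.

Set Implicit Arguments.
Unset Strict Implicit.
Unset Printing Implicit Defensive.

Import Order.TTheory GRing.Theory Num.Theory.
Import numFieldNormedType.Exports.

Local Open Scope classical_set_scope.
Local Open Scope ring_scope.

Notation plane R := (R * R)%type.
(* (x, y, t) is ((x, y), t), so that (p, psi p) is the point of the graph of
   psi over p. *)
Notation L3 R := (R * R * R)%type.

Section Topology.

Definition frontier (T : topologicalType) (A : set T) : set T :=
  closure A `\` interior A.

(* f maps A homeomorphically onto B, and g inverts f on B. *)
Definition homeomorphism_with (T U : topologicalType) (A : set T) (B : set U)
    (f : T -> U) (g : U -> T) : Prop :=
  [/\ set_bij A B f, {in A, cancel f g}, {within A, continuous f}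
    & {within B, continuous g}].

Definition homeomorphism_onto (T U : topologicalType) (A : set T) (B : set U)
    (f : T -> U) : Prop :=
  exists g : U -> T, homeomorphism_with A B f g.

Variable R : realType.

Definition simply_connected (T : topologicalType) (A : set T) : Prop :=
  (forall x y, A x -> A y -> exists gamma : R -> T,
     [/\ {within `[0, 1], continuous gamma}, gamma @` `[0, 1] `<=` A,
         gamma 0 = x & gamma 1 = y]) /\
  (forall gamma : R -> T,
     {within `[0, 1], continuous gamma} -> gamma @` `[0, 1] `<=` A ->
     gamma 0 = gamma 1 ->
     exists (H : R * R -> T) (x : T),
       [/\ {within `[0, 1] `*` `[0, 1], continuous H},
           H @` (`[0, 1] `*` `[0, 1]) `<=` A,
           forall t, t \in `[0, 1] -> H (0, t) = gamma t,
           forall t, t \in `[0, 1] -> H (1, t) = x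
         & forall s, s \in `[0, 1] -> H (s, 0) = H (s, 1)]).

Definition jordan_curve (C : set (plane R)) : Prop :=
  exists gamma : R -> plane R,
    [/\ {within `[0, 1], continuous gamma}, gamma 0 = gamma 1,
        set_inj `[0, 1[ gamma & gamma @` `[0, 1] = C].

(* Such a set is clopen in the complement of its frontier, hence it is the
   bounded component of the complement of a Jordan curve; it is nonempty since
   its frontier is. *)
Definition bounded_jordan_domain (Omega : set (plane R)) : Prop :=
  [/\ open Omega, connected Omega, bounded_set Omega
    & jordan_curve (frontier Omega)].

End Topology.

Section Smooth.
Variables (R : realType) (V W : normedModType R).

(* C^n on the open set U; used for finite-dimensional V, where it is enough to
   test directional derivatives. *)
Fixpoint C_on (n : nat) (U : set V) (f : V -> W) : Prop :=
  if n is n'.+1 then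
    (forall x, U x -> differentiable f x) /\ (forall v, C_on n' U ('D_v f))
  else forall x, U x -> {for x, continuous f}.

Definition smooth_on (U : set V) (f : V -> W) : Prop := forall n, C_on n U f.

End Smooth.

Section Lorentz.
Variable R : realType.
Implicit Types (u v a b : L3 R) (S : set (L3 R)).

Definition lorentz u v : R :=
  u.1.1 * v.1.1 + u.1.2 * v.1.2 - u.2 * v.2.

Definition lightlike v : Prop := v != 0 /\ lorentz v v = 0.

Definition segment a b : set (L3 R) :=
  [set (1 - s) *: a + s *: b | s in `[0, 1]].

Definition graph (U : set (plane R)) (phi : plane R -> R) : set (L3 R) :=
  [set (p, phi p) | p in U].

Definition bdry S : set (L3 R) := closure S `\` S.

Definition dx (phi : plane R -> R) : plane R -> R := 'D_((1, 0) : plane R) phi.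
Definition dy (phi : plane R -> R) : plane R -> R := 'D_((0, 1) : plane R) phi.

Definition zmc_eq (phi : plane R -> R) (p : plane R) : Prop :=
  (1 - dy phi p ^+ 2) * dx (dx phi) p
  + 2 * dx phi p * dy phi p * dy (dx phi) p
  + (1 - dx phi p ^+ 2) * dy (dy phi) p = 0.

Definition maximal_graph (U : set (plane R)) (phi : plane R -> R) : Prop :=
  forall p, U p -> dx phi p ^+ 2 + dy phi p ^+ 2 < 1 /\ zmc_eq phi p.

End Lorentz.

Section ShrinkingSingularities.
Variable R : realType.
Implicit Types (w : plane R) (a b : L3 R) (S : set (L3 R)).

(* The library norm on R * R is the sup norm, not the Euclidean one. *)
Definition sqnorm w : R := w.1 ^+ 2 + w.2 ^+ 2.

Definition unit_disk : set (plane R) := [set w | sqnorm w < 1].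

Definition expi (t : R) : plane R := (cos t, sin t).

(* A smooth bijection of the disk onto S whose induced metric is a positive
   multiple of the Euclidean one; either orientation is allowed. *)
Definition isothermal_parametrization S (X : plane R -> L3 R) : Prop :=
  [/\ smooth_on unit_disk X, set_bij unit_disk S X
    & forall w, unit_disk w ->
        let Xu := 'D_((1, 0) : plane R) X w in
        let Xv := 'D_((0, 1) : plane R) X w in
        [/\ lorentz Xu Xu = lorentz Xv Xv, 0 < lorentz Xu Xu
          & lorentz Xu Xv = 0]].

Definition poisson_integral (f : plane R -> R) w : R :=
  (2 * pi)^-1 *
  \int[lebesgue_measure]_(t in `[0, 2 * pi])
    ((1 - sqnorm w) / sqnorm (expi t - w) * f (expi t)).

Definition poisson_integral3 (Xhat : plane R -> L3 R) w : L3 R :=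
  (poisson_integral (fun z => (Xhat z).1.1) w,
   poisson_integral (fun z => (Xhat z).1.2) w,
   poisson_integral (fun z => (Xhat z).2) w).

(* Only the values of Xhat on the unit circle matter. *)
Definition boundary_map (X Xhat : plane R -> L3 R) : Prop :=
  [/\ measurable_fun [set: R] (fun t : R => Xhat (expi t)),
      [bounded Xhat (expi t) | t in [set: R]]
    & forall w, unit_disk w -> X w = poisson_integral3 Xhat w].

(* Null-set modifications of Xhat are again boundary maps of X, so they are
   absorbed by the quantifier on Xhat. *)
Definition shrinking_singularities S a b : Prop :=
  exists X Xhat : plane R -> L3 R,
    [/\ isothermal_parametrization S X, boundary_map X Xhat
      & exists t0 eps delta : R,
          [/\ 0 < eps, 0 < delta,
              forall t, t0 - eps < t < t0 -> Xhat (expi t) = a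
            & forall t, t0 < t < t0 + delta -> Xhat (expi t) = b]].

End ShrinkingSingularities.

(* Smooth 2-manifold without boundary, given by an atlas.  chart_inv i is
   meaningful on the open set chart i @` chart_dom i only. *)
Record surface (R : realType) := Surface {
  carrier :> topologicalType;
  chart_index : Type;
  chart_dom : chart_index -> set carrier;
  chart : chart_index -> carrier -> plane R;
  chart_inv : chart_index -> plane R -> carrier;
  surface_hausdorff : hausdorff_space carrier;
  surface_second_countable : @second_countable carrier;
  chart_cover : forall m : carrier, exists i, chart_dom i m;
  chart_dom_open : forall i, open (chart_dom i);
  chart_img_open : forall i, open (chart i @` chart_dom i);
  chart_homeo : forall i, homeomorphism_with (chart_dom i)
    (chart i @` chart_dom i) (chart i) (chart_inv i);
  chart_transition : forall i j,
    smooth_on (chart i @` (chart_dom i `&` chart_dom j))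
      (chart j \o chart_inv i)
}.
Arguments chart_dom {R} M : rename.
Arguments chart {R} M : rename.
Arguments chart_inv {R} M : rename.

Section SurfaceMaps.
Variables (R : realType) (M : surface R).

Definition chart_img (i : chart_index M) : set (plane R) :=
  chart M i @` chart_dom M i.

Definition smooth_from (F : M -> L3 R) : Prop :=
  forall i, smooth_on (chart_img i) (F \o chart_inv M i).

(* The differential of F at the point with coordinates p in the chart i, applied
   to the tangent vector with coordinates v. *)
Definition chart_diff (F : M -> L3 R) (i : chart_index M) (p v : plane R) :
  L3 R := 'D_v (F \o chart_inv M i) p.

Definition immersion (F : M -> L3 R) : Prop :=
  forall i p v, chart_img i p -> chart_diff F i p v = 0 -> v = 0.

Definition spacelike_on (A : set M) (F : M -> L3 R) : Prop :=
  forall i p v, chart_img i p -> A (chart_inv M i p) -> v != 0 ->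
    0 < lorentz (chart_diff F i p v) (chart_diff F i p v).

(* A map into M is smooth on the open set U. *)
Definition smooth_to (V : normedModType R) (U : set V) (g : V -> M) : Prop :=
  (forall x, U x -> {for x, continuous g}) /\
  forall i, smooth_on (U `&` g @^-1` chart_dom M i) (chart M i \o g).

(* An open arc, smoothly embedded. *)
Definition embedded_curve (ell : set M) : Prop :=
  exists sigma : R -> M,
    [/\ smooth_to (`]0, 1[ : set R) sigma,
        forall i t, t \in `]0, 1[ -> chart_dom M i (sigma t) ->
          'D_1 (chart M i \o sigma) t != 0
      & homeomorphism_onto (`]0, 1[ : set R) ell sigma].

(* Since p |-> (p, psi p) parametrizes the graph, G is the inverse of the
   restriction of F to A read in this parametrization. *)
Definition diffeo_onto_graph (A : set M) (U : set (plane R))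
    (psi : plane R -> R) (F : M -> L3 R) : Prop :=
  set_bij A (graph U psi) F /\
  exists2 G : plane R -> M, smooth_to U G
    & forall p, U p -> A (G p) /\ F (G p) = (p, psi p).

Definition locally_zmc_graph (F : M -> L3 R) : Prop :=
  forall m : M, exists (N : set M) (U : set (plane R)) (phi : plane R -> R),
    [/\ open N /\ N m, open U, smooth_on U phi,
        forall p, U p -> zmc_eq phi p & set_bij N (graph U phi) F].

End SurfaceMaps.

(* F : M -> L3 extends the graph of psi over Omega across the segment from a to
   b; ell is the curve of M over this segment. *)
Record zmc_extension (R : realType) (Omega : set (plane R))
    (psi : plane R -> R) (a b : L3 R) (M : surface R) (F : M -> L3 R)
    (Mplus ell : set M) : Prop := ZmcExtension {
  ext_connected : connected [set: M];
  ext_smooth : smooth_from F;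
  ext_immersion : immersion F;
  ext_open : open Mplus;
  ext_diffeo : diffeo_onto_graph Mplus Omega psi F;
  ext_curve : embedded_curve ell;
  ext_boundary : ell `<=` frontier Mplus;
  ext_segment : homeomorphism_onto ell (segment a b `\` [set a; b]) F;
  ext_zmc : locally_zmc_graph F
}.

Definition point_symmetry (R : realType) (c p : L3 R) : L3 R := 2 *: c - p.

(* Main.v *)
Require Import Defs.
From HB Require Import structures.
From mathcomp Require Import all_boot all_order all_algebra.
From mathcomp Require Import all_classical all_reals all_analysis.
From mathcomp Require Import measurable_realfun ring lra.

Set Implicit Arguments.
Unset Strict Implicit.
Unset Printing Implicit Defensive.

Import Order.TTheory GRing.Theory Num.Theory.
Import numFieldNormedType.Exports.

Local Open Scope classical_set_scope.
Local Open Scope ring_scope.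

(* Let zeta = r (i - s) be the coordinate of the upper half plane {r > 0}, sent
   to the disk by the Cayley map that takes zeta = 0 to the jump of Xhat.  Since
   Xhat equals b just after the jump and a just before it,
     X = b + (a - b) arg zeta / pi + h,
   where h is the Poisson integral of a function vanishing near the jump.  Now
   arg zeta = pi / 2 + atan s, and h = r K(r, s) where K is the integral of
   f / |1 - sigma zeta| ^ 2 for the cotangent sigma of half the angle from the
   jump.  As |1 - sigma zeta| ^ 2 >= 1 / (1 + s ^ 2) for all real r and s, this
   formula defines a smooth map F on the whole (r, s)-plane, which maps the line
   r = 0 onto the open segment and satisfies F(- p) = a + b - F(p).

   It remains to see that the projection of F to the xy-plane is a local
   diffeomorphism along r = 0; it is one elsewhere because X is spacelike.  If it
   is not, the component of h orthogonal to the projection of a - b has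
   vanishing first moment.  Let N > 0 be the order of its first nonvanishing
   moment: to leading order the Jacobian is r ^ N Im((i - s) ^ (N + 1)), which
   changes sign in the connected half plane r > 0, where it has no zeros.  If all
   moments vanish, this component is constant near r = 0 and the Jacobian is 0. *)

(** * Smooth maps *)

Section SmoothCalculus.
Variables (R : realType).
Implicit Types (V W : normedModType R).

(** The coordinates (r, s) blow up the boundary point: the whole line r = 0 lies over zeta = 0, and
    along it s records the direction of approach. The jump, which prevents X from being continuous
    there, thus turns into the smooth function atan s. The map p -> - p is the conjugation of zeta,
    so the extension is a Schwarz reflection written in real terms, and the plane with a single
    chart can carry the whole extended surface. The obstacle is the line r = 0. There the
    s-derivative of F is a multiple of a - b, hence null, and spacelikeness no longer controls the
    projection. Only the r-derivative can be transverse to it, and its transverse component is the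
    integral of a weight that vanishes near the jump, about which nothing local is known. What
    excludes a zero integral is the global absence of critical points in r > 0. The mean curvature
    equation on r = 0 is then a matter of continuity: once F is a graph near such a point, the
    equation holds for r > 0 by hypothesis, for r < 0 by reflection, and its left-hand side is
    continuous. *)

Lemma is_diff_eps V W (f L : V -> W) x :
  linear L -> continuous L ->
  (forall e, 0 < e -> \forall h \near 0, `|f (h + x) - f x - L h| <= e * `|h|) ->
  is_diff x f L.
Proof.
move=> linL cL fL.
pose LM := GRing.isLinear.Build _ _ _ _ _ linL.
pose L' : {linear _ -> _} := HB.pack L LM.
have eq : f \o shift x = cst (f x) + L' +o_ 0 id.
  apply/eqaddoP => e e0; have := fL e e0; apply: filterS => h /=.
  by rewrite !fctE/= opprD addrA.
have dE : 'd f x = L' :> (V -> W) by exact: diff_unique.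
apply: DiffDef => //; apply/diff_locallyP; split; first by rewrite dE.
by rewrite dE.
Qed.

Lemma near_eq_is_diff V W (f g L : V -> W) x :
  (\near x, f x = g x) -> is_diff x f L -> is_diff x g L.
Proof.
move=> fg [df dfE].
have dE : 'd g x = 'd f x :> (V -> W).
  apply: diff_unique; first exact: diff_continuous.
  apply/eqaddoP => e e0.
  have /eqaddoP/(_ e e0) := diff_locally df.
  have := fg; rewrite (near_shift 0)/= => fg0.
  move: fg0; apply: filterS2 => h /=; rewrite !fctE /= subr0.
  by move=> ->; rewrite (nbhs_singleton fg).
apply: DiffDef; last by rewrite dE dfE.
apply/diff_locallyP; rewrite dE; split; first exact: diff_continuous.
apply/eqaddoP => e e0.
have /eqaddoP/(_ e e0) := diff_locally df.
have := fg; rewrite (near_shift 0)/= => fg0.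
move: fg0; apply: filterS2 => h /=; rewrite !fctE /= subr0.
by move=> ->; rewrite (nbhs_singleton fg).
Qed.

Lemma near_eq_differentiable V W (f g : V -> W) x :
  (\near x, f x = g x) -> differentiable f x -> differentiable g x.
Proof. by move=> fg /differentiableP /(near_eq_is_diff fg)[]. Qed.

Lemma is_diff_derive V W (f L : V -> W) x v : is_diff x f L -> 'D_v f x = L v.
Proof. by move=> [df <-]; rewrite deriveE. Qed.

Lemma C_on_congr V W n (U : set V) (f g : V -> W) :
  open U -> {in U, f =1 g} -> C_on n U f -> C_on n U g.
Proof.
move=> oU; elim: n f g => [|n IH] f g fg /=.
  move=> cf x Ux; apply: cvg_trans (cvg_trans (cf x Ux) _).
    apply: near_eq_cvg; near=> y; apply: fg; rewrite inE; near: y.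
    exact: open_nbhs_nbhs.
  by rewrite fg ?inE.
have nfg x : U x -> \near x, f x = g x.
  by move=> Ux; near=> y; apply: fg; rewrite inE; near: y; exact: open_nbhs_nbhs.
move=> [df Cf]; split=> [x Ux|v].
  exact: near_eq_differentiable (nfg x Ux) (df x Ux).
apply: IH (Cf v) => x; rewrite inE => Ux.
exact: near_eq_derive (nfg x Ux).
Unshelve. all: by end_near. Qed.

Lemma C_onS V W n (U U' : set V) (f : V -> W) :
  U' `<=` U -> C_on n U f -> C_on n U' f.
Proof.
move=> sU; elim: n f => [|n IH] f /=; first by move=> cf x /sU; exact: cf.
by move=> [df Cf]; split=> [x /sU|v]; [exact: df|exact: IH].
Qed.

(** Every level of [C_on] is a condition at single points. This serves to read the smoothness of a
    globally defined inverse off its local descriptions. *)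
Lemma C_on_local V W n (U : set V) (f : V -> W) :
  (forall x, U x -> exists2 N, N x & C_on n N f) -> C_on n U f.
Proof.
elim: n f => [|n IH] f /= h.
  by move=> x /h [N Nx cN]; exact: cN.
split=> [x /h [N Nx [d _]]|v]; first exact: d.
by apply: IH => x /h [N Nx [_ d]]; exists N.
Qed.

Lemma C_onW V W n (U : set V) (f : V -> W) : C_on n.+1 U f -> C_on n U f.
Proof.
elim: n f => [|n IH] f [df Cf].
  by move=> x Ux; exact: differentiable_continuous (df x Ux).
by split=> // v; exact: IH (Cf v).
Qed.

Lemma C_on_cst V W n (U : set V) (c : W) : C_on n U (fun=> c).
Proof.
elim: n c => [|n IH] c /=; first by move=> x _; exact: cst_continuous.
split=> [x _|v]; first exact: differentiable_cst.
have -> : 'D_v (fun=> c : W) = (fun=> 0) :> (V -> W).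
  by apply/funext => x; exact: derive_cst.
exact: IH.
Qed.

Lemma is_diff_linear V W (L : V -> W) x :
  linear L -> continuous L -> is_diff x L L.
Proof.
move=> linL cL; apply: is_diff_eps => // e e0; near=> h.
have -> : L (h + x) = L h + L x by have := linL 1 h x; rewrite !scale1r.
by rewrite addrK subrr normr0 mulr_ge0// ltW.
Unshelve. all: by end_near. Qed.

Lemma C_on_linear V W n (U : set V) (L : V -> W) :
  linear L -> continuous L -> C_on n U L.
Proof.
move=> linL cL; case: n => [|n] /=; first by move=> x _; exact: cL.
split=> [x _|v]; first by have [] := is_diff_linear x linL cL.
have -> : 'D_v L = (fun=> L v) :> (V -> W).
  by apply/funext => x; exact/is_diff_derive/is_diff_linear.
exact: C_on_cst.
Qed.

Lemma C_on_pr1 V W n (U : set (V * W)) : C_on n U (fst : V * W -> V).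
Proof. by apply: C_on_linear => // x; exact: cvg_fst. Qed.

Lemma C_on_pr2 V W n (U : set (V * W)) : C_on n U (snd : V * W -> W).
Proof. by apply: C_on_linear => // x; exact: cvg_snd. Qed.

Lemma C_onD V W n (U : set V) (f g : V -> W) : open U ->
  C_on n U f -> C_on n U g -> C_on n U (fun x => f x + g x).
Proof.
move=> oU; elim: n f g => [|n IH] f g /=.
  by move=> cf cg x Ux; apply: continuousD; [exact: cf|exact: cg].
move=> [df Cf] [dg Cg]; split=> [x Ux|v].
  by apply: differentiableD; [exact: df|exact: dg].
apply: (C_on_congr oU) (IH _ _ (Cf v) (Cg v)) => x; rewrite inE => Ux.
by rewrite -[LHS]deriveD//; apply: diff_derivable; [exact: df|exact: dg].
Qed.


Lemma C_onM V n (U : set V) (f g : V -> R) : open U ->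
  C_on n U f -> C_on n U g -> C_on n U (fun x => f x * g x).
Proof.
move=> oU; elim: n f g => [|n IH] f g Cf Cg /=.
  by move=> x Ux; apply: continuousM; [exact: Cf|exact: Cg].
have [df Df] := Cf; have [dg Dg] := Cg.
split=> [x Ux|v].
  by apply: differentiableM; [exact: df|exact: dg].
have := C_onD oU (IH _ _ (C_onW Cf) (Dg v)) (IH _ _ (Df v) (C_onW Cg)).
apply: C_on_congr => // x; rewrite inE => Ux.
have /= := @deriveM _ _ f g x v (diff_derivable (df x Ux)) (diff_derivable (dg x Ux)).
by move=> ->; congr (_ + _); rewrite mulrC.
Qed.

Lemma C_onN V W n (U : set V) (f : V -> W) : open U ->
  C_on n U f -> C_on n U (fun x => - f x).
Proof.
move=> oU; elim: n f => [|n IH] f /=.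
  by move=> cf x Ux; apply: continuousN; exact: cf.
move=> [df Cf]; split=> [x Ux|v]; first by apply: differentiableN; exact: df.
apply: (C_on_congr oU) (IH _ (Cf v)) => x; rewrite inE => Ux.
by rewrite -[LHS]deriveN//; apply: diff_derivable; exact: df.
Qed.

Lemma C_onB V W n (U : set V) (f g : V -> W) : open U ->
  C_on n U f -> C_on n U g -> C_on n U (fun x => f x - g x).
Proof. by move=> oU Cf Cg; apply: C_onD => //; exact: C_onN. Qed.

Lemma C_onX V n (U : set V) (f : V -> R) k : open U ->
  C_on n U f -> C_on n U (fun x => f x ^+ k).
Proof.
move=> oU Cf; elim: k => [|k IH]; first exact: C_on_cst.
apply: (C_on_congr oU) (C_onM oU Cf IH) => x _; by rewrite exprS.
Qed.

Lemma C_onMl V n (U : set V) (k : R) (f : V -> R) :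
  open U -> C_on n U f -> C_on n U (fun x => k * f x).
Proof. by move=> oU; apply: C_onM => //; exact: C_on_cst. Qed.

(** The derivative - f^-2 f' is again a polynomial in 1/f and f', so the induction hypothesis
    applies to 1/f itself. *)
Lemma C_onV V n (U : set V) (f : V -> R) : open U ->
  (forall x, U x -> f x != 0) ->
  C_on n U f -> C_on n U (fun x => (f x)^-1).
Proof.
move=> oU f0; elim: n => [|n IH] Cf /=.
  by move=> x Ux; apply: continuousV; [exact: f0|exact: Cf].
have [df Df] := Cf.
split=> [x Ux|v]; first by apply: differentiableV; [exact: df|exact: f0].
have C2 := C_onX 2 oU (IH (C_onW Cf)).
apply: (C_on_congr oU) (C_onN oU (C_onM oU C2 (Df v))) => x.
rewrite inE => Ux.
rewrite [RHS](@deriveV _ _ f x v (f0 x Ux) (diff_derivable (df x Ux))).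
by rewrite scaleNr exprVn.
Qed.

Lemma C_on_pair V W W' n (U : set V) (f : V -> W) (g : V -> W') : open U ->
  C_on n U f -> C_on n U g -> C_on n U (fun x => (f x, g x)).
Proof.
move=> oU; elim: n f g => [|n IH] f g /=.
  by move=> cf cg x Ux; apply: cvg_pair; [exact: cf|exact: cg].
move=> [df Cf] [dg Cg]; split=> [x Ux|v].
  by apply: differentiable_pair; [exact: df|exact: dg].
apply: (C_on_congr oU) (IH _ _ (Cf v) (Cg v)) => x; rewrite inE => Ux.
have dfx := df x Ux; have dgx := dg x Ux.
rewrite [RHS]deriveE; last exact: differentiable_pair.
by rewrite diff_pair// !deriveE.
Qed.

Lemma derive_comp_linear V V' W (f : V -> V') (L : V' -> W) x v :
  linear L -> continuous L -> differentiable f x ->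
  'D_v (L \o f) x = L ('D_v f x).
Proof.
move=> linL cL dfx; have [dLx dLE] := is_diff_linear (f x) linL cL.
rewrite deriveE; last exact: differentiable_comp.
by rewrite diff_comp// dLE /= deriveE.
Qed.

Lemma C_on_comp_linear V V' W n (U : set V) (f : V -> V') (L : V' -> W) :
  open U -> linear L -> continuous L -> C_on n U f ->
  C_on n U (fun x => L (f x)).
Proof.
move=> oU linL cL; elim: n f => [|n IH] f /=.
  by move=> cf x Ux; apply: continuous_comp; [exact: cf|exact: cL].
move=> [df Cf]; split=> [x Ux|v].
  by apply: differentiable_comp; [exact: df|have [] := is_diff_linear (f x) linL cL].
apply: (C_on_congr oU) (IH _ (Cf v)) => x; rewrite inE => Ux.
by rewrite -[RHS]/('D_v (L \o f) x) derive_comp_linear//; exact: df.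
Qed.

Lemma C_on_fst V W W' n (U : set V) (f : V -> W * W') : open U ->
  C_on n U f -> C_on n U (fun x => (f x).1).
Proof.
by move=> oU; apply: (@C_on_comp_linear _ _ _ n U f fst) => // x; exact: cvg_fst.
Qed.

Lemma C_on_snd V W W' n (U : set V) (f : V -> W * W') : open U ->
  C_on n U f -> C_on n U (fun x => (f x).2).
Proof.
by move=> oU; apply: (@C_on_comp_linear _ _ _ n U f snd) => // x; exact: cvg_snd.
Qed.

Lemma differentiable_fst V W W' (f : V -> W * W') x :
  differentiable f x -> differentiable (fun y => (f y).1) x.
Proof.
move=> df; apply: (@differentiable_comp _ _ _ _ f fst) => //.
have [h _] := @C_on_pr1 W W' 1 setT.
exact: h.
Qed.

Lemma differentiable_snd V W W' (f : V -> W * W') x :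
  differentiable f x -> differentiable (fun y => (f y).2) x.
Proof.
move=> df; apply: (@differentiable_comp _ _ _ _ f snd) => //.
have [h _] := @C_on_pr2 W W' 1 setT.
exact: h.
Qed.

Lemma derive_pair V W W' (f : V -> W * W') x v : differentiable f x ->
  'D_v f x = ('D_v (fun y => (f y).1) x, 'D_v (fun y => (f y).2) x).
Proof.
move=> df; have d1 := differentiable_fst df; have d2 := differentiable_snd df.
rewrite (deriveE _ d1) (deriveE _ d2) deriveE//.
rewrite -[RHS]/((fun h => ('d (fun y => (f y).1) x h, 'd (fun y => (f y).2) x h)) v).
rewrite -diff_pair//; congr ('d _ _ _).
by apply/funext => y; case: (f y).
Qed.

Lemma derive_comp_plane V W (f : V -> plane R) (g : plane R -> W) x v :
  differentiable f x -> differentiable g (f x) ->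
  'D_v (g \o f) x = ('D_v f x).1 *: 'D_((1, 0) : plane R) g (f x)
    + ('D_v f x).2 *: 'D_((0, 1) : plane R) g (f x).
Proof.
move=> df dg; rewrite !deriveE//; last exact: differentiable_comp.
rewrite diff_comp//= -!linearZ -linearD; congr ('d g _ _).
by rewrite [LHS]surjective_pairing; congr pair => /=;
  rewrite /GRing.scale/= !(mulr0, mulr1, addr0, add0r).
Qed.

Lemma derive_lin_plane W (g : plane R -> W) x v : differentiable g x ->
  'D_v g x = v.1 *: 'D_((1, 0) : plane R) g x
    + v.2 *: 'D_((0, 1) : plane R) g x.
Proof.
move=> dg; rewrite !deriveE// -!linearZ -linearD; congr ('d g _ _).
by rewrite [LHS]surjective_pairing; congr pair => /=;
  rewrite /GRing.scale/= !(mulr0, mulr1, addr0, add0r).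
Qed.

(** In the chain rule the direction ['D_v f x] moves with x. Expanding it in the basis leaves
    derivatives of [g] in two fixed directions, to which the induction hypothesis applies. *)
Lemma C_on_comp V n (U : set V) (O : set (plane R)) (f : V -> plane R)
    (g : plane R -> R) : open U -> open O -> (forall x, U x -> O (f x)) ->
  C_on n U f -> C_on n O g -> C_on n U (g \o f).
Proof.
move=> oU oO fUO; elim: n f g fUO => [|n IH] f g fUO Cf Cg.
  move=> x Ux; apply: continuous_comp; [exact: Cf|exact/Cg/fUO].
have [df Df] := Cf; have [dg Dg] := Cg; split=> [x Ux|v].
  by apply: differentiable_comp; [exact: df|exact/dg/fUO].
have C1 := C_on_fst oU (Df v); have C2 := C_on_snd oU (Df v).
have G1 := IH _ _ fUO (C_onW Cf) (Dg (1, 0)).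
have G2 := IH _ _ fUO (C_onW Cf) (Dg (0, 1)).
apply: (C_on_congr oU) (C_onD oU (C_onM oU C1 G1) (C_onM oU C2 G2)) => x.
by rewrite inE => Ux; rewrite derive_comp_plane//; [exact: df|exact/dg/fUO].
Qed.

Lemma C_on_atan V n (U : set V) (f : V -> R) : open U ->
  C_on n U f -> C_on n U (fun x => atan (f x)).
Proof.
move=> oU; case: n => [|n] Cf.
  by move=> x Ux; apply: continuous_comp; [exact: Cf|exact: continuous_atan].
have [df Df] := Cf.
have da y : differentiable (@atan R) y by apply/derivable1_diffP/derivable_atan.
split=> [x Ux|v]; first by apply: differentiable_comp; [exact: df|exact: da].
have d0 x : U x -> 1 + f x ^+ 2 != 0.
  by move=> _; rewrite lt0r_neq0// ltr_wpDr// sqr_ge0.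
have C2 := C_onV oU d0 (C_onD oU (C_on_cst _ _ (1 : R)) (C_onX 2 oU (C_onW Cf))).
apply: (C_on_congr oU) (C_onM oU C2 (Df v)) => x; rewrite inE => Ux.
have dfx := df x Ux.
rewrite [RHS]deriveE; last exact: differentiable_comp.
rewrite (@diff_comp _ _ _ _ f atan)//= deriv1E; last exact: derivable_atan.
by rewrite derive1_atan/= /GRing.scale/= mulrC deriveE.
Qed.

Lemma derive_left_inverse V W (f : V -> W) (g : W -> V) x v :
  differentiable f x -> differentiable g (f x) -> (\near x, g (f x) = x) ->
  'D_v f x = 0 -> v = 0.
Proof.
move=> df dg gf Df0; rewrite -[LHS](derive_id x v).
have <- : 'D_v (g \o f) x = 'D_v id x by exact: near_eq_derive.
rewrite deriveE; last exact: differentiable_comp.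
by rewrite diff_comp//= -(deriveE v df) Df0 linear0.
Qed.

End SmoothCalculus.

(** * The inverse function theorem in the plane *)

Section InverseFunction.
Variable R : realType.
Implicit Types (f g : plane R -> plane R) (h : plane R -> R) (x y : plane R).

Local Notation e1 := ((1, 0) : plane R).
Local Notation e2 := ((0, 1) : plane R).

Definition jac f x : R :=
  ('D_e1 f x).1 * ('D_e2 f x).2 - ('D_e1 f x).2 * ('D_e2 f x).1.

Lemma norm_plane_le x c : `|x| <= c = (`|x.1| <= c) && (`|x.2| <= c).
Proof. by rewrite prod_normE ge_max. Qed.

Lemma norm_fst_le x : `|x.1| <= `|x|.
Proof. by rewrite prod_normE le_max lexx. Qed.

Lemma norm_snd_le x : `|x.2| <= `|x|.
Proof. by rewrite prod_normE le_max lexx orbT. Qed.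

Lemma open_norm_ball (z : plane R) (e : R) : open [set y : plane R | `|y - z| < e].
Proof.
apply: (@open_comp _ _ (fun y : plane R => `|y - z|) [set t | t < e]); last exact: open_lt.
move=> y _; apply: (@continuous_comp _ _ _ (fun y : plane R => y - z) (fun y => `|y|)).
  by apply: continuousB; [exact: cvg_id|exact: cvg_cst].
exact: norm_continuous.
Qed.

(** The factor 2 comes from the sup norm: each partial derivative contributes [e] times the norm. *)
Lemma mean_value_plane h x y e :
  (forall t : R, t \in `[0, 1] -> differentiable h (y + t *: (x - y))) ->
  (forall t : R, t \in `[0, 1] -> `|'D_e1 h (y + t *: (x - y))| <= e /\
                             `|'D_e2 h (y + t *: (x - y))| <= e) ->
  `|h x - h y| <= 2 * e * `|x - y|.
Proof.
move=> dh he; pose p t := y + t *: (x - y).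
have dp (t : R) : is_diff t p (fun s => s *: (x - y)).
  apply: is_diff_eps => [a u v|u|e' e'0].
  - by rewrite scalerDl scalerA.
  - exact: scalel_continuous.
  - near=> s; rewrite /p scalerDl opprD addrACA subrr add0r addrK subrr.
    by rewrite normr0 mulr_ge0// ltW.
have dhp (t : R) : t \in `[0, 1] -> is_derive t 1 (h \o p) ('D_(x - y) h (p t)).
  move=> t01; have dht : differentiable h (p t) := dh t t01.
  have [dpt dpE] := dp t.
  have dc : differentiable (h \o p) t := differentiable_comp dpt dht.
  split; first exact/derivable1_diffP.
  by rewrite (deriveE _ dc) (diff_comp dpt dht) dpE /= scale1r deriveE.
have chp : {within `[0, 1], continuous (h \o p)}.
  apply: derivable_within_continuous => t t01.
  by have [] := dhp t t01.
pose dh1 (t : R) : R := 'D_(x - y) h (p t).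
have dhp1 (t : R) : t \in `]0, 1[ -> is_derive t 1 (h \o p : R -> R) (dh1 t).
  by move=> /subset_itv_oo_cc; exact: dhp.
have [c c01 hE] := MVT ltr01 dhp1 chp; move: hE.
rewrite /dh1 /p /= scale1r scale0r addr0 subr0 mulr1 (addrC y) subrK => ->.
have c01' := subset_itv_oo_cc c01.
rewrite derive_lin_plane; last exact: dh.
have [l1 l2] := he c c01'.
rewrite (le_trans (ler_normD _ _))// !normrZ -mulrA mulr_natl mulr2n.
by apply: lerD; rewrite mulrC; apply: ler_pM => //; [exact: norm_fst_le|exact: norm_snd_le].
Unshelve. all: by end_near. Qed.

(** Compactness replaces the contraction principle: a minimum point of the distance from f x to z
    must be a solution, because one approximate Newton step would at least halve the distance. *)
Lemma near_identity_surjective f x0 r : 0 < r ->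
  (forall x y, `|x - x0| <= r -> `|y - x0| <= r ->
     `|f x - f y - (x - y)| <= 2^-1 * `|x - y|) ->
  (forall x, `|x - x0| <= r -> {for x, continuous f}) ->
  forall z, `|z - f x0| < r / 8 -> exists2 x, `|x - x0| < r & f x = z.
Proof.
move=> r0 fr cf z zr.
have lip x y : `|x - x0| <= r -> `|y - x0| <= r -> `|x - y| <= 2 * `|f x - f y|.
  move=> xr yr; have := fr x y xr yr.
  have := lerB_dist (x - y) (f x - f y); rewrite (distrC (x - y)); lra.
(* A closed ball of the sup norm is a square, hence compact as a product of two segments. *)
pose B : set (plane R) := `[x0.1 - r, x0.1 + r] `*` `[x0.2 - r, x0.2 + r].
have BE x : B x <-> `|x - x0| <= r.
  rewrite norm_plane_le /B /= !in_itv/= !ler_distl.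
  by split=> [[-> ->]//|/andP[]].
have cB : compact B by apply: compact_setX; exact: segment_compact.
have B0 : B x0 by apply/BE; rewrite subrr normr0 ltW.
have cN : {within B, continuous (fun x => `|f x - z|)}.
  apply: continuous_in_subspaceT => x; rewrite inE => /BE xr.
  apply: (@continuous_comp _ _ _ (fun y => f y - z) (fun y => `|y|)).
    by apply: continuousB; [exact: cf|exact: cvg_cst].
  exact: norm_continuous.
have [x xB xmin] := compact_EVT_min (ex_intro _ x0 B0) cB cN.
have xr : `|x - x0| <= r by apply/BE; rewrite -inE.
have x0B : x0 \in B by rewrite inE.
have Nx : `|f x - z| < r / 8.
  by apply: le_lt_trans (xmin _ x0B) _; rewrite distrC.
have x0r : `|x0 - x0| <= r by rewrite subrr normr0 ltW.
(* f x and f x0 both lie within r/8 of z, and [lip] doubles their distance r/4 at most. The Newton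
   step below is shorter than r/8, so it stays in the ball. *)
have xx0 : `|x - x0| < r / 2.
  have := lip _ _ xr x0r.
  have := ler_distD z (f x) (f x0); lra.
exists x; first by lra.
pose x' := x - (f x - z).
have x'r : `|x' - x0| <= r.
  rewrite /x' addrAC; have := ler_normB (x - x0) (f x - z); lra.
have x'B : x' \in B by rewrite inE; apply/BE.
have := xmin _ x'B.
have := fr _ _ x'r xr.
have -> : x' - x = - (f x - z) by rewrite /x' addrAC subrr add0r.
rewrite opprK addrA subrK.
rewrite normrN => h1 h2.
have : `|f x - z| <= 0 by lra.
by rewrite normr_le0 subr_eq0 => /eqP.
Qed.


(** Cramer's rule for the matrix with columns [p1] and [p2]. For dependent columns [0^-1 = 0] makes
    it the zero map, so linearity and boundedness hold in every case. *)
Definition plane_inv (p1 p2 y : plane R) : plane R :=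
  (p1.1 * p2.2 - p1.2 * p2.1)^-1 *:
    (p2.2 * y.1 - p2.1 * y.2, p1.1 * y.2 - p1.2 * y.1).

Lemma plane_invE p1 p2 y : p1.1 * p2.2 - p1.2 * p2.1 != 0 ->
  (plane_inv p1 p2 y).1 *: p1 + (plane_inv p1 p2 y).2 *: p2 = y.
Proof.
move=> J0; rewrite [RHS]surjective_pairing; congr pair;
by rewrite /plane_inv /= /GRing.scale/=; field.
Qed.

Lemma plane_inv_inj p1 p2 : p1.1 * p2.2 - p1.2 * p2.1 != 0 ->
  injective (plane_inv p1 p2).
Proof. by move=> J0 y z yz; rewrite -(plane_invE y J0) yz plane_invE. Qed.

Lemma plane_invK p1 p2 y : p1.1 * p2.2 - p1.2 * p2.1 != 0 ->
  plane_inv p1 p2 (y.1 *: p1 + y.2 *: p2) = y.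
Proof.
move=> J0; rewrite [RHS]surjective_pairing; congr pair;
by rewrite /plane_inv /= /GRing.scale/=; field.
Qed.

Lemma plane_inv_linear p1 p2 : linear (plane_inv p1 p2).
Proof.
move=> k u v; rewrite [LHS]surjective_pairing [RHS]surjective_pairing.
by congr pair; rewrite /plane_inv /= /GRing.scale/=; ring.
Qed.

Lemma plane_inv_bound p1 p2 :
  exists2 K, 0 < K & forall y, `|plane_inv p1 p2 y| <= K * `|y|.
Proof.
pose D := `|(p1.1 * p2.2 - p1.2 * p2.1)^-1|.
pose S := `|p1.1| + `|p1.2| + `|p2.1| + `|p2.2|.
have D0 : 0 <= D by rewrite normr_ge0.
have S0 : 0 <= S by rewrite !addr_ge0 ?normr_ge0.
exists (D * S + 1); first by rewrite ltr_wpDl// mulr_ge0.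
move=> y; rewrite /plane_inv normrZ -/D.
apply: (@le_trans _ _ (D * (S * `|y|))); last first.
  by rewrite mulrA ler_wpM2r// lerDl.
rewrite ler_wpM2l// norm_plane_le /=.
have y1 := norm_fst_le y; have y2 := norm_snd_le y.
have b (u v : R) w1 w2 : `|w1| <= `|y| -> `|w2| <= `|y| -> `|u| + `|v| <= S ->
    `|u * w1 - v * w2| <= S * `|y|.
  move=> h1 h2 h; apply: (@le_trans _ _ ((`|u| + `|v|) * `|y|)).
    rewrite (le_trans (ler_normB _ _))// !normrM mulrDl.
    by apply: lerD; exact: ler_wpM2l.
  by apply: ler_wpM2r.
have := normr_ge0 p1.1; have := normr_ge0 p1.2.
have := normr_ge0 p2.1; have := normr_ge0 p2.2 => *.
by apply/andP; split; apply: b => //; rewrite /S; lra.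
Qed.

Lemma bounded_linear_cont (V W : normedModType R) (L : V -> W) K :
  linear L -> 0 < K -> (forall v, `|L v| <= K * `|v|) -> continuous L.
Proof.
move=> linL K0 bL v; apply/cvgrPdist_le => e e0; near=> w.
have -> : L v - L w = L (v - w).
  by have := linL (- 1) w v; rewrite !scaleN1r ![- _ + _]addrC.
apply: le_trans (bL _) _; rewrite mulrC -ler_pdivlMr//; near: w.
by apply: cvgr_dist_le; [exact: cvg_id|rewrite divr_gt0].
Unshelve. all: by end_near. Qed.

(** The increment k of [g] satisfies h = Df k + o(k). Applying the inverse of Df gives k up to o(k),
    and the Lipschitz bound turns o(k) into o(h). *)
Lemma inverse_is_diff f g (V : set (plane R)) y K :
  open V -> V y -> (forall z, V z -> f (g z) = z) ->
  differentiable f (g y) -> jac f (g y) != 0 ->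
  0 < K -> (forall z, V z -> `|g z - g y| <= K * `|z - y|) ->
  is_diff y g (plane_inv ('D_e1 f (g y)) ('D_e2 f (g y))).
Proof.
move=> oV Vy fg df J0 K0 lipg.
set L := plane_inv _ _; have linL : linear L := plane_inv_linear _ _.
have [C C0 bL] : exists2 C, 0 < C & forall v, `|L v| <= C * `|v|.
  exact: plane_inv_bound.
apply: is_diff_eps => //; first exact: bounded_linear_cont bL.
move=> e e0; set x := g y.
have nV : \forall h \near (0 : plane R), V (h + y).
  have : \forall z \near y, V z by exact: open_nbhs_nbhs.
  by rewrite (near_shift 0)/= subr0.
(* [C] is lost in applying the inverse matrix and [K] in passing from the increment of [g] to
   [h]. *)
have e'0 : 0 < e / (C * K) by rewrite divr_gt0// mulr_gt0.
have /eqaddoP/(_ _ e'0) := diff_locally df.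
move=> /nbhs_normP[d d0 hd].
have nd : \forall h \near (0 : plane R), `|h| < d / K.
  apply/nbhs_normP; exists (d / K); first by rewrite /= divr_gt0.
  by move=> z /=; rewrite sub0r normrN.
near=> h.
have Vh : V (h + y) by near: h.
set k := g (h + y) - x.
have kh : `|k| <= K * `|h| by have := lipg _ Vh; rewrite addrK.
have kd : `|0 - k| < d.
  by rewrite sub0r normrN (le_lt_trans kh)// mulrC -ltr_pdivlMr//; near: h.
have := hd k kd; rewrite /= !fctE/= /k subrK (fg _ Vh) (fg _ Vy).
rewrite opprD addrA addrK -/k -deriveE// derive_lin_plane// => hk.
have E : L (h - (k.1 *: 'D_e1 f x + k.2 *: 'D_e2 f x)) = L h - k.
  have lB u v : L (u - v) = L u - L v.
    by have := linL (- 1) v u; rewrite !scaleN1r ![- _ + _]addrC.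
  by rewrite lB /L plane_invK.
have -> : g (h + y) - g y - L h = - (L h - k) by rewrite opprB.
rewrite normrN -E; apply: le_trans (bL _) _.
apply: (@le_trans _ _ (C * (e / (C * K) * `|k|))); first by rewrite ler_wpM2l// ltW.
apply: (@le_trans _ _ (C * (e / (C * K) * (K * `|h|)))).
  by rewrite !ler_wpM2l// ltW.
by rewrite le_eqVlt; apply/orP; left; apply/eqP; field; rewrite !gt_eqF.
Unshelve. all: by end_near. Qed.

(** Bootstrapping: the derivative of [g] is a rational expression in the derivatives of [f]
    evaluated at [g], so it is as smooth as [g] is already known to be. *)
Lemma inverse_smooth f g (N V : set (plane R)) :
  open N -> open V -> smooth_on N f -> (forall x, N x -> jac f x != 0) ->
  (forall y, V y -> N (g y) /\ f (g y) = y) ->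
  (exists2 K, 0 < K & forall y z, V y -> V z -> `|g z - g y| <= K * `|z - y|) ->
  smooth_on V g.
Proof.
move=> oN oV Sf Jf gV [K K0 lipg].
have [df Df] := Sf 1%N.
have dg y : V y -> is_diff y g (plane_inv ('D_e1 f (g y)) ('D_e2 f (g y))).
  move=> Vy; have [Ngy fgy] := gV y Vy.
  apply: (@inverse_is_diff f g V y K) => //.
  - by move=> z /gV[].
  - exact: df.
  - exact: Jf.
  - by move=> z Vz; exact: lipg.
elim=> [|n IH]; first by move=> y Vy; have [d _] := dg y Vy; exact: differentiable_continuous.
split=> [y Vy|v]; first by have [] := dg y Vy.
have comp (h : plane R -> R) : (forall k, C_on k N h) -> C_on n V (h \o g).
  by move=> Sh; apply: C_on_comp IH (Sh n) => // y /gV[].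
have S1 w k : C_on k N (fun x => ('D_w f x).1).
  by have [_ /(_ w)] := Sf k.+1; exact: C_on_fst.
have S2 w k : C_on k N (fun x => ('D_w f x).2).
  by have [_ /(_ w)] := Sf k.+1; exact: C_on_snd.
have SJ k : C_on k N (fun x => (jac f x)^-1).
  by apply: C_onV => //; apply: C_onB => //; apply: C_onM.
have CJ := comp _ SJ.
have C11 := comp _ (S1 e1); have C12 := comp _ (S2 e1).
have C21 := comp _ (S1 e2); have C22 := comp _ (S2 e2).
apply: (@C_on_congr _ _ _ n V (fun y => (
  (jac f (g y))^-1 * (v.1 * ('D_e2 f (g y)).2 - v.2 * ('D_e2 f (g y)).1),
  (jac f (g y))^-1 * (v.2 * ('D_e1 f (g y)).1 - v.1 * ('D_e1 f (g y)).2)))) => //.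
  move=> y; rewrite inE => Vy; rewrite (is_diff_derive v (dg y Vy)).
  rewrite /plane_inv /jac; congr pair; rewrite /= /GRing.scale/=; ring.
exact: (C_on_pair oV
  (C_onM oV CJ (C_onB oV (C_onMl v.1 oV C22) (C_onMl v.2 oV C21)))
  (C_onM oV CJ (C_onB oV (C_onMl v.2 oV C11) (C_onMl v.1 oV C12)))).
Qed.

(** Composition with the inverse [A] of the differential at [x0] reduces to a map [phi] near the
    identity; [psi] is its deviation, whose differential vanishes at [x0]. *)
Lemma inverse_function f (U : set (plane R)) x0 :
  open U -> smooth_on U f -> (forall x, U x -> jac f x != 0) -> U x0 ->
  exists (N : set (plane R)) g,
    [/\ open N, N x0, N `<=` U & open (f @` N)] /\
    (forall x, N x -> g (f x) = x) /\ smooth_on (f @` N) g.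
Proof.
move=> oU Sf Jf Ux0; have J0 := Jf x0 Ux0.
have [df Df] := Sf 1%N.
set p1 := 'D_e1 f x0; set p2 := 'D_e2 f x0.
pose A := plane_inv p1 p2.
have linA : linear A := plane_inv_linear _ _.
have AB u v : A u - A v = A (u - v).
  by have := linA (- 1) v u; rewrite !scaleN1r ![- _ + _]addrC.
have [K K0 bA] : exists2 K, 0 < K & forall v, `|A v| <= K * `|v|.
  exact: plane_inv_bound.
have cA : continuous A := bounded_linear_cont linA K0 bA.
pose phi := A \o f.
have Cphi k : C_on k U phi by apply: C_on_comp_linear.
have [dphi Dphi] := Cphi 1%N.
pose psi := phi - id.
have Cpsi k : C_on k U psi.
  by apply: C_onB => //; apply: C_on_linear => // x; exact: cvg_id.
have [dpsi Dpsi] := Cpsi 1%N.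
have Dpsi0 v : 'D_v psi x0 = 0.
  rewrite /psi deriveB; [|exact/diff_derivable/dphi|exact: derivable_id].
  rewrite derive_comp_linear//; last exact: df.
  rewrite derive_lin_plane; last exact: df.
  by rewrite /A plane_invK// derive_id subrr.
(* With the factor 2 of [mean_value_plane], the bound 1/4 gives the Lipschitz constant 1/2 required
   by [near_identity_surjective]. *)
have small v : \forall x \near x0, `|'D_v psi x| <= 4^-1.
  have cv : {for x0, continuous ('D_v psi)} by exact: (Dpsi v).
  near=> x; rewrite -[X in `|X|]subr0 -(Dpsi0 v) distrC; near: x.
  by apply: cvgr_dist_le cv _ _.
have nU : \forall x \near x0, U x by exact: open_nbhs_nbhs.
have /nbhs_normP[r0 r00 hr0] : \forall x \near x0,
    [/\ U x, `|'D_e1 psi x| <= 4^-1 & `|'D_e2 psi x| <= 4^-1].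
  by apply: filterS3 nU (small e1) (small e2) => x Ux b1 b2; split.
pose r := r0 / 2; have r_gt0 : 0 < r by rewrite divr_gt0.
have hr x : `|x - x0| <= r -> [/\ U x, `|'D_e1 psi x| <= 4^-1 & `|'D_e2 psi x| <= 4^-1].
  move=> xr; apply: hr0; rewrite /= distrC (le_lt_trans xr)//.
  by rewrite /r ltr_pdivrMr// ltr_pMr// ltr1n.
have seg x y (t : R) : `|x - x0| <= r -> `|y - x0| <= r -> t \in `[0, 1] ->
    `|y + t *: (x - y) - x0| <= r.
  move=> xr yr; rewrite in_itv/= => /andP[t0 t1].
  have -> : y + t *: (x - y) - x0 = t *: (x - x0) + (1 - t) *: (y - x0).
    by rewrite [LHS]surjective_pairing [RHS]surjective_pairing;
       congr pair; rewrite /= /GRing.scale/=; ring.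
  rewrite (le_trans (ler_normD _ _))// !normrZ !ger0_norm ?subr_ge0//.
  have : t * `|x - x0| <= t * r by rewrite ler_wpM2l.
  have : (1 - t) * `|y - x0| <= (1 - t) * r by rewrite ler_wpM2l// subr_ge0.
  lra.
have cfst : continuous (fst : plane R -> R) by move=> z; exact: cvg_fst.
have csnd : continuous (snd : plane R -> R) by move=> z; exact: cvg_snd.
have phir x y : `|x - x0| <= r -> `|y - x0| <= r ->
    `|phi x - phi y - (x - y)| <= 2^-1 * `|x - y|.
  move=> xr yr.
  have -> : phi x - phi y - (x - y) = psi x - psi y.
    by rewrite /psi !fctE/= !opprD !opprK addrACA.
  have comp (p : plane R -> R) : linear p -> continuous p ->
      (forall z, `|p z| <= `|z|) ->
      `|(p \o psi) x - (p \o psi) y| <= 2 * 4^-1 * `|x - y|.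
    move=> linp cp pz; apply: mean_value_plane => t t01.
      have [Ut _ _] := hr _ (seg _ _ _ xr yr t01).
      apply: differentiable_comp; first exact: dpsi.
      by have [] := is_diff_linear (psi (y + t *: (x - y))) linp cp.
    have [Ut b1 b2] := hr _ (seg _ _ _ xr yr t01).
    have E v := derive_comp_linear v linp cp (dpsi _ Ut).
    split.
      have E1 := E e1.
      rewrite E1.
      exact: le_trans (pz _) b1.
    rewrite (E e2).
    exact: le_trans (pz _) b2.
  have -> : 2^-1 = 2 * 4^-1 :> R by field.
  rewrite norm_plane_le; apply/andP; split.
    by apply: (comp fst) => // z; exact: norm_fst_le.
  by apply: (comp snd) => // z; exact: norm_snd_le.
have lip x y : `|x - x0| <= r -> `|y - x0| <= r -> `|x - y| <= 2 * K * `|f x - f y|.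
  move=> xr yr; have := phir x y xr yr.
  have := lerB_dist (x - y) (phi x - phi y); rewrite (distrC (x - y)).
  have := bA (f x - f y); rewrite -AB -/(phi x) -/(phi y).
  by rewrite -mulrA; set q := K * _; lra.
pose rho := r / (8 * K); have rho0 : 0 < rho by rewrite divr_gt0// mulr_gt0.
(* The second condition makes the image of [N] a full ball, hence open. Its radius [rho] is such
   that [A] maps that ball into one of radius r/8, where solutions are known to exist. *)
pose N : set (plane R) := [set x | `|x - x0| < r /\ `|f x - f x0| < rho].
have fN : f @` N = [set y | `|y - f x0| < rho].
  apply/seteqP; split=> [_ [x [xr fx] <-]//|y /= yr].
  have [||x xr phix] := near_identity_surjective r_gt0 phir _ (z := A y).
  - by move=> x /hr[Ux _ _]; exact/differentiable_continuous/dphi.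
  - rewrite /phi /= AB (le_lt_trans (bA _))// mulrC -ltr_pdivlMr//.
    by rewrite -mulrA -invfM.
  have fxy : f x = y.
    exact: (plane_inv_inj J0 phix).
  by exists x => //; split => //; rewrite fxy.
have oB := @open_norm_ball.
have NU : N `<=` U by move=> x [/ltW/hr[]].
have oN : open N.
  rewrite openE => x [xr fx]; have Ux : U x by apply: NU.
  have cfx : {for x, continuous f} by apply: differentiable_continuous; exact: df.
  have n1 : \forall y \near x, `|y - x0| < r.
    exact: (open_nbhs_nbhs (conj (oB x0 r) xr)).
  have n2 : \forall y \near x, `|f y - f x0| < rho.
    exact: (cfx _ (open_nbhs_nbhs (conj (oB (f x0) rho) fx))).
  by near=> y; split; near: y.
have injf x y : N x -> N y -> f x = f y -> x = y.
  move=> [/ltW xr _] [/ltW yr _] fxy; apply/eqP; rewrite -subr_eq0 -normr_le0.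
  by have := lip x y xr yr; rewrite fxy subrr normr0 mulr0.
pose g y := get [set x | N x /\ f x = y].
have gP y : (f @` N) y -> N (g y) /\ f (g y) = y.
  by move=> [x Nx fx]; apply: (@getPex _ [set x | N x /\ f x = y]); exists x.
have gf x : N x -> g (f x) = x.
  move=> Nx; have [Ng fg] := gP (f x) (ex_intro2 _ _ x Nx erefl).
  exact: injf.
exists N, g; split; first split => //.
- by split; rewrite subrr normr0.
- by rewrite fN; exact: oB.
split; first exact: gf.
have oV : open (f @` N) by rewrite fN; exact: oB.
apply: (inverse_smooth oN oV _ _ gP).
- by move=> k; exact: C_onS NU (Sf k).
- by move=> x /NU; exact: Jf.
exists (2 * K); first by rewrite mulr_gt0.
move=> y z /gP[[/ltW yr _] fy] /gP[[/ltW zr _] fz].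
by have := lip _ _ zr yr; rewrite fy fz.
Unshelve. all: by end_near. Qed.


End InverseFunction.

(** * Integrals depending on a parameter *)

Section BoundedMeasurable.
Context d (T : measurableType d) (R : realType).
Variables (mu : {measure set T -> \bar R}) (D : set T).
Hypotheses (mD : measurable D) (fD : (mu D < +oo)%E).
Implicit Types (f g : T -> R) (k l : T -> plane R -> R) (C : R).

(** On a set of finite measure this implies integrability and, unlike integrability, it is stable
    under products, so that any polynomial in the kernel can be integrated. *)
Definition bounded_measurable f :=
  measurable_fun D f /\ exists C, forall t, D t -> `|f t| <= C.

Local Notation bmeas := bounded_measurable.

Lemma bmeas_cst (c : R) : bmeas (fun=> c).
Proof. by split; [exact: measurable_cst|exists `|c|]. Qed.

Lemma bmeasM f g : bmeas f -> bmeas g -> bmeas (fun t => f t * g t).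
Proof.
move=> [mf [C fC]] [mg [C' gC]]; split; first exact: measurable_funM.
by exists (C * C') => t Dt; rewrite normrM ler_pM// ?fC ?gC.
Qed.

Lemma bmeasD f g : bmeas f -> bmeas g -> bmeas (fun t => f t + g t).
Proof.
move=> [mf [C fC]] [mg [C' gC]]; split; first exact: measurable_funD.
exists (C + C') => t Dt; rewrite (le_trans (ler_normD _ _))// lerD// ?fC ?gC//.
Qed.

Lemma bmeasB f g : bmeas f -> bmeas g -> bmeas (fun t => f t - g t).
Proof.
move=> [mf [C fC]] [mg [C' gC]]; split; first exact: measurable_funB.
exists (C + C') => t Dt; rewrite (le_trans (ler_normB _ _))// lerD// ?fC ?gC//.
Qed.

Lemma bmeasX f n : bmeas f -> bmeas (fun t => f t ^+ n).
Proof.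
move=> [mf [C fC]]; split; first exact: measurable_funX.
by exists (C ^+ n) => t Dt; rewrite normrX lerXn2r ?nnegrE ?fC// (le_trans _ (fC t Dt)).
Qed.

Lemma bmeasV f (c : R) : 0 < c -> (forall t, D t -> c <= f t) -> bmeas f ->
  bmeas (fun t => (f t)^-1).
Proof.
move=> c0 fc [mf _]; split.
  apply: (@measurable_comp _ _ _ _ _ _ (`]0, +oo[%classic : set R) (fun x : R => x^-1) D f) => //.
  - by move=> _ [t Dt <-]; rewrite /= in_itv/= andbT (lt_le_trans c0)// fc.
  - apply: open_continuous_measurable_fun => // x; rewrite inE/= in_itv/= andbT => x0.
    by apply: (@continuousV _ _ id); [rewrite gt_eqF|exact: cvg_id].
exists c^-1 => t Dt; have f0 : 0 < f t by rewrite (lt_le_trans c0)// fc.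
have f1 : 0 <= (f t)^-1 by rewrite invr_ge0 ltW.
by rewrite ger0_norm// lef_pV2 ?posrE// fc.
Qed.

Lemma bmeas_integrable f : bmeas f -> mu.-integrable D (EFin \o f).
Proof.
move=> [mf [C fC]]; apply: measurable_bounded_integrable => //.
exists C; split; first exact: num_real.
by move=> M CM t Dt /=; apply: le_trans (fC t Dt) (ltW CM).
Qed.

Local Notation "\I f" := (\int[mu]_(t in D) f t) (at level 10).

Lemma RintegralD_bmeas f g : bmeas f -> bmeas g ->
  \I (fun t => f t + g t) = \I f + \I g.
Proof. by move=> bf bg; apply: RintegralD => //; exact: bmeas_integrable. Qed.

Lemma RintegralB_bmeas f g : bmeas f -> bmeas g ->
  \I (fun t => f t - g t) = \I f - \I g.
Proof. by move=> bf bg; apply: RintegralB => //; exact: bmeas_integrable. Qed.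

Lemma RintegralZ_bmeas (a : R) f : bmeas f -> \I (fun t => a * f t) = a * \I f.
Proof. by move=> bf; apply: RintegralZl => //; exact: bmeas_integrable. Qed.

Lemma Rintegral_bound f C : bmeas f -> (forall t, D t -> `|f t| <= C) ->
  `|\I f| <= C * fine (mu D).
Proof.
move=> bf fC; have bnf : bmeas (fun t => `|f t|).
  have [mf [C' fC']] := bf; split; first exact: measurableT_comp.
  by exists C' => t Dt; rewrite normr_id fC'.
rewrite (le_trans (le_normr_Rintegral mD (bmeas_integrable bf)))//.
rewrite -(Rintegral_cst mu mD); apply: le_Rintegral => //.
  exact: bmeas_integrable bnf.
exact: bmeas_integrable (bmeas_cst C).
Qed.

(* A uniform quadratic remainder, rather than o(h), makes differentiation under
   the integral sign an estimate that is stable under products and inverses. *)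
Definition uniform_diff (k : T -> plane R -> R) (k1 k2 : T -> R) (p : plane R) :=
  exists2 C : R, 0 <= C & forall t, D t ->
    [/\ `|k t p| <= C, `|k1 t| <= C, `|k2 t| <= C
      & forall h : plane R, `|h| <= 1 ->
        `|k t (h + p) - k t p - (k1 t * h.1 + k2 t * h.2)| <= C * `|h| ^+ 2].

Lemma uniform_diff_grad_bound (a b C : R) (h : plane R) : 0 <= C -> `|a| <= C ->
  `|b| <= C -> `|a * h.1 + b * h.2| <= 2 * C * `|h|.
Proof.
move=> C0 aC bC; rewrite (le_trans (ler_normD _ _))// !normrM -mulrA mulr_natl mulr2n.
by apply: lerD; apply: ler_pM => //; [exact: norm_fst_le|exact: norm_snd_le].
Qed.

Lemma uniform_diffD k (k1 k2 : T -> R) l (l1 l2 : T -> R) p :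
  uniform_diff k k1 k2 p -> uniform_diff l l1 l2 p ->
  uniform_diff (fun t q => k t q + l t q) (fun t => k1 t + l1 t)
    (fun t => k2 t + l2 t) p.
Proof.
move=> [C C0 kC] [C' C'0 lC]; exists (C + C'); first by rewrite addr_ge0.
move=> t Dt; have [a b c e] := kC t Dt; have [a' b' c' e'] := lC t Dt.
split; try by rewrite (le_trans (ler_normD _ _))// lerD.
move=> h h1; rewrite [leRHS]mulrDl.
have -> : k t (h + p) + l t (h + p) - (k t p + l t p)
   - ((k1 t + l1 t) * h.1 + (k2 t + l2 t) * h.2)
  = (k t (h + p) - k t p - (k1 t * h.1 + k2 t * h.2))
  + (l t (h + p) - l t p - (l1 t * h.1 + l2 t * h.2)) by ring.
by rewrite (le_trans (ler_normD _ _))// lerD// ?e ?e'.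
Qed.

Lemma uniform_diff_add_bound k (k1 k2 : T -> R) C p t (h : plane R) : 0 <= C -> `|h| <= 1 ->
  `|k t p| <= C -> `|k1 t| <= C -> `|k2 t| <= C ->
  `|k t (h + p) - k t p - (k1 t * h.1 + k2 t * h.2)| <= C * `|h| ^+ 2 ->
  `|k t (h + p) - k t p| <= 3 * C * `|h| /\ `|k t (h + p)| <= 4 * C.
Proof.
move=> C0 h1 a b c e.
have g := uniform_diff_grad_bound h C0 b c.
have hh : C * `|h| ^+ 2 <= C * `|h|.
  by rewrite ler_wpM2l// expr2 ler_piMl.
have Ch : C * `|h| <= C by rewrite ler_piMr.
have kd : `|k t (h + p) - k t p| <= 3 * C * `|h|.
  rewrite -[X in `|X|](subrK (k1 t * h.1 + k2 t * h.2)).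
  rewrite (le_trans (ler_normD _ _))//; lra.
split=> //; rewrite -[X in `|X|](subrK (k t p)).
rewrite (le_trans (ler_normD _ _))//; lra.
Qed.

Lemma uniform_diffM k (k1 k2 : T -> R) l (l1 l2 : T -> R) p :
  uniform_diff k k1 k2 p -> uniform_diff l l1 l2 p ->
  uniform_diff (fun t q => k t q * l t q) (fun t => k1 t * l t p + k t p * l1 t)
    (fun t => k2 t * l t p + k t p * l2 t) p.
Proof.
move=> [A A0 kA] [B B0 lB]; pose C := A + B + 1.
have C1 : 1 <= C by rewrite lerDr addr_ge0.
have C0 : 0 <= C by rewrite (le_trans ler01).
have AC : A <= C by rewrite /C -addrA lerDl addr_ge0.
have BC : B <= C by rewrite /C addrAC lerDr addr_ge0.
have CC : C <= C ^+ 2 by rewrite expr2 ler_peMl.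
(* 11 = 4 + 1 + 6, the contributions of [E1], [E2] and [E3]. *)
exists (11 * C ^+ 2); first by rewrite mulr_ge0// exprn_ge0.
move=> t Dt; have [a b c e] := kA t Dt; have [a' b' c' e'] := lB t Dt.
have {}a := le_trans a AC; have {}b := le_trans b AC; have {}c := le_trans c AC.
have {}a' := le_trans a' BC; have {}b' := le_trans b' BC; have {}c' := le_trans c' BC.
have C2 (x y : R) : `|x| <= C -> `|y| <= C -> `|x * y| <= C ^+ 2.
  by move=> xC yC; rewrite normrM expr2 ler_pM.
have C20 : 0 <= C ^+ 2 by rewrite exprn_ge0.
split.
- have := C2 _ _ a a'; lra.
- rewrite (le_trans (ler_normD _ _))//.
  by have := C2 _ _ b a'; have := C2 _ _ a b'; lra.
- rewrite (le_trans (ler_normD _ _))//.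
  by have := C2 _ _ c a'; have := C2 _ _ a c'; lra.
move=> h h1; set H := `|h|; have H0 : 0 <= H by exact: normr_ge0.
have eC : `|k t (h + p) - k t p - (k1 t * h.1 + k2 t * h.2)| <= C * `|h| ^+ 2.
  by rewrite (le_trans (e h h1))// ler_wpM2r// exprn_ge0.
have eC' : `|l t (h + p) - l t p - (l1 t * h.1 + l2 t * h.2)| <= C * `|h| ^+ 2.
  by rewrite (le_trans (e' h h1))// ler_wpM2r// exprn_ge0.
have [kd k4] := uniform_diff_add_bound C0 h1 a b c eC.
have [ld l4] := uniform_diff_add_bound C0 h1 a' b' c' eC'.
have gl := uniform_diff_grad_bound h C0 b' c'.
have gk := uniform_diff_grad_bound h C0 b c.
set Lk := k1 t * h.1 + k2 t * h.2 in eC gk.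
set Ll := l1 t * h.1 + l2 t * h.2 in eC' gl.
have -> : k t (h + p) * l t (h + p) - k t p * l t p
   - ((k1 t * l t p + k t p * l1 t) * h.1 + (k2 t * l t p + k t p * l2 t) * h.2)
  = (k t (h + p) - k t p - Lk) * l t (h + p)
   + (k t p * (l t (h + p) - l t p - Ll) + Lk * (l t (h + p) - l t p)).
  by rewrite /Lk /Ll; ring.
have E1 : `|(k t (h + p) - k t p - Lk) * l t (h + p)| <= (C * H ^+ 2) * (4 * C).
  by rewrite normrM ler_pM.
have E2 : `|k t p * (l t (h + p) - l t p - Ll)| <= C * (C * H ^+ 2).
  by rewrite normrM ler_pM.
have E3 : `|Lk * (l t (h + p) - l t p)| <= (2 * C * H) * (3 * C * H).
  by rewrite normrM ler_pM.
rewrite (le_trans (ler_normD _ _))//.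
have := ler_normD (k t p * (l t (h + p) - l t p - Ll)) (Lk * (l t (h + p) - l t p)).
move=> E4.
have -> : 11 * C ^+ 2 * H ^+ 2 = C * H ^+ 2 * (4 * C) + (C * (C * H ^+ 2) + 2 * C * H * (3 * C * H)) by ring.
by rewrite lerD// (le_trans E4)// lerD.
Qed.

Lemma uniform_diffV k (k1 k2 : T -> R) p (c : R) : 0 < c ->
  (forall t h, D t -> `|h| <= 1 -> c <= k t (h + p)) ->
  uniform_diff k k1 k2 p ->
  uniform_diff (fun t q => (k t q)^-1) (fun t => - (k t p)^-1 ^+ 2 * k1 t)
    (fun t => - (k t p)^-1 ^+ 2 * k2 t) p.
Proof.
move=> c0 kc [C C0 kC]; pose B := c^-1.
have B0 : 0 <= B by rewrite invr_ge0 ltW.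
have K (t : T) h : D t -> `|h| <= 1 -> k t (h + p) != 0 /\ `|(k t (h + p))^-1| <= B.
  move=> Dt h1; have k0 : 0 < k t (h + p) by rewrite (lt_le_trans c0)// kc.
  have k1' : 0 <= (k t (h + p))^-1 by rewrite invr_ge0 ltW.
  by split; rewrite ?gt_eqF// ger0_norm// lef_pV2 ?posrE// kc.
(* The three terms bound the value, the gradient and the product of increments; the last two
   together bound the remainder. *)
exists (B + B ^+ 2 * C + 6 * B ^+ 3 * C ^+ 2).
  by rewrite !addr_ge0// ?mulr_ge0// ?exprn_ge0.
move=> t Dt; have [ka k1C k2C e] := kC t Dt.
have [k0 kB] : k t p != 0 /\ `|(k t p)^-1| <= B.
  by have := K t 0 Dt; rewrite normr0 add0r; apply.
have B2 : 0 <= B ^+ 2 * C by rewrite mulr_ge0// exprn_ge0.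
have B3 : 0 <= 6 * B ^+ 3 * C ^+ 2 by rewrite !mulr_ge0// exprn_ge0.
have kB2 : `|(k t p)^-1 ^+ 2| <= B ^+ 2 by rewrite normrX lerXn2r ?nnegrE.
split.
- lra.
- rewrite normrM normrN; have : `|(k t p)^-1 ^+ 2| * `|k1 t| <= B ^+ 2 * C by rewrite ler_pM.
  lra.
- rewrite normrM normrN; have : `|(k t p)^-1 ^+ 2| * `|k2 t| <= B ^+ 2 * C by rewrite ler_pM.
  lra.
move=> h h1; have [k'0 k'B] := K t h Dt h1.
have eh := e h h1; set H := `|h| in eh *.
have [kd k4] := uniform_diff_add_bound C0 h1 ka k1C k2C eh.
have gk := uniform_diff_grad_bound h C0 k1C k2C.
set L := k1 t * h.1 + k2 t * h.2 in eh gk.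
(* Only second-order terms are left on the right: the remainder of k and a product of two
   increments. *)
have -> : (k t (h + p))^-1 - (k t p)^-1 -
    (- (k t p)^-1 ^+ 2 * k1 t * h.1 + - (k t p)^-1 ^+ 2 * k2 t * h.2) =
  - ((k t (h + p))^-1 * (k t p)^-1 * (k t (h + p) - k t p - L))
  + (k t (h + p))^-1 * (k t p)^-1 ^+ 2 * (L * (k t (h + p) - k t p)).
  by rewrite /L; field; rewrite k0 k'0.
have H0 : 0 <= H by exact: normr_ge0.
have E1 : `|(k t (h + p))^-1 * (k t p)^-1 * (k t (h + p) - k t p - L)|
    <= (B * B) * (C * H ^+ 2).
  by rewrite normrM ler_pM// normrM ler_pM.
have E2 : `|(k t (h + p))^-1 * (k t p)^-1 ^+ 2 * (L * (k t (h + p) - k t p))|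
    <= (B * B ^+ 2) * ((2 * C * H) * (3 * C * H)).
  by rewrite normrM ler_pM// normrM ler_pM.
rewrite (le_trans (ler_normD _ _))// normrN.
have E3 : 0 <= B * H ^+ 2 by rewrite mulr_ge0// exprn_ge0.
have -> : (B + B ^+ 2 * C + 6 * B ^+ 3 * C ^+ 2) * H ^+ 2
  = B * H ^+ 2 + (B * B * (C * H ^+ 2) + B * B ^+ 2 * (2 * C * H * (3 * C * H))) by ring.
by rewrite ler_wpDl// lerD.
Qed.

Lemma is_diff_Rintegral k (k1 k2 : T -> R) p :
  (forall q, bmeas (fun t => k t q)) -> bmeas k1 -> bmeas k2 ->
  uniform_diff k k1 k2 p ->
  is_diff p (fun q => \I (fun t => k t q))
    (fun h => h.1 * \I k1 + h.2 * \I k2).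
Proof.
move=> bk b1 b2 [C C0 kC].
apply: is_diff_eps => [a u v|v|e e0].
- by rewrite /= /GRing.scale/=; ring.
- apply: (@continuousD _ _ _ (fun h : plane R => h.1 * \I k1)
      (fun h : plane R => h.2 * \I k2)).
    by apply: (@continuousM _ _ fst (fun=> \I k1)); [exact: cvg_fst|exact: cvg_cst].
  by apply: (@continuousM _ _ snd (fun=> \I k2)); [exact: cvg_snd|exact: cvg_cst].
have M0 : 0 <= fine (mu D) by apply: fine_ge0.
(* The added 1 keeps the divisor positive when the measure or [C] is zero. *)
pose M := C * fine (mu D) + 1.
have Mp : 0 < M by rewrite ltr_wpDl// mulr_ge0.
have n1 : \forall h \near (0 : plane R), `|h| < 1.
  apply/nbhs_normP; exists 1; first by rewrite /= ltr01.
  by move=> z /=; rewrite sub0r normrN.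
have n2 : \forall h \near (0 : plane R), `|h| < e / M.
  apply/nbhs_normP; exists (e / M) => /=; first by rewrite divr_gt0.
  by move=> z /=; rewrite sub0r normrN.
apply: filterS2 n1 n2 => h h1 hM.
rewrite -RintegralB_bmeas// -!RintegralZ_bmeas//.
rewrite -RintegralD_bmeas; [|exact: bmeasM (bmeas_cst _) b1|exact: bmeasM (bmeas_cst _) b2].
rewrite -RintegralB_bmeas; [|exact: bmeasB|]; last first.
  by apply: bmeasD; [exact: bmeasM (bmeas_cst _) b1|exact: bmeasM (bmeas_cst _) b2].
apply: (@le_trans _ _ (C * `|h| ^+ 2 * fine (mu D))).
  apply: Rintegral_bound.
    apply: bmeasB; first exact: bmeasB.
    by apply: bmeasD; [exact: bmeasM (bmeas_cst _) b1|exact: bmeasM (bmeas_cst _) b2].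
  move=> t Dt; have [_ _ _ /(_ h (ltW h1))] := kC t Dt.
  by rewrite (mulrC h.1) (mulrC h.2).
rewrite mulrAC expr2 mulrA ler_wpM2r//.
rewrite (@le_trans _ _ (M * `|h|))//; first by rewrite ler_wpM2r// lerDl.
by rewrite mulrC -ler_pdivlMr// ltW.
Qed.


Lemma uniform_diff_eq k k' (k1 k1' k2 k2' : T -> R) p :
  (forall t q, k t q = k' t q) -> (forall t, k1 t = k1' t) ->
  (forall t, k2 t = k2' t) -> uniform_diff k k1 k2 p -> uniform_diff k' k1' k2' p.
Proof.
move=> e e1 e2.
have -> : k' = k by apply/funext => t; apply/funext => q; rewrite e.
have -> : k1' = k1 by apply/funext => t; rewrite e1.
by have -> : k2' = k2 by apply/funext => t; rewrite e2.
Qed.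

Lemma uniform_diff_cst f p : bmeas f ->
  uniform_diff (fun t _ => f t) (fun=> 0) (fun=> 0) p.
Proof.
(* The bound [C] may be negative when [D] is empty. *)
move=> [_ [C fC]]; have C0 : 0 <= Num.max C 0 by rewrite le_max lexx orbT.
exists (Num.max C 0) => // t Dt; rewrite normr0; split=> // [|h _].
  by rewrite le_max fC.
by rewrite !mul0r addr0 subr0 subrr normr0 mulr_ge0 ?exprn_ge0.
Qed.

Lemma uniform_diff_fst p :
  uniform_diff (fun _ q => q.1) (fun=> 1) (fun=> 0) p.
Proof.
exists (`|p.1| + 1); first by rewrite addr_ge0.
move=> t _; rewrite normr0 normr1 lerDl ler01 lerDr normr_ge0 addr_ge0//.
split=> // h _; rewrite mul1r mul0r addr0 /= addrK subrr normr0.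
by rewrite mulr_ge0 ?exprn_ge0// addr_ge0.
Qed.

Lemma uniform_diff_snd p :
  uniform_diff (fun _ q => q.2) (fun=> 0) (fun=> 1) p.
Proof.
exists (`|p.2| + 1); first by rewrite addr_ge0.
move=> t _; rewrite normr0 normr1 lerDl ler01 lerDr normr_ge0 addr_ge0//.
split=> // h _; rewrite mul1r mul0r add0r /= addrK subrr normr0.
by rewrite mulr_ge0 ?exprn_ge0// addr_ge0.
Qed.

End BoundedMeasurable.

(** * Integrals against powers of the kernel in the blow-up coordinates *)

Section PoissonKernel.
Variable R : realType.
Implicit Types p q : plane R.

(* The point (r, s) stands for zeta = r (i - s), for which this is the squared
   modulus of 1 - x zeta. *)
Definition den (x : R) p : R := (1 + x * p.1 * p.2) ^+ 2 + (x * p.1) ^+ 2.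

(** [den x p] is the squared distance from 1 to the point x zeta of the real line spanned by zeta,
    and 1 / (1 + s^2) is the squared sine of the angle of that line. *)
Lemma den_ge x p : (1 + p.2 ^+ 2)^-1 <= den x p.
Proof.
have s0 : 0 < 1 + p.2 ^+ 2 by rewrite ltr_pwDl// sqr_ge0.
rewrite -div1r ler_pdivrMr// -subr_ge0.
have -> : den x p * (1 + p.2 ^+ 2) - 1 = (p.2 + x * p.1 * (1 + p.2 ^+ 2)) ^+ 2.
  by rewrite /den; ring.
exact: sqr_ge0.
Qed.

Lemma den_gt0 x p : 0 < den x p.
Proof.
by apply: lt_le_trans (den_ge x p); rewrite invr_gt0 ltr_pwDl// sqr_ge0.
Qed.

Lemma den_neq0 x p : den x p != 0. Proof. by rewrite gt_eqF// den_gt0. Qed.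

Lemma den0 x s : den x (0, s) = 1.
Proof. by rewrite /den /= mulr0 mul0r addr0 expr0n addr0 expr1n. Qed.

Context d (T : measurableType d).
Variables (mu : {measure set T -> \bar R}) (D : set T).
Hypotheses (mD : measurable D) (fD : (mu D < +oo)%E).
Variable sigma : T -> R.
Hypothesis bsigma : bounded_measurable D sigma.
Implicit Types f : T -> R.

Local Notation bmeas := (bounded_measurable D).

(** Differentiation raises the exponent [m] by one and multiplies the weight [f] by sigma or
    sigma^2. With both left free the family is closed under differentiation, which gives smoothness
    by induction. *)
Definition kernel_int m f p : R :=
  \int[mu]_(t in D) (f t * (den (sigma t) p)^-1 ^+ m).

Lemma bmeas_den p : bmeas (fun t => den (sigma t) p).
Proof.
have b1 : bmeas (fun t => sigma t * p.1) := bmeasM bsigma (bmeas_cst _ _).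
have b2 := bmeasM b1 (bmeas_cst _ p.2).
exact: (bmeasD (bmeasX 2 (bmeasD (bmeas_cst _ 1) b2)) (bmeasX 2 b1)).
Qed.

Lemma bmeas_kernel m f p : bmeas f -> bmeas (fun t => f t * (den (sigma t) p)^-1 ^+ m).
Proof.
move=> bf; apply: (bmeasM bf); apply: bmeasX.
apply: (@bmeasV _ _ _ _ _ (1 + p.2 ^+ 2)^-1) (bmeas_den p).
- by rewrite invr_gt0 ltr_pwDl// sqr_ge0.
- by move=> t _; exact: den_ge.
Qed.

(** The partial derivatives of [den] in r and s, sorted by powers of x so that the gradient of an
    integral splits into two kernel integrals. *)
Definition den1 (x : R) p : R := 2 * x * p.2 + 2 * x ^+ 2 * (p.1 * (1 + p.2 ^+ 2)).
Definition den2 (x : R) p : R := 2 * x * p.1 + 2 * x ^+ 2 * (p.1 ^+ 2 * p.2).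

Lemma uniform_diff_den p : uniform_diff D (fun t q => den (sigma t) q)
  (fun t => den1 (sigma t) p) (fun t => den2 (sigma t) p) p.
Proof.
have us := uniform_diff_cst p bsigma.
have ux := uniform_diffM us (uniform_diff_fst D p).
have uxs := uniform_diffM ux (uniform_diff_snd D p).
have u1 := uniform_diffD (uniform_diff_cst p (bmeas_cst D 1)) uxs.
have := uniform_diffD (uniform_diffM u1 u1) (uniform_diffM ux ux).
by apply: uniform_diff_eq => [t q|t|t]; rewrite /den /den1 /den2; ring.
Qed.

Lemma uniform_diff_kernel m f p : bmeas f ->
  uniform_diff D (fun t q => f t * (den (sigma t) q)^-1 ^+ m)
   (fun t => f t * (- m%:R * (den (sigma t) p)^-1 ^+ m.+1 * den1 (sigma t) p))
   (fun t => f t * (- m%:R * (den (sigma t) p)^-1 ^+ m.+1 * den2 (sigma t) p)) p.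
Proof.
move=> bf; have uf := uniform_diff_cst p bf.
(* [den_ge] at the largest second coordinate within distance 1 of [p]: a lower bound uniform in t
   and in the increment. *)
pose c := (1 + (`|p.2| + 1) ^+ 2)^-1.
have c0 : 0 < c by rewrite invr_gt0 ltr_pwDl// sqr_ge0.
have dc t h : D t -> `|h| <= 1 -> c <= den (sigma t) (h + p).
  move=> _ h1; apply: le_trans (den_ge _ _).
  rewrite lef_pV2 ?posrE ?ltr_pwDl ?sqr_ge0// lerD2l /=.
  rewrite -[leLHS]real_normK ?num_real// lerXn2r ?nnegrE ?addr_ge0//.
  rewrite addrC (le_trans (ler_normD _ _))// lerD2l.
  exact: le_trans (norm_snd_le h) h1.
have uV := uniform_diffV c0 dc (uniform_diff_den p).
have um : uniform_diff D (fun t q => (den (sigma t) q)^-1 ^+ m)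
   (fun t => - m%:R * (den (sigma t) p)^-1 ^+ m.+1 * den1 (sigma t) p)
   (fun t => - m%:R * (den (sigma t) p)^-1 ^+ m.+1 * den2 (sigma t) p) p.
  elim: m => [|m IH].
    have := uniform_diff_cst p (bmeas_cst D 1).
    by apply: uniform_diff_eq => [t q|t|t]; rewrite ?expr0// oppr0 !mul0r.
  have := uniform_diffM uV IH.
  by apply: uniform_diff_eq => [t q|t|t]; rewrite ?exprS// -natr1; ring.
have := uniform_diffM uf um.
by apply: uniform_diff_eq => [t q|t|t] //; rewrite mul0r add0r.
Qed.

Lemma kernel_intD m f g p : bmeas f -> bmeas g ->
  kernel_int m (fun t => f t + g t) p = kernel_int m f p + kernel_int m g p.
Proof.
move=> bf bg; rewrite /kernel_int -(RintegralD_bmeas mD fD); try exact: bmeas_kernel.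
by apply: eq_Rintegral => t _; rewrite mulrDl.
Qed.

Lemma kernel_intZ m a f p : bmeas f ->
  kernel_int m (fun t => a * f t) p = a * kernel_int m f p.
Proof.
move=> bf; rewrite /kernel_int -(RintegralZ_bmeas mD fD); try exact: bmeas_kernel.
by apply: eq_Rintegral => t _; rewrite mulrA.
Qed.

Definition kernel_grad1 m f p : R := - m%:R *
  (2 * p.2 * kernel_int m.+1 (fun t => f t * sigma t) p
   + 2 * (p.1 * (1 + p.2 ^+ 2)) * kernel_int m.+1 (fun t => f t * sigma t ^+ 2) p).

Definition kernel_grad2 m f p : R := - m%:R *
  (2 * p.1 * kernel_int m.+1 (fun t => f t * sigma t) p
   + 2 * (p.1 ^+ 2 * p.2) * kernel_int m.+1 (fun t => f t * sigma t ^+ 2) p).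

Lemma is_diff_kernel_int m f p : bmeas f ->
  is_diff p (kernel_int m f)
    (fun h => h.1 * kernel_grad1 m f p + h.2 * kernel_grad2 m f p).
Proof.
move=> bf; have bk q := bmeas_kernel m q bf.
have b1 := bmeasM bf bsigma; have b2 := bmeasM bf (bmeasX 2 bsigma).
have grad (x y : R) : \int[mu]_(t in D) (f t * (- m%:R * (den (sigma t) p)^-1 ^+ m.+1
      * (2 * sigma t * x + 2 * sigma t ^+ 2 * y)))
    = - m%:R * (2 * x * kernel_int m.+1 (fun t => f t * sigma t) p
      + 2 * y * kernel_int m.+1 (fun t => f t * sigma t ^+ 2) p).
  have z1 := bmeasM (bmeas_cst D (2 * x)) b1.
  have z2 := bmeasM (bmeas_cst D (2 * y)) b2.
  rewrite -!kernel_intZ// -kernel_intD// -kernel_intZ; last exact: bmeasD.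
  by apply: eq_Rintegral => t _; ring.
have bg (x y : R) : bmeas (fun t => f t * (- m%:R * (den (sigma t) p)^-1 ^+ m.+1
      * (2 * sigma t * x + 2 * sigma t ^+ 2 * y))).
  have z1 := bmeasM (bmeas_cst D (2 * x)) b1.
  have z2 := bmeasM (bmeas_cst D (2 * y)) b2.
  have := bmeasM (bmeas_cst D (- m%:R)) (bmeas_kernel m.+1 p (bmeasD z1 z2)).
  congr bounded_measurable; apply/funext => t; ring.
have := is_diff_Rintegral mD fD bk (bg _ _) (bg _ _) (uniform_diff_kernel m p bf).
by rewrite !grad.
Qed.

Lemma smooth_kernel_int m f : bmeas f -> smooth_on setT (kernel_int m f).
Proof.
move=> bf n; elim: n m f bf => [|n IH] m f bf.
  move=> p _; apply: differentiable_continuous.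
  by have [] := is_diff_kernel_int m p bf.
split=> [p _|v]; first by have [] := is_diff_kernel_int m p bf.
have oT : open [set: plane R] := openT.
have c1 : C_on n setT (fst : plane R -> R) by exact: C_on_pr1.
have c2 : C_on n setT (snd : plane R -> R) by exact: C_on_pr2.
have k1 := IH m.+1 _ (bmeasM bf bsigma).
have k2 := IH m.+1 _ (bmeasM bf (bmeasX 2 bsigma)).
have g1 := C_onMl (- m%:R) oT (C_onD oT (C_onM oT (C_onMl 2 oT c2) k1)
  (C_onM oT (C_onMl 2 oT (C_onM oT c1
    (C_onD oT (C_on_cst n setT (1 : R)) (C_onX 2 oT c2)))) k2)).
have g2 := C_onMl (- m%:R) oT (C_onD oT (C_onM oT (C_onMl 2 oT c1) k1)
  (C_onM oT (C_onMl 2 oT (C_onM oT (C_onX 2 oT c1) c2)) k2)).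
apply: (C_on_congr oT) (C_onD oT (C_onMl v.1 oT g1) (C_onMl v.2 oT g2)) => p _.
by rewrite (is_diff_derive v (is_diff_kernel_int m p bf)).
Qed.

End PoissonKernel.

(** * Poisson integrals on the disk *)

Section PoissonIntegral.
Variable R : realType.
Implicit Types (t x y : R) (w p : plane R).

Local Notation mu := (@lebesgue_measure R).

(** The sign condition makes the cosine of the sum positive. As the sum lies strictly between - pi
    and pi, it then lies between - pi / 2 and pi / 2, where [tan] is inverted by [atan]. *)
Lemma atanD x y : 0 < 1 - x * y -> atan x + atan y = atan ((x + y) / (1 - x * y)).
Proof.
move=> xy0.
have c0 (z : R) : 0 < cos (atan z).
  by rewrite cos_gt0_pihalf// atan_gtNpi2 atan_ltpi2.
have sE (z : R) : sin (atan z) = z * cos (atan z).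
  have e : sin (atan z) / cos (atan z) = z := atanK z.
  by apply: (canRL (divfK _) e); rewrite gt_eqF// c0.
have cD : cos (atan x + atan y) = cos (atan x) * cos (atan y) * (1 - x * y).
  by rewrite cosD !sE; ring.
have sD : sin (atan x + atan y) = cos (atan x) * cos (atan y) * (x + y).
  by rewrite sinD !sE; ring.
have cp : 0 < cos (atan x + atan y) by rewrite cD !mulr_gt0 ?c0.
have -> : (x + y) / (1 - x * y) = tan (atan x + atan y).
  by rewrite /tan cD sD; field; rewrite !gt_eqF ?c0.
rewrite tanK// in_itv/=.
have := atan_gtNpi2 x; have := atan_gtNpi2 y; have := atan_ltpi2 x; have := atan_ltpi2 y.
set a := atan x + atan y => h1 h2 h3 h4.
have pi0 := pi_gt0 R.
have no (b : R) : pi / 2 <= b -> b < pi -> cos b <= 0.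
  move=> b1 b2; rewrite -(subrK (pi / 2) b) cosDpihalf oppr_le0.
  apply: sin_ge0_pi; apply/andP; split; lra.
apply/andP; split; rewrite ltNge; apply/negP => h.
- have := no (- a); rewrite cosN.
  have e1 : pi / 2 <= - a by lra.
  have e2 : - a < pi by rewrite /a; lra.
  by move=> /(_ e1 e2); rewrite leNgt cp.
- have e2 : a < pi by rewrite /a; lra.
  by have := no a h e2; rewrite leNgt cp.
Qed.

Definition poisson_kernel w t : R := (1 - sqnorm w) / sqnorm (expi t - w).

(* the argument of 1 - w e^(-it), whose real part is positive for w in the disk *)
Definition poisson_angle w t : R :=
  atan ((w.1 * sin t - w.2 * cos t) / (1 - w.1 * cos t - w.2 * sin t)).

(** With q = w e^(-it) the kernel is the real part of (1 + q) / (1 - q) = 1 + 2 q / (1 - q), and the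
    real part of q / (1 - q) is the t-derivative of arg (1 - q). *)
Definition poisson_primitive w t : R := t + 2 * poisson_angle w t.

Lemma disk_dot w t : unit_disk w -> w.1 * cos t + w.2 * sin t < 1.
Proof.
rewrite /unit_disk /sqnorm /= => w1; have cs := cos2Dsin2 t.
rewrite ltNge; apply/negP => h.
have : 1 <= (w.1 * cos t + w.2 * sin t) ^+ 2 by rewrite exprn_ege1.
have : (w.1 * cos t + w.2 * sin t) ^+ 2 + (w.1 * sin t - w.2 * cos t) ^+ 2
   = (w.1 ^+ 2 + w.2 ^+ 2) * (cos t ^+ 2 + sin t ^+ 2) by ring.
rewrite cs mulr1; have := sqr_ge0 (w.1 * sin t - w.2 * cos t); lra.
Qed.

Lemma sqnorm_expiB w t : sqnorm (expi t - w) =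
  (w.1 * sin t - w.2 * cos t) ^+ 2 + (1 - w.1 * cos t - w.2 * sin t) ^+ 2.
Proof.
have cs : sin t ^+ 2 = 1 - cos t ^+ 2 by rewrite sin2cos2.
rewrite /sqnorm /expi /=.
have -> : (w.1 * sin t - w.2 * cos t) ^+ 2 + (1 - w.1 * cos t - w.2 * sin t) ^+ 2
  = (w.1 ^+ 2 + w.2 ^+ 2) * (sin t ^+ 2 + cos t ^+ 2) + 1 - 2 * (w.1 * cos t + w.2 * sin t).
  by ring.
by rewrite cs; ring: cs.
Qed.

Lemma sqnorm_expiB_gt0 w t : unit_disk w -> 0 < sqnorm (expi t - w).
Proof.
move=> /(disk_dot t) w1; rewrite sqnorm_expiB ltr_wpDl ?sqr_ge0// exprn_gt0//.
by lra.
Qed.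

Lemma is_derive_poisson_primitive w t : unit_disk w ->
  is_derive t 1 (poisson_primitive w) (poisson_kernel w t).
Proof.
move=> w1; have D0 := disk_dot t w1; have q0 := sqnorm_expiB_gt0 t w1.
pose N t := w.1 * sin t - w.2 * cos t.
pose Dn t := 1 - w.1 * cos t - w.2 * sin t.
have Dn0 : Dn t != 0 by rewrite gt_eqF// /Dn; lra.
have dN : is_derive t 1 N (1 - Dn t).
  by apply: is_derive_eq; rewrite /Dn /GRing.scale/=; ring.
have dD : is_derive t 1 Dn (N t).
  by apply: is_derive_eq; rewrite /N /GRing.scale/=; ring.
have dV : is_derive t 1 (fun s => (Dn s)^-1) (- (Dn t) ^- 2 *: N t).
  exact: is_deriveV.
have dq : is_derive t 1 (fun s => N s * (Dn s)^-1)
    (N t *: (- (Dn t) ^- 2 *: N t) + (Dn t)^-1 *: (1 - Dn t)).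
  exact: is_deriveM.
have da := @is_derive1_comp _ (@atan R) (fun s => N s * (Dn s)^-1) t _ _ (is_derive1_atan _) dq.
have dd : is_derive t 1 (fun s => s + 2 * atan (N s * (Dn s)^-1))
   (1 + 2 *: ((1 + (N t * (Dn t)^-1) ^+ 2)^-1 *
    (N t *: (- (Dn t) ^- 2 *: N t) + (Dn t)^-1 *: (1 - Dn t)))).
  exact: is_deriveD.
apply: (is_derive_eq dd).
rewrite /poisson_kernel.
have qE : sqnorm (expi t - w) = N t ^+ 2 + Dn t ^+ 2 by rewrite sqnorm_expiB.
have sE : 1 - sqnorm w = 2 * Dn t - (N t ^+ 2 + Dn t ^+ 2).
  have cs : sin t ^+ 2 = 1 - cos t ^+ 2 by rewrite sin2cos2.
  by rewrite /N /Dn /sqnorm; ring: cs.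
rewrite qE sE /GRing.scale/=; field.
by rewrite Dn0 -qE gt_eqF.
Qed.


Lemma continuous_poisson_kernel w : unit_disk w -> continuous (poisson_kernel w).
Proof.
move=> w1 t.
have c (f : R -> R) (a : R) : continuous f -> {for t, continuous (fun s => (f s - a) ^+ 2)}.
  move=> cf; have cfa : {for t, continuous (fun s => f s - a)}.
    by apply: continuousB; [exact: cf|exact: cst_continuous].
  have -> : (fun s => (f s - a) ^+ 2) = (fun s => (f s - a) * (f s - a)).
    by apply/funext => s; rewrite expr2.
  exact: continuousM.
have cq : {for t, continuous (fun s => sqnorm (expi s - w))}.
  have := continuousD (c _ w.1 (@continuous_cos R)) (c _ w.2 (@continuous_sin R)).
  exact.
apply: (@continuousM _ _ (fun=> 1 - sqnorm w) (fun s => (sqnorm (expi s - w))^-1)).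
  exact: cst_continuous.
by apply: continuousV; [rewrite gt_eqF// sqnorm_expiB_gt0|exact: cq].
Qed.

Lemma integral_poisson_kernel w (a b : R) : unit_disk w -> a <= b ->
  \int[mu]_(t in `[a, b]) poisson_kernel w t
  = poisson_primitive w b - poisson_primitive w a.
Proof.
move=> w1; rewrite le_eqVlt => /predU1P[->|ab].
  by rewrite set_itv1 Rintegral_set1 subrr.
have dQ t : derivable (poisson_primitive w) t 1.
  by have [] := is_derive_poisson_primitive t w1.
have cQ t : {for t, continuous (poisson_primitive w)}.
  exact/differentiable_continuous/derivable1_diffP.
rewrite /Rintegral (@continuous_FTC2 _ _ (poisson_primitive w))//.
- by apply: continuous_subspaceT; exact: continuous_poisson_kernel.
- split=> [t _|//|].
  + exact: dQ.
  + exact/cvg_at_right_filter/cQ.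
  + exact/cvg_at_left_filter/cQ.
- by move=> t _; rewrite derive1E; have [] := is_derive_poisson_primitive t w1.
Qed.

Lemma bmeas_poisson_kernel w (a b : R) : unit_disk w ->
  bounded_measurable `[a, b] (poisson_kernel w).
Proof.
move=> w1; split.
  apply: measurable_funTS; apply: continuous_measurable_fun.
  exact: continuous_poisson_kernel.
have [ab|ba] := leP a b; last first.
  by exists 0 => t; rewrite /= in_itv/= => /andP[at' tb]; have := le_lt_trans (le_trans at' tb) ba; rewrite ltxx.
have cn : {within `[a, b], continuous (fun t => `|poisson_kernel w t|)}.
  apply: continuous_subspaceT => t.
  apply: (@continuous_comp _ _ _ (poisson_kernel w) (fun x => `|x|)).
    exact: continuous_poisson_kernel.
  exact: norm_continuous.
have [c _ cM] := EVT_max ab cn.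
by exists `|poisson_kernel w c| => t tab; apply: cM.
Qed.

Lemma lebesgue_itv_lty (a b : R) : (mu `[a, b]%classic < +oo)%E.
Proof.
by rewrite lebesgue_measure_itv/=; case: ifP => // _; rewrite -EFinB ltry.
Qed.

Lemma integral_poisson_piece w (f : R -> R) (c a b : R) : unit_disk w -> a <= b ->
  mu.-integrable `[a, b] (EFin \o (fun t => poisson_kernel w t * f t)) ->
  (forall t, t \in `]a, b[ -> f t = c) ->
  \int[mu]_(t in `[a, b]) (poisson_kernel w t * f t)
  = c * (poisson_primitive w b - poisson_primitive w a).
Proof.
move=> w1 ab ifab fc.
have ik (i : interval R) : [set` i] `<=` `[a, b] ->
    mu.-integrable [set` i] (EFin \o (fun t => poisson_kernel w t * f t)).
  by move=> si; apply: integrableS ifab.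
have ic (i : interval R) : [set` i] `<=` `[a, b] ->
    mu.-integrable [set` i] (EFin \o poisson_kernel w).
  move=> si; apply: (@integrableS _ _ _ mu `[a, b]) => //.
  apply: bmeas_integrable; [by []|exact: lebesgue_itv_lty|exact: bmeas_poisson_kernel].
(* The value of [f] is known in the open interval only; the endpoints are null. *)
rewrite -Rintegral_itv_obnd_cbnd; last by apply: ik; exact: subset_itv_oc_cc.
rewrite -Rintegral_itv_bndo_bndc; last by apply: ik; exact: subset_itv_oo_cc.
transitivity (\int[mu]_(t in `]a, b[) (c * poisson_kernel w t)).
  by apply: eq_Rintegral => t; rewrite inE => /fc ->; rewrite mulrC.
rewrite RintegralZl//; last by apply: ic; exact: subset_itv_oo_cc.
rewrite Rintegral_itv_bndo_bndc; last by apply: ic; exact: subset_itv_oo_cc.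
rewrite Rintegral_itv_obnd_cbnd; last by apply: ic; exact: subset_itv_oc_cc.
by rewrite integral_poisson_kernel.
Qed.

Lemma poisson_primitiveD2pi w t :
  poisson_primitive w (t + 2 * pi) = poisson_primitive w t + 2 * pi.
Proof.
rewrite /poisson_primitive /poisson_angle mulr_natl sinD2pi cosD2pi.
by rewrite addrAC.
Qed.

(** Cutting the circle at 0 splits the arc with value [c1] into two intervals. Their masses
    recombine because the primitive grows by 2 pi over one turn. *)
Lemma integral_poisson_step w (f : R -> R) (c1 c2 x1 x2 : R) : unit_disk w ->
  0 <= x1 -> x1 <= x2 -> x2 <= 2 * pi -> bounded_measurable `[0, 2 * pi] f ->
  (forall t, t \in `]0, x1[ -> f t = c1) ->
  (forall t, t \in `]x1, x2[ -> f t = c2) ->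
  (forall t, t \in `]x2, 2 * pi[ -> f t = c1) ->
  \int[mu]_(t in `[0, 2 * pi]) (poisson_kernel w t * f t)
  = 2 * pi * c1 + (c2 - c1) * (poisson_primitive w x2 - poisson_primitive w x1).
Proof.
move=> w1 x10 x12 x2p bf f1 f2 f3.
have ik : mu.-integrable `[0, 2 * pi] (EFin \o (fun t => poisson_kernel w t * f t)).
  apply: bmeas_integrable; [by []|exact: lebesgue_itv_lty|].
  by apply: bmeasM => //; exact: bmeas_poisson_kernel.
have ikS (i : interval R) : [set` i] `<=` `[0, 2 * pi] ->
    mu.-integrable [set` i] (EFin \o (fun t => poisson_kernel w t * f t)).
  by move=> si; apply: integrableS ik.
have s1 : `[0, x1] `<=` `[0, 2 * pi].
  by apply: subset_itvl; rewrite bnd_simp (le_trans x12).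
have s2 : `[0, x2] `<=` `[0, 2 * pi] by apply: subset_itvl; rewrite bnd_simp.
have s12 : `[x1, x2] `<=` `[0, 2 * pi].
  by apply: subset_itv; rewrite bnd_simp.
have s3 : `[x2, 2 * pi] `<=` `[0, 2 * pi].
  by apply: subset_itvr; rewrite bnd_simp (le_trans x10).
have E3 := @Rintegral_itvB _ _ (BLeft 0) (BRight (2 * pi)) x2 ik.
have E2 := @Rintegral_itvB _ _ (BLeft 0) (BRight x2) x1 (ikS _ s2).
rewrite !bnd_simp in E3 E2.
have := E3 (le_trans x10 x12) x2p; have := E2 x10 x12.
rewrite Rintegral_itv_obnd_cbnd; last first.
  by apply: ikS; apply: subset_trans s12; exact: subset_itv_oc_cc.
rewrite Rintegral_itv_obnd_cbnd; last first.
  by apply: ikS; apply: subset_trans s3; exact: subset_itv_oc_cc.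
rewrite (integral_poisson_piece w1 x12 (ikS _ s12) f2).
rewrite (integral_poisson_piece w1 x2p (ikS _ s3) f3).
rewrite (integral_poisson_piece w1 x10 (ikS _ s1) f1).
have := poisson_primitiveD2pi w 0; rewrite add0r => ->.
move=> /eqP; rewrite subr_eq => /eqP h2 /eqP; rewrite subr_eq => /eqP ->.
rewrite h2.
ring.
Qed.

End PoissonIntegral.

(** * The Cayley transform and the Poisson kernel of the half plane *)

Section Cayley.
Variable R : realType.
Implicit Types (t x y : R) (w p : plane R).

Definition half_plane : set (plane R) := [set p | 0 < p.1].

Definition rot a w : plane R :=
  (w.1 * cos a - w.2 * sin a, w.1 * sin a + w.2 * cos a).

(* (1 + i zeta) / (1 - i zeta) for zeta = r (i - s) *)
Definition cayley p : plane R :=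
  ((1 - p.1 ^+ 2 - (p.1 * p.2) ^+ 2) / ((1 + p.1) ^+ 2 + (p.1 * p.2) ^+ 2),
   - 2 * (p.1 * p.2) / ((1 + p.1) ^+ 2 + (p.1 * p.2) ^+ 2)).

(** The preimage zeta of w is recorded by its imaginary part r and by the quotient s = - Re zeta /
    Im zeta, which explains the denominator of the second coordinate. *)
Definition cayley_inv w : plane R :=
  ((1 - sqnorm w) / ((1 + w.1) ^+ 2 + w.2 ^+ 2), - 2 * w.2 / (1 - sqnorm w)).

Lemma open_half_plane : open half_plane.
Proof.
apply: (@open_comp _ _ (fst : plane R -> R) [set x | 0 < x]).
  by move=> p _; exact: cvg_fst.
exact: open_gt.
Qed.

Lemma open_unit_disk : open (@unit_disk R).
Proof.
apply: (@open_comp _ _ (@sqnorm R) [set x | x < 1]); last exact: open_lt.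
move=> w _; have c1 : {for w, continuous (fst : plane R -> R)} by exact: cvg_fst.
have c2 : {for w, continuous (snd : plane R -> R)} by exact: cvg_snd.
have := continuousD (continuousM c1 c1) (continuousM c2 c2).
by congr (_ @ _ --> _); rewrite /sqnorm funeqE.
Qed.

Lemma sqnorm_rot a w : sqnorm (rot a w) = sqnorm w.
Proof.
have cs : sin a ^+ 2 = 1 - cos a ^+ 2 by rewrite sin2cos2.
by rewrite /sqnorm /rot /=; ring: cs.
Qed.

Lemma rotNK a : cancel (rot a) (rot (- a)).
Proof.
move=> w; have cs : sin a ^+ 2 = 1 - cos a ^+ 2 by rewrite sin2cos2.
rewrite [RHS]surjective_pairing /rot /= cosN sinN.
by congr pair; ring: cs.
Qed.

Lemma rotKN a : cancel (rot (- a)) (rot a).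
Proof. by move=> w; rewrite -{1}(opprK a) rotNK. Qed.

Lemma cayley_den_gt0 p : half_plane p -> 0 < (1 + p.1) ^+ 2 + (p.1 * p.2) ^+ 2.
Proof.
rewrite /half_plane /= => r0; rewrite ltr_pwDl ?sqr_ge0// exprn_gt0//; lra.
Qed.

Lemma sqnorm_cayley p : half_plane p ->
  1 - sqnorm (cayley p) = 4 * p.1 / ((1 + p.1) ^+ 2 + (p.1 * p.2) ^+ 2).
Proof.
move=> /cayley_den_gt0 q0; rewrite /sqnorm /cayley /=; field.
by rewrite gt_eqF.
Qed.

Lemma cayley_disk p : half_plane p -> unit_disk (cayley p).
Proof.
move=> Hp; rewrite /unit_disk /= -subr_gt0 sqnorm_cayley// divr_gt0//.
  by rewrite mulr_gt0.
exact: cayley_den_gt0.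
Qed.

Lemma cayleyK p : half_plane p -> cayley_inv (cayley p) = p.
Proof.
move=> Hp; have q0 := cayley_den_gt0 Hp; have r0 : 0 < p.1 := Hp.
rewrite /cayley_inv sqnorm_cayley// [RHS]surjective_pairing /cayley /=.
congr pair; field; rewrite ?gt_eqF//=.
have -> : (1 + p.1) ^+ 2 + (p.1 * p.2) ^+ 2 + (1 - p.1 ^+ 2 - (p.1 * p.2) ^+ 2)
  = 2 * (1 + p.1) by ring.
by rewrite ltr_pwDl ?sqr_ge0// exprn_gt0// mulr_gt0// addr_gt0.
Qed.

Lemma cayley_inv_den_gt0 w : unit_disk w -> 0 < (1 + w.1) ^+ 2 + w.2 ^+ 2.
Proof.
rewrite /unit_disk /sqnorm /= => w1.
have := sqr_ge0 w.2; have := sqr_ge0 (1 + w.1) => h1 h2.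
rewrite lt0r addr_ge0// andbT; apply/eqP => h.
have w20 : w.2 ^+ 2 = 0 by lra.
have : (1 + w.1) ^+ 2 = 0 by lra.
by move=> /eqP; rewrite sqrf_eq0 => /eqP w10; have e : w.1 = -1 by [lra]; move: w1; rewrite e w20; lra.
Qed.

Lemma cayley_inv_half_plane w : unit_disk w -> half_plane (cayley_inv w).
Proof.
move=> w1; have := cayley_inv_den_gt0 w1; move: w1; rewrite /unit_disk /half_plane /=.
by rewrite -subr_gt0 => h1 h2; rewrite divr_gt0.
Qed.

Lemma cayley_invK w : unit_disk w -> cayley (cayley_inv w) = w.
Proof.
move=> w1; have q0 := cayley_inv_den_gt0 w1.
have r0 : 0 < 1 - sqnorm w by rewrite subr_gt0.
have q1 : (1 + (1 - sqnorm w) / ((1 + w.1) ^+ 2 + w.2 ^+ 2)) ^+ 2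
  + ((1 - sqnorm w) / ((1 + w.1) ^+ 2 + w.2 ^+ 2) * (- 2 * w.2 / (1 - sqnorm w))) ^+ 2
  = 4 / ((1 + w.1) ^+ 2 + w.2 ^+ 2).
  rewrite /sqnorm in r0 *; field.
  by rewrite !gt_eqF.
rewrite [RHS]surjective_pairing /cayley /cayley_inv /= q1 /sqnorm.
rewrite /sqnorm in r0; congr pair; field; by rewrite !gt_eqF.
Qed.


Lemma C_on_cayley n : C_on n half_plane cayley.
Proof.
have oH := open_half_plane.
have c1 : C_on n half_plane (fst : plane R -> R) by exact: C_on_pr1.
have c2 : C_on n half_plane (snd : plane R -> R) by exact: C_on_pr2.
have c12 := C_onM oH c1 c2; have cst1 := C_on_cst n half_plane (1 : R).
have cq := C_onV oH (fun p Hp => lt0r_neq0 (cayley_den_gt0 Hp))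
  (C_onD oH (C_onX 2 oH (C_onD oH cst1 c1)) (C_onX 2 oH c12)).
exact: (C_on_pair oH
  (C_onM oH (C_onB oH (C_onB oH cst1 (C_onX 2 oH c1)) (C_onX 2 oH c12)) cq)
  (C_onM oH (C_onMl (- 2) oH c12) cq)).
Qed.

Lemma C_on_cayley_inv n : C_on n (@unit_disk R) cayley_inv.
Proof.
have oH := open_unit_disk.
have c1 : C_on n (@unit_disk R) (fst : plane R -> R) by exact: C_on_pr1.
have c2 : C_on n (@unit_disk R) (snd : plane R -> R) by exact: C_on_pr2.
have cst1 := C_on_cst n (@unit_disk R) (1 : R).
have cq := C_onV oH (fun p Hp => lt0r_neq0 (cayley_inv_den_gt0 Hp))
  (C_onD oH (C_onX 2 oH (C_onD oH cst1 c1)) (C_onX 2 oH c2)).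
have cs := C_onB oH cst1 (C_onD oH (C_onX 2 oH c1) (C_onX 2 oH c2)).
have s0 w : unit_disk w -> 1 - (w.1 ^+ 2 + w.2 ^+ 2) != 0.
  by move=> w1; rewrite gt_eqF// subr_gt0.
exact: (C_on_pair oH (C_onM oH cs cq)
  (C_onM oH (C_onMl (- 2) oH c2) (C_onV oH s0 cs))).
Qed.

Lemma C_on_rot n a (U : set (plane R)) : open U -> C_on n U (rot a).
Proof.
move=> oU; have c1 : C_on n U (fst : plane R -> R) by exact: C_on_pr1.
have c2 : C_on n U (snd : plane R -> R) by exact: C_on_pr2.
have cc c := C_on_cst n U (c : R).
exact: (C_on_pair oU (C_onB oU (C_onM oU c1 (cc _)) (C_onM oU c2 (cc _)))
  (C_onD oU (C_onM oU c1 (cc _)) (C_onM oU c2 (cc _)))).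
Qed.

(* Maps the half plane {r > 0} onto the unit disk and the line r = 0, on which
   zeta = 0, to the boundary point expi t0. *)
Definition to_disk t0 p : plane R := rot t0 (cayley p).
Definition of_disk t0 w : plane R := cayley_inv (rot (- t0) w).

Lemma to_disk_disk t0 p : half_plane p -> unit_disk (to_disk t0 p).
Proof. by move=> Hp; rewrite /unit_disk /= sqnorm_rot; exact: cayley_disk. Qed.

Lemma of_disk_half_plane t0 w : unit_disk w -> half_plane (of_disk t0 w).
Proof.
by move=> w1; apply: cayley_inv_half_plane; rewrite /unit_disk /= sqnorm_rot.
Qed.

Lemma to_diskK t0 p : half_plane p -> of_disk t0 (to_disk t0 p) = p.
Proof. by move=> Hp; rewrite /of_disk rotNK cayleyK. Qed.

Lemma of_diskK t0 w : unit_disk w -> to_disk t0 (of_disk t0 w) = w.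
Proof.
by move=> w1; rewrite /to_disk cayley_invK ?rotKN// /unit_disk /= sqnorm_rot.
Qed.

Lemma differentiable_to_disk t0 p : half_plane p -> differentiable (to_disk t0) p.
Proof.
move=> Hp; have [dc _] := C_on_cayley 1; have [dr _] := C_on_rot 1 t0 openT.
by apply: differentiable_comp; [exact: dc|exact: dr].
Qed.

Lemma differentiable_of_disk t0 w : unit_disk w -> differentiable (of_disk t0) w.
Proof.
move=> w1; have [dc _] := C_on_cayley_inv 1; have [dr _] := C_on_rot 1 (- t0) openT.
apply: differentiable_comp; [exact: dr|apply: dc].
by rewrite /unit_disk /= sqnorm_rot.
Qed.

Lemma derive_to_disk_neq0 t0 p v : half_plane p -> v != 0 ->
  'D_v (to_disk t0) p != 0.
Proof.
move=> Hp; apply: contra_neq => D0.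
apply: (derive_left_inverse (differentiable_to_disk t0 Hp)
  (differentiable_of_disk t0 (to_disk_disk t0 Hp)) _ D0).
have : \near p, half_plane p by exact: open_nbhs_nbhs (conj open_half_plane Hp).
by apply: filterS => q Hq; exact: to_diskK.
Qed.

(** Here x is the cotangent of half of t - t0, and for nonzero x the Cayley map with the rotation by
    [t0] sends the real point 1 / x to [expi t]. So this is the half-plane kernel for the boundary
    point 1 / x. Written in x it stays regular at the point opposite the jump, where x = 0. *)
Lemma poisson_kernel_to_disk t0 t p : half_plane p -> 1 - cos (t - t0) != 0 ->
  let x := sin (t - t0) / (1 - cos (t - t0)) in
  poisson_kernel (to_disk t0 p) t = p.1 * ((1 + x ^+ 2) / den x p).
Proof.
move=> Hp; set c := cos (t - t0); set s := sin (t - t0) => c1 x.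
have cs : s ^+ 2 = 1 - c ^+ 2 by rewrite /s /c sin2cos2.
have q0 := cayley_den_gt0 Hp.
pose E := (1 - c) + (1 + c) * (p.1 ^+ 2 + (p.1 * p.2) ^+ 2) + 2 * s * (p.1 * p.2).
have sq : sqnorm (expi t - to_disk t0 p) = 2 * E / ((1 + p.1) ^+ 2 + (p.1 * p.2) ^+ 2).
  have -> : expi t - to_disk t0 p = rot t0 ((c, s) - cayley p).
    have -> : expi t = rot t0 (c, s).
      have cs0 : sin t0 ^+ 2 = 1 - cos t0 ^+ 2 by rewrite sin2cos2.
      by rewrite /rot /c /s /= cosB sinB /expi; congr pair; ring: cs0.
    by rewrite /to_disk /rot; congr pair; rewrite /=; ring.
  rewrite sqnorm_rot /sqnorm /cayley /E /=.
  by field: cs; rewrite gt_eqF.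
have dE : den x p = E / (1 - c) by rewrite /den /E /x; field: cs.
have xE : 1 + x ^+ 2 = 2 / (1 - c) by rewrite /x; field: cs.
have E0 : E != 0.
  have : den x p != 0 by exact: den_neq0.
  by rewrite dE; apply: contra_neq => ->; rewrite mul0r.
rewrite /poisson_kernel sq xE dE /to_disk sqnorm_rot sqnorm_cayley//.
by field; rewrite E0 c1 gt_eqF.
Qed.

(** With z = [cayley p] the two angles are arg (1 - z) and arg (1 + z). The quotient (1 - z) / (1 +
    z) equals - i zeta = r (1 + i s), whose argument is atan s. *)
Lemma poisson_angle_to_disk t0 p : half_plane p ->
  poisson_angle (to_disk t0 p) t0 - poisson_angle (to_disk t0 p) (t0 + pi) = atan p.2.
Proof.
move=> Hp; have q0 := cayley_den_gt0 Hp; have r0 : 0 < p.1 := Hp.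
set w := to_disk t0 p; set z := cayley p.
have cs0 : sin t0 ^+ 2 = 1 - cos t0 ^+ 2 by rewrite sin2cos2.
have w1 : w.1 * cos t0 + w.2 * sin t0 = z.1.
  by rewrite /w /to_disk /rot -/z /=; ring: cs0.
have w2 : w.1 * sin t0 - w.2 * cos t0 = - z.2.
  by rewrite /w /to_disk /rot -/z /=; ring: cs0.
have a0 : 0 < 1 + p.1 by rewrite addr_gt0.
have b0 : 0 < 1 + p.1 + p.1 * p.2 ^+ 2.
  by rewrite ltr_wpDr// mulr_ge0 ?sqr_ge0// ltW.
have -> : poisson_angle w t0 = atan (p.2 / (1 + p.1 + p.1 * p.2 ^+ 2)).
  rewrite /poisson_angle -addrA -opprD w1 w2 /z /cayley /=; congr atan.
  field; rewrite !gt_eqF//.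
  have -> : (1 + p.1) ^+ 2 + (p.1 * p.2) ^+ 2 - (1 - p.1 ^+ 2 - (p.1 * p.2) ^+ 2)
    = 2 * p.1 * (1 + p.1 + p.1 * p.2 ^+ 2) by ring.
  by rewrite !mulr_gt0.
have -> : poisson_angle w (t0 + pi) = - atan (p.1 * p.2 / (1 + p.1)).
  rewrite /poisson_angle sinDpi cosDpi !mulrN !opprK.
  have -> : - (w.1 * sin t0) + w.2 * cos t0 = z.2 by rewrite -[RHS]opprK -w2 opprB addrC.
  rewrite -addrA w1 /z /cayley -atanN /=; congr atan.
  field; rewrite !gt_eqF//.
  have -> : (1 + p.1) ^+ 2 + (p.1 * p.2) ^+ 2 + (1 - p.1 ^+ 2 - (p.1 * p.2) ^+ 2)
    = 2 * (1 + p.1) by ring.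
  by rewrite mulr_gt0.
rewrite opprK.
have xy : 1 - p.2 / (1 + p.1 + p.1 * p.2 ^+ 2) * (p.1 * p.2 / (1 + p.1))
    = ((1 + p.1) ^+ 2 + (p.1 * p.2) ^+ 2) / ((1 + p.1 + p.1 * p.2 ^+ 2) * (1 + p.1)).
  by field; rewrite !gt_eqF.
rewrite atanD xy; last by rewrite divr_gt0// mulr_gt0.
congr atan; field; by rewrite !gt_eqF.
Qed.

End Cayley.

(** * The Poisson integral of a function with a jump *)

Section BoundaryJump.
Variables (R : realType) (t0 kappa : R).
Hypotheses (t0_ge0 : 0 <= t0) (t0_le : t0 <= 2 * pi) (kappa_gt0 : 0 < kappa).
Implicit Types (p : plane R).

Local Notation mu := (@lebesgue_measure R).
Local Notation circle := (`[0, 2 * pi]%classic : set R).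

(* cot ((t - t0) / 2), truncated near t0 *)
Definition cot_half (t : R) : R :=
  sin (t - t0) / Num.max (1 - cos (t - t0)) kappa.

Let continuous_shift : continuous (fun t : R => t - t0).
Proof. by move=> t; apply: continuousB; [exact: cvg_id|exact: cst_continuous]. Qed.

Let continuous_sin_shift : continuous (fun t : R => sin (t - t0)).
Proof.
move=> t; apply: (@continuous_comp _ _ _ (fun t : R => t - t0) (@sin R)).
  exact: continuous_shift.
exact: continuous_sin.
Qed.

Let continuous_cos_shift : continuous (fun t : R => cos (t - t0)).
Proof.
move=> t; apply: (@continuous_comp _ _ _ (fun t : R => t - t0) (@cos R)).
  exact: continuous_shift.
exact: continuous_cos.
Qed.

Lemma bmeas_cot_half : bounded_measurable circle cot_half.
Proof.
have bs : bounded_measurable circle (fun t => sin (t - t0)).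
  split; first by have ms := continuous_measurable_fun continuous_sin_shift; exact: measurable_funTS ms.
  by exists 1 => t _; exact: sin_max.
apply: bmeasM bs _.
apply: (@bmeasV _ _ _ _ _ kappa) => // [t _|]; first by rewrite le_max lexx orbT.
split.
  apply: measurable_maxr => //; apply: measurable_funB => //.
  by have mc := continuous_measurable_fun continuous_cos_shift; exact: measurable_funTS mc.
exists (2 + kappa) => t _; have := cos_geN1 (t - t0); have := cos_le1 (t - t0) => c1 c2.
have k0 := ltW kappa_gt0.
rewrite ger0_norm; last by rewrite le_max k0 orbT.
by rewrite ge_max; apply/andP; split; lra.
Qed.

Section Component.
Variables (g : plane R -> R) (alpha beta : R).
Hypothesis bg : bounded_measurable circle (fun t => g (expi t)).
Hypothesis g_left : forall t, 1 - cos (t - t0) < kappa -> sin (t - t0) < 0 ->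
  g (expi t) = alpha.
Hypothesis g_right : forall t, 1 - cos (t - t0) < kappa -> 0 < sin (t - t0) ->
  g (expi t) = beta.

(** At the zeros of the sine, which include the jump, the value of [g] itself is taken: there the
    hypotheses say nothing about [g], and with this choice [g] agrees with [step] on a full
    neighbourhood of the jump. *)
Let step (t : R) : R :=
  if 0 < sin (t - t0) then beta
  else if sin (t - t0) < 0 then alpha else g (expi t).

(** The factor 1 + cot^2 is the numerator of the kernel in the half plane. The weight vanishes
    wherever [cot_half] differs from the true cotangent. *)
Definition jump_weight (t : R) : R :=
  (2 * pi)^-1 * (g (expi t) - step t) * (1 + cot_half t ^+ 2).

Let bmeas_step : bounded_measurable circle step.
Proof.
have [mg [C gC]] := bg.
have ms : measurable_fun circle (fun t : R => sin (t - t0)).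
  have ms := continuous_measurable_fun continuous_sin_shift.
  exact: measurable_funTS ms.
split.
  apply: measurable_fun_if => //; first exact: measurable_fun_ltr.
  have mb : measurable (circle `&` (fun t : R => 0 < sin (t - t0)) @^-1` [set false]).
    by apply: (@measurable_fun_ltr _ _ _ circle (fun=> 0) (fun t => sin (t - t0))).
  apply: measurable_fun_if => //.
  - by apply: measurable_fun_ltr => //; apply: measurable_funS ms.
  - by apply: measurable_funS mg => // t [] [].
exists (`|alpha| + `|beta| + `|C|) => t ct; rewrite /step.
have := normr_ge0 alpha; have := normr_ge0 beta; have := normr_ge0 C => h1 h2 h3.
case: ifP => _; first lra.
case: ifP => _; first lra.
have := gC t ct; have := ler_norm C; lra.
Qed.

Lemma bmeas_jump_weight : bounded_measurable circle jump_weight.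
Proof.
have b1 := bmeasM (bmeas_cst circle (2 * pi)^-1) (bmeasB bg bmeas_step).
exact: (bmeasM b1 (bmeasD (bmeas_cst circle 1) (bmeasX 2 bmeas_cot_half))).
Qed.

Let sin_gt0 (x : R) : 0 < x < pi -> 0 < sin x := @sin_gt0_pi R x.

Let sin_lt0 (x : R) : - pi < x < 0 -> sin x < 0.
Proof.
move=> /andP[x1 x2]; rewrite -oppr_gt0 -sinN; apply: sin_gt0.
by apply/andP; split; lra.
Qed.

Let step_right (t : R) : 0 < sin (t - t0) -> step t = beta.
Proof. by rewrite /step => ->. Qed.

Let step_left (t : R) : sin (t - t0) < 0 -> step t = alpha.
Proof. by move=> s0; rewrite /step s0 ltNge (ltW s0). Qed.

Let integral_step p : half_plane p ->
  \int[mu]_(t in circle) (poisson_kernel (to_disk t0 p) t * step t)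
  = 2 * pi * (beta + (alpha - beta) * (2^-1 + atan p.2 / pi)).
Proof.
move=> Hp; have w1 := to_disk_disk t0 Hp.
have pi0 := pi_gt0 R; have pin0 : pi != 0 :> R by rewrite gt_eqF.
have angle := poisson_angle_to_disk t0 Hp.
have sinD2 (x : R) : sin (x + 2 * pi) = sin x by rewrite mulr_natl sinD2pi.
(* The half circle after the jump is an interval of [0, 2 pi] if t0 <= pi; otherwise the half circle
   before the jump is one, and [alpha] and [beta] exchange their roles. *)
have [t0pi|pit0] := leP t0 pi.
- rewrite (@integral_poisson_step _ _ _ alpha beta t0 (t0 + pi))//; try lra.
  + rewrite /poisson_primitive -angle.
    move: (poisson_angle _ (t0 + pi)) (poisson_angle _ t0) => A1 A2.
    by move: (@pi R) pin0 => P P0; field.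
  + move=> t; rewrite in_itv/= => /andP[ta tb]; apply: step_left.
    by apply: sin_lt0; apply/andP; split; lra.
  + move=> t; rewrite in_itv/= => /andP[ta tb]; apply: step_right.
    by apply: sin_gt0; apply/andP; split; lra.
  + move=> t; rewrite in_itv/= => /andP[ta tb]; apply: step_left.
    have -> : t - t0 = t - t0 - 2 * pi + 2 * pi by ring.
    rewrite sinD2; apply: sin_lt0; apply/andP; split. - by move: ta; rewrite -subr_gt0 => ta; rewrite -subr_gt0; apply: (lt_le_trans ta); rewrite le_eqVlt; apply/orP; left; apply/eqP; ring.
      by move: tb; move: (@pi R) t0_ge0 => P *; lra.
- have angle' : poisson_angle (to_disk t0 p) (t0 - pi) = poisson_angle (to_disk t0 p) (t0 + pi).
    have -> : t0 + pi = (t0 - pi) + 2 * pi by ring.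
    by rewrite /poisson_angle mulr_natl sinD2pi cosD2pi.
  rewrite (@integral_poisson_step _ _ _ beta alpha (t0 - pi) t0)//; try lra.
  + rewrite /poisson_primitive -angle angle'.
    move: (poisson_angle _ (t0 + pi)) (poisson_angle _ t0) => A1 A2.
    by move: (@pi R) pin0 => P P0; field.
  + move=> t; rewrite in_itv/= => /andP[ta tb]; apply: step_right.
    rewrite -sinD2; apply: sin_gt0; apply/andP; split.
      by rewrite -addrA ltr_pwDl// addrC subr_ge0.
    move: tb; rewrite -subr_gt0 => tb; rewrite -subr_gt0; apply: (lt_le_trans tb).
    by rewrite le_eqVlt; apply/orP; left; apply/eqP; ring.
  + move=> t; rewrite in_itv/= => /andP[ta tb]; apply: step_left.
    by apply: sin_lt0; apply/andP; split; lra.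
  + move=> t; rewrite in_itv/= => /andP[ta tb]; apply: step_right.
    by apply: sin_gt0; apply/andP; split; lra.
Qed.

(** Split g into [step] and g - [step]. The first part gives the arctangent. The second vanishes
    where the truncation is active, so elsewhere the kernel can be written in terms of
    [cot_half]. *)
Lemma poisson_integral_jump p : half_plane p ->
  poisson_integral g (to_disk t0 p) = beta + (alpha - beta) * (2^-1 + atan p.2 / pi)
    + p.1 * kernel_int mu circle cot_half 1 jump_weight p.
Proof.
move=> Hp; have w1 := to_disk_disk t0 Hp.
have pi0 := pi_gt0 R; have pin0 : pi != 0 :> R by rewrite gt_eqF.
have mc : measurable circle by [].
have fc : (mu circle < +oo)%E by exact: lebesgue_itv_lty.
have bK : bounded_measurable circle (poisson_kernel (to_disk t0 p)).
  exact: bmeas_poisson_kernel.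
have bS := bmeasM bK bmeas_step.
have bW := bmeas_kernel bmeas_cot_half 1 p bmeas_jump_weight.
have bJ := bmeasM (bmeas_cst circle p.1) bW.
have bJ2 := bmeasM (bmeas_cst circle (2 * pi)) bJ.
rewrite /poisson_integral /kernel_int.
rewrite -(@RintegralZ_bmeas _ _ _ mu circle mc fc p.1 _ bW).
have -> : \int[mu]_(t in `[0, 2 * pi])
    ((1 - sqnorm (to_disk t0 p)) / sqnorm (expi t - to_disk t0 p) * g (expi t))
  = \int[mu]_(t in circle) (poisson_kernel (to_disk t0 p) t * step t
      + 2 * pi * (p.1 * (jump_weight t * (den (cot_half t) p)^-1 ^+ 1))).
  apply: eq_Rintegral => t _; rewrite -/(poisson_kernel (to_disk t0 p) t).
  have [ck|kc] := ltP (1 - cos (t - t0)) kappa.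
    have gs : g (expi t) = step t.
      rewrite /step; case: ifP => [s0|_]; first exact: g_right.
      by case: ifP => // s0; exact: g_left.
    by rewrite /jump_weight gs subrr mulr0 !mul0r !mulr0 addr0.
  have c0 : 1 - cos (t - t0) != 0 by rewrite gt_eqF// (lt_le_trans kappa_gt0).
  have chE : cot_half t = sin (t - t0) / (1 - cos (t - t0)).
    by rewrite /cot_half max_l.
  rewrite (poisson_kernel_to_disk Hp c0) -chE /jump_weight expr1.
  move: (@pi R) pin0 (den_neq0 (cot_half t) p) => P P0 D0.
  by field; rewrite P0 D0.
rewrite (@RintegralD_bmeas _ _ _ mu circle mc fc _ _ bS bJ2)
  (@RintegralZ_bmeas _ _ _ mu circle mc fc _ _ bJ) integral_step//.
rewrite -mulrDr mulKf //; by rewrite mulf_neq0.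
Qed.

End Component.
End BoundaryJump.

(** * The blow-up at the jump *)

Section BlowUp.
Variable R : realType.
Implicit Types (p : plane R) (a b : L3 R) (f sg : R -> R).

Local Notation mu := (@lebesgue_measure R).
Local Notation circle := (`[0, 2 * pi]%classic : set R).

Definition blowup1 sg f (alpha beta : R) p : R :=
  beta + (alpha - beta) * (2^-1 + atan p.2 / pi)
  + p.1 * kernel_int mu circle sg 1 f p.

Definition blowup sg f1 f2 f3 a b p : L3 R :=
  ((blowup1 sg f1 a.1.1 b.1.1 p, blowup1 sg f2 a.1.2 b.1.2 p),
   blowup1 sg f3 a.2 b.2 p).

Lemma expi_normalize (t0 : R) :
  exists t1, [/\ 0 <= t1, t1 <= 2 * pi & expi t1 = expi t0].
Proof.
have pi0 := pi_gt0 R.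
have c1 : -1 <= cos t0 <= 1 by rewrite cos_geN1 cos_le1.
have cK : cos (acos (cos t0)) = cos t0 by rewrite acosK// in_itv.
have sE : sin (acos (cos t0)) = `|sin t0|.
  by rewrite sin_acos// -sin2cos2 sqrtr_sqr.
have a0 := acos_ge0 c1; have api := acos_lepi c1.
have [s0|s0] := leP 0 (sin t0).
  exists (acos (cos t0)); split=> //.
    by rewrite (le_trans api)// ler_peMl ?ler1n// ltW.
  by rewrite /expi cK sE ger0_norm.
exists (2 * pi - acos (cos t0)); split.
- by rewrite subr_ge0 (le_trans api)// ler_peMl ?ler1n// ltW.
- by rewrite gerBl.
have -> : 2 * pi - acos (cos t0) = - acos (cos t0) + 2 * pi by rewrite addrC.
by rewrite /expi mulr_natl sinD2pi cosD2pi cosN sinN cK sE ltr0_norm ?opprK.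
Qed.

(** Shrinking is assumed for real parameters near [t0], whereas the integral needs it near a point
    of the circle, for every parameter of it. The angular distance x is the arccosine of the
    cosine. *)
Lemma expi_near (t0 t1 eta t : R) : expi t1 = expi t0 -> 0 < eta -> eta < pi ->
  1 - cos (t - t1) < 1 - cos eta ->
  (0 < sin (t - t1) -> exists x, [/\ 0 < x, x < eta & expi t = expi (t0 + x)]) /\
  (sin (t - t1) < 0 -> exists x, [/\ 0 < x, x < eta & expi t = expi (t0 - x)]).
Proof.
move=> [c10 s10] eta0 etapi ct.
have pi0 := pi_gt0 R.
have := subrK t1 t; rewrite addrC; move: (t - t1) ct => y ct ty.
have c1 : -1 <= cos y <= 1 by rewrite cos_geN1 cos_le1.
pose x := acos (cos y).
have cK : cos x = cos y by rewrite acosK// in_itv.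
have sE : sin x = `|sin y| by rewrite sin_acos// -sin2cos2 sqrtr_sqr.
have x0 : 0 <= x := acos_ge0 c1; have xpi : x <= pi := acos_lepi c1.
have xeta : x < eta.
  rewrite -(@ltr_cos R) ?in_itv/= ?x0 ?xpi ?(ltW eta0) ?(ltW etapi)// cK.
  by lra.
have xgt0 : sin y != 0 -> 0 < x.
  move=> sy; rewrite lt0r x0 andbT; apply/eqP => x00.
  by move: sE; rewrite x00 sin0 => /esym/eqP; rewrite normr_eq0 (negbTE sy).
split=> sy; exists x; split=> //.
- by apply: xgt0; rewrite gt_eqF.
- by rewrite -ty /expi !cosD !sinD cK sE gtr0_norm// c10 s10.
- by apply: xgt0; rewrite lt_eqF.
- by rewrite -ty /expi !cosD !sinD cosN sinN cK sE ltr0_norm// opprK c10 s10.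
Qed.

Lemma boundary_map_component (X Xhat : plane R -> L3 R) (c : L3 R -> R) :
  measurable_fun setT c -> (forall v : L3 R, `|c v| <= `|v|) ->
  boundary_map X Xhat ->
  bounded_measurable circle (fun t => c (Xhat (expi t))).
Proof.
move=> mc cb [mX [M [Mr bX]] _]; split.
  by apply: measurable_funTS; exact: measurableT_comp mc mX.
exists (M + 1) => t _; apply: le_trans (cb _) _.
by apply: (bX (M + 1)); rewrite ?ltrDl.
Qed.

Lemma shrinking_blowup (S : set (L3 R)) a b : shrinking_singularities S a b ->
  exists (X : plane R -> L3 R) (t0 : R) sg f1 f2 f3,
    [/\ isothermal_parametrization S X, bounded_measurable circle sg &
        [/\ bounded_measurable circle f1, bounded_measurable circle f2
          & bounded_measurable circle f3]] /\
    (forall p, half_plane p -> X (to_disk t0 p) = blowup sg f1 f2 f3 a b p).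
Proof.
move=> [X [Xhat [iX bX [t0 [eps [delta [eps0 delta0 Xa Xb]]]]]]].
have pi0 := pi_gt0 R.
have [t1 [t10 t12 t1E]] := expi_normalize t0.
(* The cap pi / 2 keeps [eta] in the range where the cosine is decreasing, so that 1 - cos below
   [kappa] means angular distance below [eta]. *)
pose eta := Num.min (Num.min eps delta) (pi / 2).
have eta0 : 0 < eta by rewrite !lt_min eps0 delta0 divr_gt0.
have etae : eta <= eps by rewrite !ge_min lexx.
have etad : eta <= delta by rewrite !ge_min lexx orbT.
have etapi : eta < pi.
  have : eta <= pi / 2 by rewrite ge_min lexx orbT.
  by move/le_lt_trans; apply; rewrite gtr_pMr// invf_lt1// ltr1n.
pose kappa := 1 - cos eta.
have kappa0 : 0 < kappa.
  rewrite subr_gt0 -cos0 ltr_cos// in_itv/= ?lexx ?(ltW pi0)//.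
  by rewrite (ltW eta0) (ltW etapi).
have Xleft t : 1 - cos (t - t1) < kappa -> sin (t - t1) < 0 -> Xhat (expi t) = a.
  move=> ct st; have [_ /(_ st) [x [x0 xe ->]]] := expi_near t1E eta0 etapi ct.
  by apply: Xa; apply/andP; split; lra.
have Xright t : 1 - cos (t - t1) < kappa -> 0 < sin (t - t1) -> Xhat (expi t) = b.
  move=> ct st; have [/(_ st) [x [x0 xe ->]] _] := expi_near t1E eta0 etapi ct.
  by apply: Xb; apply/andP; split; lra.
have bc1 : bounded_measurable circle (fun t => (Xhat (expi t)).1.1).
  apply: (boundary_map_component (c := fun v => v.1.1)) bX => [|v].
    by apply: (measurableT_comp (f := fst)) => //; exact: measurable_fst.
  by rewrite (le_trans (norm_fst_le _))// prod_normE le_max lexx.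
have bc2 : bounded_measurable circle (fun t => (Xhat (expi t)).1.2).
  apply: (boundary_map_component (c := fun v => v.1.2)) bX => [|v].
    by apply: (measurableT_comp (f := snd)) => //; exact: measurable_snd.
  by rewrite (le_trans (norm_snd_le _))// prod_normE le_max lexx.
have bc3 : bounded_measurable circle (fun t => (Xhat (expi t)).2).
  apply: (boundary_map_component (c := fun v => v.2)) bX => [|v].
    exact: measurable_snd.
  by rewrite prod_normE le_max lexx orbT.
exists X, t1, (cot_half t1 kappa).
exists (jump_weight t1 kappa (fun z => (Xhat z).1.1) a.1.1 b.1.1).
exists (jump_weight t1 kappa (fun z => (Xhat z).1.2) a.1.2 b.1.2).
exists (jump_weight t1 kappa (fun z => (Xhat z).2) a.2 b.2).
split; first split=> //.
- exact: bmeas_cot_half.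
- by split; apply: bmeas_jump_weight.
move=> p Hp; have [_ _ XE] := bX; rewrite XE; last exact: to_disk_disk.
rewrite /poisson_integral3 /blowup /blowup1.
congr (_, _, _); apply: poisson_integral_jump => //.
- by move=> t c s; rewrite Xleft.
- by move=> t c s; rewrite Xright.
- by move=> t c s; rewrite Xleft.
- by move=> t c s; rewrite Xright.
- by move=> t c s; rewrite Xleft.
- by move=> t c s; rewrite Xright.
Qed.

End BlowUp.

(** * Nondegeneracy *)

Section CotPowers.
Variable R : realType.
Implicit Types (s x : R) (n : nat).

(* real and imaginary parts of (i - s) ^ n *)
Fixpoint pow_is n s : R * R :=
  if n is n'.+1 then
    (- s * (pow_is n' s).1 - (pow_is n' s).2, (pow_is n' s).1 - s * (pow_is n' s).2)
  else (1, 0).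

(** De Moivre: for s = - cot x one has i - s = e^(ix) / sin x. *)
Lemma pow_is_trig n x : sin x != 0 ->
  pow_is n (- cos x / sin x) =
  (cos (n%:R * x) / sin x ^+ n, sin (n%:R * x) / sin x ^+ n).
Proof.
move=> sx; elim: n => [|n IH].
  by rewrite /= mul0r cos0 sin0 expr0 divr1 mul0r.
rewrite /= IH /= -natr1 mulrDl mul1r cosD sinD exprS.
have sn : sin x ^+ n != 0 by rewrite expf_neq0.
by congr pair; field; rewrite sn sx.
Qed.

(** Exponents start at 2 because the imaginary part of i - s is constantly 1. In the variable x of
    [pow_is_trig] the sign is that of sin ((n + 2) x), and x ranges over an interval of length
    pi. *)
Lemma pow_is_sign n : exists s1 s2, 0 < (pow_is n.+2 s1).2 /\ (pow_is n.+2 s2).2 < 0.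
Proof.
have pi0 := pi_gt0 R.
have n0 : 0 < n.+2%:R :> R by rewrite ltr0n.
have n2 : 2 <= n.+2%:R :> R by rewrite ler_nat.
(* The multiples (n + 2) x are pi / 2 and 3 pi / 2, where the sine is 1 and - 1; x2 < pi because n +
   2 >= 2. *)
pose x1 : R := pi / 2 / n.+2%:R; pose x2 : R := (pi / 2 + pi) / n.+2%:R.
have sx1 : 0 < sin x1.
  apply: sin_gt0_pi; rewrite /x1 !divr_gt0//= ltr_pdivrMr//.
  by apply: (@lt_le_trans _ _ (pi * 2)); [lra|rewrite ler_pM2l].
have sx2 : 0 < sin x2.
  apply: sin_gt0_pi; rewrite /x2; apply/andP; split.
    by rewrite divr_gt0// addr_gt0// divr_gt0.
  rewrite ltr_pdivrMr//.
  by apply: (@lt_le_trans _ _ (pi * 2)); [lra|rewrite ler_pM2l].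
exists (- cos x1 / sin x1), (- cos x2 / sin x2).
rewrite !pow_is_trig ?gt_eqF//=.
have -> : n.+2%:R * x1 = pi / 2 by rewrite /x1 mulrC divfK ?gt_eqF.
have -> : n.+2%:R * x2 = pi / 2 + pi by rewrite /x2 mulrC divfK ?gt_eqF.
rewrite sinDpi sin_pihalf; split; first by rewrite divr_gt0// exprn_gt0.
by rewrite mulNr oppr_lt0 divr_gt0// exprn_gt0.
Qed.

Lemma pow_is_bound n s : `|s| <= 1 ->
  `|(pow_is n s).1| <= 2 ^+ n /\ `|(pow_is n s).2| <= 2 ^+ n.
Proof.
move=> s1; elim: n => [|n [IH1 IH2]]; first by rewrite /= normr1 normr0 expr0.
have e1 : `|s * (pow_is n s).1| <= 2 ^+ n by rewrite normrM (le_trans _ IH1)// ler_piMl.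
have e2 : `|s * (pow_is n s).2| <= 2 ^+ n by rewrite normrM (le_trans _ IH2)// ler_piMl.
rewrite /= exprS mulNr; split; rewrite (le_trans (ler_normB _ _))// ?normrN; lra.
Qed.

Lemma C_on_pow_is n m (U : set (plane R)) : open U ->
  C_on m U (fun p : plane R => (pow_is n p.2).1) /\
  C_on m U (fun p : plane R => (pow_is n p.2).2).
Proof.
move=> oU; have c2 : C_on m U (snd : plane R -> R) by exact: C_on_pr2.
elim: n => [|n [IH1 IH2]]; first by split; exact: C_on_cst.
split; first exact: (C_onB oU (C_onM oU (C_onN oU c2) IH1) IH2).
exact: (C_onB oU IH1 (C_onM oU c2 IH2)).
Qed.

End CotPowers.

(** * Moments of the weight and the sign of the Jacobian *)

Section Nondegenerate.
Context d (T : measurableType d) (R : realType).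
Variables (mu : {measure set T -> \bar R}) (D : set T).
Hypotheses (mD : measurable D) (fD : (mu D < +oo)%E).
Variable sigma : T -> R.
Hypothesis bsigma : bounded_measurable D sigma.
Variable g : T -> R.
Hypothesis bg : bounded_measurable D g.
Implicit Types (p q : plane R) (n N : nat).

Local Notation e1 := ((1, 0) : plane R).
Local Notation e2 := ((0, 1) : plane R).

Let moment N : R := \int[mu]_(t in D) (g t * sigma t ^+ N).

Let gs N := bmeasM bg (bmeasX N bsigma).

(* With zeta = r (i - s), kernel_int 1 g is the integral of
   g Im (zeta / (1 - sigma zeta)) / r, and r ^ N * remainder N is what is left
   of it after the first N terms of the geometric series. *)
Let remainder N p : R :=
  (pow_is N.+1 p.2).2 * kernel_int mu D sigma 1 (fun t => g t * sigma t ^+ N) p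
  + p.1 * (p.2 * (pow_is N.+1 p.2).2 + (pow_is N.+1 p.2).1) *
    kernel_int mu D sigma 1 (fun t => g t * sigma t ^+ N.+1) p.

Let remainderE N p : remainder N p =
  \int[mu]_(t in D) (g t * sigma t ^+ N * (den (sigma t) p)^-1
    * ((pow_is N.+1 p.2).2 * (1 + sigma t * p.1 * p.2)
       + (pow_is N.+1 p.2).1 * (sigma t * p.1))).
Proof.
have k1 := bmeas_kernel bsigma 1 p (gs N).
have k2 := bmeas_kernel bsigma 1 p (gs N.+1).
rewrite /remainder /kernel_int -!(@RintegralZ_bmeas _ _ _ mu D mD fD)//.
rewrite -(@RintegralD_bmeas _ _ _ mu D mD fD); first last.
- exact: bmeasM (bmeas_cst D _) k2.
- exact: bmeasM (bmeas_cst D _) k1.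
by apply: eq_Rintegral => t _; rewrite expr1 exprS; ring.
Qed.

(** One step of the geometric series: 1 / (1 - sigma zeta) = 1 + sigma zeta / (1 - sigma zeta),
    multiplied by (i - s)^(N+1), with zeta = r (i - s). *)
Let remainderS N p :
  remainder N p = (pow_is N.+1 p.2).2 * moment N + p.1 * remainder N.+1 p.
Proof.
have k1 := gs N; have k2 := bmeas_kernel bsigma 1 p (gs N.+1).
have bf : bounded_measurable D (fun t => g t * sigma t ^+ N.+1 * (den (sigma t) p)^-1
    * ((pow_is N.+2 p.2).2 * (1 + sigma t * p.1 * p.2)
       + (pow_is N.+2 p.2).1 * (sigma t * p.1))).
  have b1 := bmeasM bsigma (bmeas_cst D p.1).
  have b2 := bmeasD (bmeas_cst D 1) (bmeasM b1 (bmeas_cst D p.2)).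
  have b3 := bmeasD (bmeasM (bmeas_cst D (pow_is N.+2 p.2).2) b2) (bmeasM (bmeas_cst D (pow_is N.+2 p.2).1) b1).
  exact: bmeasM k2 b3.
rewrite (remainderE N.+1) remainderE /moment.
rewrite -!(@RintegralZ_bmeas _ _ _ mu D mD fD)//.
rewrite -(@RintegralD_bmeas _ _ _ mu D mD fD); first last.
- exact: bmeasM (bmeas_cst D _) bf.
- exact: bmeasM (bmeas_cst D _) k1.
apply: eq_Rintegral => t _; have := den_neq0 (sigma t) p.
have -> : pow_is N.+2 p.2 = (- p.2 * (pow_is N.+1 p.2).1 - (pow_is N.+1 p.2).2,
  (pow_is N.+1 p.2).1 - p.2 * (pow_is N.+1 p.2).2) by [].
move: (pow_is N.+1 p.2) => P; rewrite /den (exprS (sigma t) N) /= => d0.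
by field; rewrite d0.
Qed.

Let remainder0 p : remainder 0 p = kernel_int mu D sigma 1 g p.
Proof.
rewrite /remainder /= mulr0 mulr1 subr0 mul1r subr0.
have -> : (fun t => g t * sigma t ^+ 0) = g by apply/funext => t; rewrite expr0 mulr1.
by ring.
Qed.

Let kernel_remainder N p : (forall n, (n < N)%N -> moment n = 0) ->
  kernel_int mu D sigma 1 g p = p.1 ^+ N * remainder N p.
Proof.
elim: N => [|N IH] m0; first by rewrite expr0 mul1r remainder0.
rewrite IH => [|n nN]; last by apply: m0; rewrite (ltn_trans nN).
by rewrite remainderS m0// mulr0 add0r exprSr mulrA.
Qed.

Let smooth_remainder N : smooth_on setT (remainder N).
Proof.
move=> n; have oT : open [set: plane R] := openT.
have c1 : C_on n setT (fst : plane R -> R) by exact: C_on_pr1.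
have c2 : C_on n setT (snd : plane R -> R) by exact: C_on_pr2.
have [P Q] := C_on_pow_is N.+1 n oT.
have k1 := smooth_kernel_int mD fD bsigma 1 (gs N) n.
have k2 := smooth_kernel_int mD fD bsigma 1 (gs N.+1) n.
exact: (C_onD oT (C_onM oT Q k1)
  (C_onM oT (C_onM oT c1 (C_onD oT (C_onM oT c2 Q) P)) k2)).
Qed.


Let remainder_axis N (s : R) : remainder N (0, s) = (pow_is N.+1 s).2 * moment N.
Proof. by rewrite remainderS /= mul0r addr0. Qed.

Let differentiable_remainder N p : differentiable (remainder N) p.
Proof. by have [dE _] := smooth_remainder N 1; exact: dE. Qed.

Let continuous_remainder N : continuous (remainder N).
Proof. by move=> p; exact: differentiable_continuous. Qed.

Let continuous_D_remainder N v : continuous ('D_v (remainder N)).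
Proof. by move=> p; have [_ cE] := smooth_remainder N 1; exact: cE. Qed.

Lemma is_diff_fstX n p :
  is_diff p (fun q : plane R => q.1 ^+ n.+1) (fun v => n.+1%:R * p.1 ^+ n * v.1).
Proof.
have cf : continuous (fst : plane R -> R) by move=> q; exact: cvg_fst.
have df := @is_diff_linear _ _ _ (fst : plane R -> R) p (fun _ _ _ => erefl) cf.
have := is_diffX n df.
rewrite (_ : fst ^+ n.+1 = (fun q : plane R => q.1 ^+ n.+1))//.
by apply/funext => q; rewrite exprfctE.
Qed.

Let is_diff_Y N c p :
  is_diff p (fun q : plane R => c + q.1 ^+ N.+1 * remainder N q)
    (fun v => N.+1%:R * p.1 ^+ N * v.1 * remainder N p
              + p.1 ^+ N.+1 * 'D_v (remainder N) p).
Proof.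
have dE := differentiableP (differentiable_remainder N p).
have h := is_diffD (is_diff_cst c p) (is_diffM (is_diff_fstX N p) dE).
have e : (cst c + (fun q : plane R => q.1 ^+ N.+1) * remainder N)
  = (fun q : plane R => c + q.1 ^+ N.+1 * remainder N q) by [].
rewrite e in h; apply: is_diff_eq h _; apply/funext => v.
rewrite !fctE /= add0r addrC (deriveE _ (differentiable_remainder N p)).
by rewrite /GRing.scale/= [X in X + _]mulrC.
Qed.

(** The Jacobian of [A] and r^(N+1) times the remainder, after division by r^N. Unlike the quotient
    it makes sense on the axis, where only the term with the factor N + 1 survives. *)
Let bracket (A : plane R -> R) N p : R := 'D_e1 A p * (p.1 * 'D_e2 (remainder N) p)
  - 'D_e2 A p * (N.+1%:R * remainder N p + p.1 * 'D_e1 (remainder N) p).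

Let continuous_bracket (A : plane R -> R) N : smooth_on setT A -> continuous (bracket A N).
Proof.
move=> SA p; have [_ DA] := SA 1%N.
have c1 : {for p, continuous (fst : plane R -> R)} by exact: cvg_fst.
have a1 : {for p, continuous ('D_e1 A)} by exact: DA.
have a2 : {for p, continuous ('D_e2 A)} by exact: DA.
have r0 := @continuous_remainder N p.
have r1 := @continuous_D_remainder N e1 p.
have r2 := @continuous_D_remainder N e2 p.
have cN : {for p, continuous (fun _ : plane R => N.+1%:R : R)} by exact: cst_continuous.
exact: (continuousB (continuousM a1 (continuousM c1 r2))
  (continuousM a2 (continuousD (continuousM cN r0) (continuousM c1 r1)))).
Qed.

Lemma half_plane_limit_ge0 (f : plane R -> R) (s : R) : continuous f ->
  (forall p, 0 < p.1 -> 0 <= f p) -> 0 <= f (0, s).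
Proof.
move=> cf f0; rewrite leNgt; apply/negP => fs.
have : \forall p \near ((0, s) : plane R), f p < 0 by exact: cvgr_lt (cf _) _ fs.
move=> /nbhs_normP[e e0 he].
have /he : ball_ (fun x : plane R => `|x|) (0, s) e (e / 2, s).
  rewrite /ball_ /= prod_normE /= subrr normr0 sub0r normrN.
  rewrite max_l// ger0_norm ?divr_ge0 ?ltW// ltr_pdivrMr//.
  by rewrite ltr_pMr// ltr1n.
by rewrite ltNge f0//= divr_gt0.
Qed.

Lemma half_plane_constant_sign (f : plane R -> R) p q : continuous f ->
  (forall p, 0 < p.1 -> f p != 0) -> 0 < p.1 -> 0 < q.1 -> 0 < f p * f q.
Proof.
move=> cf f0 p0 q0; rewrite ltNge; apply/negP => fpq.
pose l (t : R) := q + t *: (p - q).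
have cl : continuous l.
  by move=> t; apply: (@continuousD _ _ _ (fun _ : R => q) (fun t : R => t *: (p - q))); [exact: cst_continuous|exact: scalel_continuous].
have cfl : {within `[0, 1], continuous (f \o l)}.
  by apply: continuous_subspaceT => t; apply: continuous_comp; [exact: cl|exact: cf].
have l0 : l 0 = q by rewrite /l scale0r addr0.
have l1 : l 1 = p by rewrite /l scale1r addrC subrK.
have [|c c01 fc] := IVT (v := 0) ler01 cfl.
  rewrite /= l0 l1; have := f0 p p0; have := f0 q q0.
  rewrite ge_min le_max; case: (ltgtP (f p) 0) => // fp; case: (ltgtP (f q) 0) => // fq _ _.
  - by have := nmulr_lgt0 (f p) fq; rewrite fp => h; move: fpq; rewrite leNgt h.
  - by have := mulr_gt0 fp fq; rewrite ltNge fpq.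
have := f0 (l c); rewrite [f (l c)]fc eqxx => /(_ _)/negP; apply => //.
move: c01; rewrite in_itv/= => /andP[c0 c1].
rewrite /l /= /GRing.scale/=.
have -> : q.1 + c * (p.1 - q.1) = (1 - c) * q.1 + c * p.1 by ring.
have [c1'|c1'] := ltP c 1.
  by rewrite ltr_pwDl ?mulr_gt0 ?subr_gt0// mulr_ge0// ltW.
by rewrite ltr_wpDl ?mulr_gt0 ?(lt_le_trans _ c1')// mulr_ge0 ?subr_ge0// ltW.
Qed.

(** Without moments the integral equals r^N times the N-th remainder for every N, and for small r
    this is at most a constant times 2^-N. *)
Let kernel_vanishes : (forall N, moment N = 0) ->
  exists2 r0 : R, 0 < r0 & forall p, 0 < p.1 -> p.1 < r0 -> `|p.2| < 1 ->
    kernel_int mu D sigma 1 g p = 0.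
Proof.
move=> m0; have [_ [G gG]] := bg; have [_ [S' sS]] := bsigma.
pose S := Num.max S' 1; have S1 : 1 <= S by rewrite le_max lexx orbT.
have S0 : 0 < S by rewrite (lt_le_trans ltr01).
have {}sS t : D t -> `|sigma t| <= S by move=> /sS h; rewrite le_max h.
(* Each power of i - s costs a factor 2 and each power of sigma a factor [S], so the ratio is 2 S r,
   below 1/2 in this range. *)
exists (4 * S)^-1; first by rewrite invr_gt0 mulr_gt0.
move=> p r0 rS s1; set K := kernel_int _ _ _ _ _ _.
have rS1 : 2 * S * p.1 <= 2^-1.
  have : p.1 * (4 * S) < 1 by rewrite -ltr_pdivlMr// ?div1r// mulr_gt0.
  lra.
pose C := `|G| * 16 * fine (mu D).
have KC N : `|K| <= C * 2^-1 ^+ N.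
  rewrite /K (@kernel_remainder N p) => [|n _]; last exact: m0.
  rewrite normrM normrX gtr0_norm//.
  have Eb : `|remainder N p| <= `|G| * S ^+ N * 2 * (2 ^+ N.+1 * 4) * fine (mu D).
    rewrite remainderE; apply: (Rintegral_bound mD fD).
      have k2 := bmeas_kernel bsigma 1 p (gs N).
      have b1 := bmeasM bsigma (bmeas_cst D p.1).
      have b2 := bmeasD (bmeas_cst D 1) (bmeasM b1 (bmeas_cst D p.2)).
      have b3 := bmeasD (bmeasM (bmeas_cst D (pow_is N.+1 p.2).2) b2)
        (bmeasM (bmeas_cst D (pow_is N.+1 p.2).1) b1).
      exact: bmeasM k2 b3.
    move=> t Dt; have [P Q] := pow_is_bound N.+1 (ltW s1).
    have sr : `|sigma t * p.1| <= 1.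
      rewrite normrM (gtr0_norm r0) (@le_trans _ _ (S * p.1))//.
        by rewrite ler_wpM2r ?sS// ltW.
      lra.
    have srs : `|sigma t * p.1 * p.2| <= 1.
      by rewrite normrM mulr_ile1// ltW.
    have dI : `|(den (sigma t) p)^-1| <= 2.
      rewrite ger0_norm ?invr_ge0 ?(ltW (den_gt0 _ _))//.
      rewrite -[leRHS]invrK lef_pV2 ?posrE ?den_gt0 ?invr_gt0//.
      apply: le_trans (den_ge _ _); rewrite lef_pV2 ?posrE//; last first.
        by rewrite ltr_pwDl ?sqr_ge0.
      have : p.2 ^+ 2 <= 1 by rewrite -real_normK ?num_real// exprn_ile1// ltW.
      lra.
    have gs1 : `|g t * sigma t ^+ N| <= `|G| * S ^+ N.
      rewrite normrM normrX ler_pM ?exprn_ge0//.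
        by rewrite (le_trans (gG t Dt))// ler_norm.
      by rewrite lerXn2r ?nnegrE ?sS// ltW.
    have w0 : 0 <= 2 ^+ N.+1 :> R by rewrite exprn_ge0.
    have e1 : `|(pow_is N.+1 p.2).2 * (1 + sigma t * p.1 * p.2)| <= 2 ^+ N.+1 * 2.
      rewrite normrM ler_pM// (le_trans (ler_normD _ _))// normr1; lra.
    have e2 : `|(pow_is N.+1 p.2).1 * (sigma t * p.1)| <= 2 ^+ N.+1 * 1.
      by rewrite normrM ler_pM.
    rewrite normrM ler_pM//; last by rewrite (le_trans (ler_normD _ _))//; lra.
    by rewrite normrM ler_pM.
  apply: le_trans (ler_wpM2l _ Eb) _; first by rewrite exprn_ge0// ltW.
  have -> : p.1 ^+ N * (`|G| * S ^+ N * 2 * (2 ^+ N.+1 * 4) * fine (mu D))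
     = C * (2 * S * p.1) ^+ N.
    by rewrite /C !exprMn exprS; ring.
  rewrite ler_wpM2l//; first by rewrite /C !mulr_ge0// fine_ge0.
  by rewrite lerXn2r ?nnegrE ?mulr_ge0 ?invr_ge0 ?(ltW r0) ?(ltW S0).
apply/eqP; rewrite -normr_le0 leNgt; apply/negP => K0.
have C0 : 0 <= C by rewrite /C !mulr_ge0// fine_ge0.
have [n Cn] : exists n : nat, C / `|K| < n%:R.
  by exists (Num.truncn (C / `|K|)).+1; rewrite truncnS_gt.
have := KC n; rewrite leNgt => /negP; apply.
rewrite exprVn ltr_pdivrMr ?exprn_gt0// mulrC -ltr_pdivrMr//.
apply: (lt_le_trans Cn).
by rewrite -natrX ler_nat ltnW// ltn_expl.
Qed.

Lemma kernel_int_axis (s : R) :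
  kernel_int mu D sigma 1 g (0, s) = \int[mu]_(t in D) g t.
Proof.
apply: eq_Rintegral => t _; by rewrite den0 invr1 expr1n mulr1.
Qed.

(** On the axis [Y] is constant and its r-derivative is the integral of [g]. As the s-derivative of
    [A] is positive there, the conclusion says that the Jacobian is nonzero up to the boundary of
    the half plane. *)
Lemma kernel_nondegenerate (A : plane R -> R) (c : R) : smooth_on setT A ->
  (forall s, 0 < 'D_e2 A (0, s)) ->
  let Y p := c + p.1 * kernel_int mu D sigma 1 g p in
  (forall p, 0 < p.1 -> 'D_e1 A p * 'D_e2 Y p - 'D_e2 A p * 'D_e1 Y p != 0) ->
  \int[mu]_(t in D) g t != 0.
Proof.
move=> SA A2 Y J0; apply/eqP => g0.
have [dA DA] := SA 1%N.
have YE N : (forall n, (n < N)%N -> moment n = 0) ->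
    Y = (fun q => c + q.1 ^+ N.+1 * remainder N q).
  move=> m0; apply/funext => q.
  by rewrite /Y (@kernel_remainder N q m0) mulrA -exprS.
pose J p := 'D_e1 A p * 'D_e2 Y p - 'D_e2 A p * 'D_e1 Y p.
have JE N p : (forall n, (n < N)%N -> moment n = 0) -> J p = p.1 ^+ N * bracket A N p.
  move=> m0; rewrite /J (YE N m0) !(is_diff_derive _ (is_diff_Y N c p)) /bracket.
  move: ('D_e1 A p) ('D_e2 A p) ('D_e1 (remainder N) p) ('D_e2 (remainder N) p) => a1 a2 x1 x2.
  by move: (remainder N p) => x0; rewrite exprS /=; ring.
have cJ : continuous J.
  have -> : J = bracket A 0.
    by apply/funext => p; rewrite (JE 0%N)// expr0 mul1r.
  exact: continuous_bracket.
pose j0 := J (1, 0).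
have j00 : j0 != 0 by apply: J0 => /=.
have Jsign p : 0 < p.1 -> 0 < J p * j0.
  by move=> p0; apply: half_plane_constant_sign.
have m0 : forall N, moment N = 0.
  elim/ltn_ind => -[_|N IH].
    by rewrite -g0; apply: eq_Rintegral => t _; rewrite expr0 mulr1.
  (* The positive power of r can be divided out, so the constant sign of [J] passes to [bracket] and
     to its limit on the axis. *)
  have B0 (s : R) : 0 <= bracket A N.+1 (0, s) * j0.
    apply: (@half_plane_limit_ge0 (fun p => bracket A N.+1 p * j0)) => [p|p p0].
      by apply: continuousM; [exact: continuous_bracket|exact: cst_continuous].
    have := Jsign p p0; rewrite (JE N.+1)// -mulrA => h.
    by rewrite ltW// -(pmulr_rgt0 _ (exprn_gt0 N.+1 p0)).
  have Q0 (s : R) : (pow_is N.+2 s).2 * (moment N.+1 * j0) <= 0.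
    have Bx : bracket A N.+1 (0, s)
        = - 'D_e2 A (0, s) * (N.+2%:R * ((pow_is N.+2 s).2 * moment N.+1)).
      rewrite /bracket remainder_axis.
      move: ('D_e1 A (0, s)) ('D_e2 A (0, s)) ('D_e1 (remainder N.+1) (0, s))
        ('D_e2 (remainder N.+1) (0, s)) (moment N.+1) (pow_is N.+2 s).
      by move=> a1 a2 x1 x2 m P; rewrite /=; ring.
    have Ap : 0 < 'D_e2 A (0, s) * N.+2%:R by rewrite mulr_gt0// ltr0n.
    have := B0 s; rewrite Bx; move: Ap.
    move: ('D_e2 A (0, s)) (moment N.+1) (pow_is N.+2 s) => a2 m P Ap h.
    by rewrite -oppr_ge0 -(pmulr_rge0 _ Ap); move: h; congr (0 <= _); ring.
  (* A factor of either sign forces moment times [j0] to be both nonnegative and nonpositive. *)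
  have [s1 [s2 [Q1 Q2]]] := pow_is_sign R N.
  have := Q0 s1; have := Q0 s2; rewrite nmulr_rle0// pmulr_rle0// => h1 h2.
  have : moment N.+1 * j0 = 0 by apply/eqP; rewrite eq_le h1 h2.
  by move=> /eqP; rewrite mulf_eq0 (negbTE j00) orbF => /eqP.
have [r0 r00 kv] := kernel_vanishes m0.
pose p : plane R := (r0 / 2, 0).
have p0 : 0 < p.1 by rewrite divr_gt0.
have nY : \forall q \near p, Y q = c.
  (* The two radii keep q.1 strictly between 0 and r0 and the absolute value of q.2 below 1. *)
  apply/nbhs_normP; exists (Num.min (r0 / 2) 1); first by rewrite /= lt_min divr_gt0//=.
  move=> q /=; rewrite prod_normE gt_max !lt_min /= sub0r normrN.
  move=> /andP[/andP[q1 _] /andP[_ q2]].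
  move: q1; rewrite ltr_norml => /andP[q3 q4].
  by rewrite /Y kv ?mulr0 ?addr0//; lra.
have DY v : 'D_v Y p = 0.
  have -> : 'D_v Y p = 'D_v (cst c) p by exact: near_eq_derive.
  by rewrite derive_cst.
by have := J0 p p0; rewrite !DY !mulr0 subrr eqxx.
Qed.

End Nondegenerate.

(** * Symmetry, spacelikeness and regularity of the blown-up map *)

Section BlowUpGeometry.
Variable R : realType.
Implicit Types (p v : plane R).

Local Notation mu := (@lebesgue_measure R).
Local Notation circle := (`[0, 2 * pi]%classic : set R).
Local Notation e1 := ((1, 0) : plane R).
Local Notation e2 := ((0, 1) : plane R).

Let mcircle : measurable circle. Proof. by []. Qed.
Let fcircle : (mu circle < +oo)%E. Proof. exact: lebesgue_itv_lty. Qed.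

Variable sg : R -> R.
Hypothesis bsg : bounded_measurable circle sg.

Lemma smooth_blowup1 f (alpha beta : R) : bounded_measurable circle f ->
  smooth_on setT (blowup1 sg f alpha beta).
Proof.
move=> bf n; have oT : open [set: plane R] := openT.
have c1 : C_on n setT (fst : plane R -> R) by exact: C_on_pr1.
have c2 : C_on n setT (snd : plane R -> R) by exact: C_on_pr2.
have k := @smooth_kernel_int _ _ _ mu circle mcircle fcircle sg bsg 1 f bf n.
have cc (x : R) := C_on_cst n [set: plane R] x.
exact: (C_onD oT (C_onD oT (cc beta) (C_onMl (alpha - beta) oT
  (C_onD oT (cc 2^-1) (C_onM oT (C_on_atan oT c2) (cc pi^-1)))))
  (C_onM oT c1 k)).
Qed.

(** [den] depends only on r s and r^2, so its integral is even, while the prefactor r and the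
    arctangent are odd. *)
Lemma blowup1N f (alpha beta : R) p :
  blowup1 sg f alpha beta (- p) = alpha + beta - blowup1 sg f alpha beta p.
Proof.
have pin0 : pi != 0 :> R by rewrite gt_eqF// pi_gt0.
rewrite /blowup1 /=.
have -> : kernel_int mu circle sg 1 f (- p) = kernel_int mu circle sg 1 f p.
  apply: eq_Rintegral => t _; congr (_ * _^-1 ^+ _); rewrite /den /=.
  by rewrite !mulrN mulNr opprK sqrrN.
rewrite atanN; move: (kernel_int _ _ _ _ _ _) (atan _) => K x.
by move: (@pi R) pin0 => P P0; field.
Qed.

Lemma blowup1_axis f (alpha beta s : R) :
  blowup1 sg f alpha beta (0, s) = beta + (alpha - beta) * (2^-1 + atan s / pi).
Proof. by rewrite /blowup1 /= mul0r addr0. Qed.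

Lemma derive_blowup1_axis f (alpha beta s : R) v : bounded_measurable circle f ->
  'D_v (blowup1 sg f alpha beta) (0, s)
  = v.1 * \int[mu]_(t in circle) f t + v.2 * ((alpha - beta) / (pi * (1 + s ^+ 2))).
Proof.
move=> bf; set K := kernel_int mu circle sg 1 f.
have [dK _] := @smooth_kernel_int _ _ _ mu circle mcircle fcircle sg bsg 1 f bf 1.
have pin0 : pi != 0 :> R by rewrite gt_eqF// pi_gt0.
have s0 : 1 + s ^+ 2 != 0 by rewrite gt_eqF// ltr_pwDl// sqr_ge0.
have cf : continuous (fst : plane R -> R) by move=> q; exact: cvg_fst.
have cs : continuous (snd : plane R -> R) by move=> q; exact: cvg_snd.
have df := @is_diff_linear _ _ _ (fst : plane R -> R) (0, s) (fun _ _ _ => erefl) cf.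
have ds := @is_diff_linear _ _ _ (snd : plane R -> R) (0, s) (fun _ _ _ => erefl) cs.
have [dsd _] := ds.
have datan : differentiable (@atan R) s by exact/derivable1_diffP/derivable_atan.
have da : is_diff (0, s) (fun p : plane R => atan p.2) (fun v => v.2 * (1 + s ^+ 2)^-1).
  apply: DiffDef; first exact: (@differentiable_comp _ _ _ _ snd (@atan R)).
  rewrite (@diff_comp _ _ _ _ snd (@atan R))//; apply/funext => w /=.
  rewrite deriv1E; last exact: derivable_atan.
  by rewrite derive1_atan /GRing.scale/=; have [_ ->] := ds.
have dK0 := differentiableP (dK (0, s) I).
have dFK := is_diffM df dK0.
have db := is_diffZ (alpha - beta) (is_diffZ pi^-1 da).
have dsum := is_diffD (is_diff_cst (beta + (alpha - beta) / 2) ((0, s) : plane R)) (is_diffD db dFK).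
have e : cst (beta + (alpha - beta) / 2) + (((alpha - beta) *: (pi^-1 *: (fun p : plane R => atan p.2))) + (fst : plane R -> R) * K) = blowup1 sg f alpha beta.
  apply/funext => p; rewrite /blowup1 -/K !fctE /= /GRing.scale/=.
  by move: (atan _) (K p) => x y; move: (@pi R) pin0 => P P0; field.
rewrite e in dsum; rewrite (is_diff_derive v dsum) !fctE /= /GRing.scale/=.
rewrite mul0r !add0r /K kernel_int_axis.
by move: (\int[mu]_(t in circle) f t) => J; move: (@pi R) pin0 => P P0; field; rewrite P0 s0.
Qed.

Variables (f1 f2 f3 : R -> R).
Hypotheses (bf1 : bounded_measurable circle f1)
  (bf2 : bounded_measurable circle f2) (bf3 : bounded_measurable circle f3).
Variables (a b : L3 R).

Local Notation F := (blowup sg f1 f2 f3 a b).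

Lemma smooth_blowup : smooth_on setT F.
Proof.
move=> n; have oT : open [set: plane R] := openT.
exact: (C_on_pair oT (C_on_pair oT (smooth_blowup1 a.1.1 b.1.1 bf1 n)
  (smooth_blowup1 a.1.2 b.1.2 bf2 n)) (smooth_blowup1 a.2 b.2 bf3 n)).
Qed.

Lemma differentiable_blowup p : differentiable F p.
Proof. by have [dF _] := smooth_blowup 1; exact: dF. Qed.

Lemma blowupN p : F (- p) = a + b - F p.
Proof. by rewrite /blowup !blowup1N. Qed.

Lemma blowup_axis s : F (0, s) = b + (2^-1 + atan s / pi) *: (a - b).
Proof.
by rewrite /blowup !blowup1_axis; congr (_, _, _); rewrite /= /GRing.scale/= mulrC.
Qed.

Lemma derive_blowup_axis s v : 'D_v F (0, s)
  = v.1 *: (\int[mu]_(t in circle) f1 t, \int[mu]_(t in circle) f2 t,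
            \int[mu]_(t in circle) f3 t)
    + (v.2 / (pi * (1 + s ^+ 2))) *: (a - b).
Proof.
have dF := differentiable_blowup (0, s).
rewrite (derive_pair v dF) (derive_pair v (differentiable_fst dF)).
have D f alpha beta : bounded_measurable circle f ->
   'D_v (blowup1 sg f alpha beta) (0, s) = v.1 *: (\int[mu]_(t in circle) f t)
      + (v.2 / (pi * (1 + s ^+ 2))) *: (alpha - beta).
  by move=> bf; rewrite derive_blowup1_axis// /GRing.scale/= (mulrAC v.2) mulrA.
by congr (_, _, _); [exact: (D _ a.1.1 b.1.1 bf1)|exact: (D _ a.1.2 b.1.2 bf2)|
  exact: (D _ a.2 b.2 bf3)].
Qed.

Lemma derive_blowupN p v : 'D_v F (- p) = 'D_v F p.
Proof.
have dF := differentiable_blowup (- p).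
have dN : is_diff p (fun q : plane R => - q) (fun q => - q).
  apply: is_diff_linear; last exact: opp_continuous.
  by move=> k u w; rewrite opprD scalerN.
have [dNd dNE] := dN.
have -> : 'D_v F p = 'D_v (cst (a + b) - F \o -%R) p.
  by congr ('D_v _ p); apply/funext => q; rewrite !fctE /= blowupN opprB addrC subrK.
have dc : differentiable (F \o -%R) p by exact: differentiable_comp.
rewrite deriveB; [|exact: derivable_cst|exact: diff_derivable].
rewrite derive_cst sub0r (deriveE _ dc) (diff_comp dNd dF) dNE /= linearN opprK.
by rewrite deriveE.
Qed.


Lemma sqr_sum_gt0 v : v != 0 -> 0 < v.1 ^+ 2 + v.2 ^+ 2.
Proof.
move=> v0; rewrite lt0r addr_ge0 ?sqr_ge0// andbT.
apply: contra v0; rewrite paddr_eq0 ?sqr_ge0// !sqrf_eq0 => /andP[/eqP h1 /eqP h2].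
by apply/eqP; rewrite [LHS]surjective_pairing h1 h2.
Qed.

Lemma derive_lincomb (k l : R) (x y : plane R -> R) p v :
  differentiable x p -> differentiable y p ->
  'D_v (fun q => k * x q + l * y q) p = k * 'D_v x p + l * 'D_v y p.
Proof.
move=> dx dy.
have h := is_diffD (is_diffZ k (differentiableP dx)) (is_diffZ l (differentiableP dy)).
have e : (k *: x) + (l *: y) = (fun q => k * x q + l * y q) by [].
by rewrite e in h; rewrite (is_diff_derive v h) !fctE -!deriveE.
Qed.

Lemma derive_component11 (G : plane R -> L3 R) p v : differentiable G p ->
  'D_v (fun q => (G q).1.1) p = ('D_v G p).1.1.
Proof.
by move=> dG; rewrite (derive_pair v dG) (derive_pair v (differentiable_fst dG)).
Qed.

Lemma derive_component12 (G : plane R -> L3 R) p v : differentiable G p ->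
  'D_v (fun q => (G q).1.2) p = ('D_v G p).1.2.
Proof.
by move=> dG; rewrite (derive_pair v dG) (derive_pair v (differentiable_fst dG)).
Qed.

Lemma plane_inv0 (p1 p2 : plane R) : plane_inv p1 p2 0 = 0.
Proof. by rewrite /plane_inv /= !mulr0 subrr scaler0. Qed.

Lemma jac_neq0_injective (f : plane R -> plane R) p v : differentiable f p ->
  jac f p != 0 -> 'D_v f p = 0 -> v = 0.
Proof.
move=> df J0 D0; have := derive_lin_plane v df; rewrite D0 => E.
by have := plane_invK v J0; rewrite -E => <-; exact: plane_inv0.
Qed.

Lemma plane_dependent (u w : plane R) : u.1 * w.2 - u.2 * w.1 = 0 ->
  exists2 v : plane R, v != 0 & v.1 *: u + v.2 *: w = 0.
Proof.
move=> J0.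
have pairE (x : plane R) : x.1 = 0 -> x.2 = 0 -> x = 0.
  by move=> h1 h2; rewrite [x]surjective_pairing h1 h2.
have [w10|w10] := eqVneq w.1 0; last first.
  exists ((- w.1, u.1) : plane R).
    by apply: contra w10 => /eqP[h1 _]; rewrite -oppr_eq0 h1.
  by apply: pairE; rewrite /= /GRing.scale/=; lra.
have [w20|w20] := eqVneq w.2 0.
  exists e2; first by apply/eqP => -[] /eqP; rewrite oner_eq0.
  by apply: pairE; rewrite /= /GRing.scale/= ?w10 ?w20; ring.
exists ((- w.2, u.2) : plane R).
  by apply: contra w20 => /eqP[h1 _]; rewrite -oppr_eq0 h1.
apply: pairE; rewrite /= /GRing.scale/= ?w10; last by ring.
by move: J0; rewrite w10 => J0; lra.
Qed.

(** The coordinates (r, s) are not isothermal, but positivity survives: the quadratic form of a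
    pushed vector is its Euclidean square length in the disk times the conformal factor. *)
Lemma conformal_comp_spacelike (X : plane R -> L3 R) (W : plane R -> plane R) p v :
  differentiable W p -> differentiable X (W p) ->
  lorentz ('D_e1 X (W p)) ('D_e1 X (W p)) = lorentz ('D_e2 X (W p)) ('D_e2 X (W p)) ->
  0 < lorentz ('D_e1 X (W p)) ('D_e1 X (W p)) ->
  lorentz ('D_e1 X (W p)) ('D_e2 X (W p)) = 0 ->
  'D_v W p != 0 ->
  0 < lorentz ('D_v (X \o W) p) ('D_v (X \o W) p).
Proof.
move=> dW dX; rewrite (derive_comp_plane v dW dX).
move: ('D_e1 X (W p)) ('D_e2 X (W p)) ('D_v W p) => A B w E E0 EAB w0.
have -> : lorentz (w.1 *: A + w.2 *: B) (w.1 *: A + w.2 *: B)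
  = (w.1 ^+ 2 + w.2 ^+ 2) * lorentz A A.
  transitivity (w.1 ^+ 2 * lorentz A A + w.2 ^+ 2 * lorentz B B
    + 2 * w.1 * w.2 * lorentz A B).
    by rewrite /lorentz /= /GRing.scale/=; ring.
  by rewrite -E EAB; ring.
by rewrite mulr_gt0// sqr_sum_gt0.
Qed.

Variables (Omega : set (plane R)) (psi : plane R -> R).
Variables (X : plane R -> L3 R) (t0 : R).
Hypothesis isothermalX : isothermal_parametrization (graph Omega psi) X.
Hypothesis XE : forall p, half_plane p -> X (to_disk t0 p) = F p.
Hypothesis ab_lightlike : lightlike (b - a).

Let spacelike_half_plane p v : half_plane p -> v != 0 ->
  0 < lorentz ('D_v F p) ('D_v F p).
Proof.
move=> Hp v0; have [SX _ iso] := isothermalX.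
have Wp := to_disk_disk t0 Hp; have [dX _] := SX 1%N.
have [E E0 EAB] := iso _ Wp.
have <- : 'D_v (X \o to_disk t0) p = 'D_v F p.
  apply: near_eq_derive.
  have : \forall q \near p, half_plane q by exact: open_nbhs_nbhs (conj (@open_half_plane R) Hp).
  by apply: filterS => q Hq; exact: XE.
exact: (conformal_comp_spacelike (differentiable_to_disk t0 Hp) (dX _ Wp) E E0 EAB
  (derive_to_disk_neq0 t0 Hp v0)).
Qed.

Lemma blowup_spacelike p v : p.1 != 0 -> v != 0 -> 0 < lorentz ('D_v F p) ('D_v F p).
Proof.
rewrite neq_lt => /orP[p0|p0] v0; last exact: spacelike_half_plane.
by rewrite -derive_blowupN; apply: spacelike_half_plane => //; rewrite /half_plane /= oppr_gt0.
Qed.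

Lemma differentiable_blowup_plane p : differentiable (fun q => (F q).1) p.
Proof. exact/differentiable_fst/differentiable_blowup. Qed.

Lemma derive_blowup_plane p v : 'D_v (fun q => (F q).1) p = ('D_v F p).1.
Proof. by rewrite (derive_pair v (differentiable_blowup p)). Qed.

(** A vector killed by the projected differential would have a vertical image, on which the Lorentz
    form is at most 0. *)
Let jac_off_axis p : p.1 != 0 -> jac (fun q => (F q).1) p != 0.
Proof.
move=> p0; apply/eqP => J0.
have dp := differentiable_blowup_plane p.
have [v v0 vE] := plane_dependent J0.
have D0 : ('D_v F p).1 = 0 by rewrite -derive_blowup_plane derive_lin_plane.
have := blowup_spacelike p0 v0; rewrite /lorentz D0 /= !mul0r addr0 sub0r oppr_gt0.
by rewrite -expr2 ltNge sqr_ge0.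
Qed.

Lemma lightlike_plane_neq0 : (a - b).1 != 0.
Proof.
have [n0 l0] := ab_lightlike; apply/eqP => h.
have h1 : (b - a).1 = 0 by rewrite -[b - a]opprB /= -[RHS]oppr0 -h.
move: l0; rewrite /lorentz h1 /= !mul0r addr0 sub0r => /eqP.
rewrite oppr_eq0 -expr2 sqrf_eq0 => /eqP h2; have {}h2 : (b - a).2 = 0 := h2.
by move/eqP: n0; apply; rewrite [LHS]surjective_pairing h1 h2.
Qed.

Let C_on_blowup_comp n :
  C_on n setT (fun p => (F p).1.1) /\ C_on n setT (fun p => (F p).1.2).
Proof.
have oT : open [set: plane R] := openT.
have S := C_on_fst oT (smooth_blowup n).
by split; [exact: (C_on_fst oT S)|exact: (C_on_snd oT S)].
Qed.

(** On the axis, coordinates adapted to the projection [q] of a - b separate the two derivatives: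
    the s-derivative of [F] projects along [q], so only the component of the r-derivative across [q]
    matters. *)
Lemma blowup_jac_neq0 p : jac (fun q => (F q).1) p != 0.
Proof.
have [p0|p0] := eqVneq p.1 0; last exact: jac_off_axis.
rewrite [p]surjective_pairing p0; move: p.2 => s {p p0}.
pose q := (a - b).1; have q0 : 0 < q.1 ^+ 2 + q.2 ^+ 2.
  by apply: sqr_sum_gt0; exact: lightlike_plane_neq0.
have oT : open [set: plane R] := openT.
(* Components along [q] and along [q] turned by a right angle. This similarity multiplies the
   Jacobian by the square length of [q], which is nonzero because a - b is lightlike. *)
pose A p := q.1 * (F p).1.1 + q.2 * (F p).1.2.
pose Y p := q.1 * (F p).1.2 + - q.2 * (F p).1.1.
have SA : smooth_on setT A.
  move=> n; have [c1 c2] := C_on_blowup_comp n.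
  exact: (C_onD oT (C_onMl q.1 oT c1) (C_onMl q.2 oT c2)).
have D1 p : differentiable (fun q => (F q).1.1) p.
  exact/differentiable_fst/differentiable_blowup_plane.
have D2 p : differentiable (fun q => (F q).1.2) p.
  exact/differentiable_snd/differentiable_blowup_plane.
have dA p v : 'D_v A p = q.1 * ('D_v F p).1.1 + q.2 * ('D_v F p).1.2.
  rewrite -(derive_component11 v (differentiable_blowup p)).
  rewrite -(derive_component12 v (differentiable_blowup p)).
  exact: derive_lincomb (D1 p) (D2 p).
have dY p v : 'D_v Y p = q.1 * ('D_v F p).1.2 + - q.2 * ('D_v F p).1.1.
  rewrite -(derive_component11 v (differentiable_blowup p)).
  rewrite -(derive_component12 v (differentiable_blowup p)).
  exact: derive_lincomb (D2 p) (D1 p).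
have AYE p : 'D_e1 A p * 'D_e2 Y p - 'D_e2 A p * 'D_e1 Y p
    = (q.1 ^+ 2 + q.2 ^+ 2) * jac (fun q => (F q).1) p.
  rewrite !dA !dY /jac !derive_blowup_plane.
  by move: ('D_e1 F p) ('D_e2 F p) => u w; ring.
have s0 (x : R) : 0 < pi * (1 + x ^+ 2).
  by rewrite mulr_gt0 ?pi_gt0// ltr_pwDl// sqr_ge0.
have A2 x : 0 < 'D_e2 A (0, x).
  rewrite dA derive_blowup_axis /= /GRing.scale/= !mul0r !add0r !mul1r.
  have -> : q.1 * ((pi * (1 + x ^+ 2))^-1 * (a.1.1 - b.1.1))
      + q.2 * ((pi * (1 + x ^+ 2))^-1 * (a.1.2 - b.1.2))
    = (pi * (1 + x ^+ 2))^-1 * (q.1 ^+ 2 + q.2 ^+ 2).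
    by move: ((pi * (1 + x ^+ 2))^-1) => z; rewrite /q /=; ring.
  by rewrite mulr_gt0// invr_gt0.
pose g (t : R) := q.1 * f2 t - q.2 * f1 t.
have bg1 := bmeasM (bmeas_cst circle q.1) bf2.
have bg2 := bmeasM (bmeas_cst circle q.2) bf1.
have bg : bounded_measurable circle g := bmeasB bg1 bg2.
(* The component of the midpoint of a and b across [q]. The arctangent terms cancel in [Y] since
   they are multiples of a - b. *)
pose c := q.1 * (b.1.2 + (a.1.2 - b.1.2) / 2) - q.2 * (b.1.1 + (a.1.1 - b.1.1) / 2).
have YE : Y = (fun p => c + p.1 * kernel_int mu circle sg 1 g p).
  apply/funext => p; have k1 := bmeas_kernel bsg 1 p bf1; have k2 := bmeas_kernel bsg 1 p bf2.
  have -> : kernel_int mu circle sg 1 g p = q.1 * kernel_int mu circle sg 1 f2 p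
     - q.2 * kernel_int mu circle sg 1 f1 p.
    rewrite /kernel_int -!(@RintegralZ_bmeas _ _ _ mu circle mcircle fcircle)//.
    rewrite -(@RintegralB_bmeas _ _ _ mu circle mcircle fcircle); first last.
    - exact: bmeasM (bmeas_cst circle _) k1.
    - exact: bmeasM (bmeas_cst circle _) k2.
    by apply: eq_Rintegral => t _; rewrite /g expr1; ring.
  rewrite /Y /c /blowup /blowup1 /=.
  move: (kernel_int _ _ _ _ _ _) (kernel_int _ _ _ _ _ _) => K1 K2.
  by rewrite /q /=; move: (atan _ / pi) => x; ring.
have J0 p : 0 < p.1 ->
    'D_e1 A p * 'D_e2 (fun p => c + p.1 * kernel_int mu circle sg 1 g p) p
    - 'D_e2 A p * 'D_e1 (fun p => c + p.1 * kernel_int mu circle sg 1 g p) p != 0.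
  move=> p0; rewrite -YE AYE; apply: mulf_neq0; first by rewrite gt_eqF.
  by apply: jac_off_axis; rewrite gt_eqF.
have g0 := @kernel_nondegenerate _ _ _ mu circle mcircle fcircle sg bsg g bg A c SA A2 J0.
have gE : \int[mu]_(t in circle) g t
    = q.1 * \int[mu]_(t in circle) f2 t - q.2 * \int[mu]_(t in circle) f1 t.
  rewrite -!(@RintegralZ_bmeas _ _ _ mu circle mcircle fcircle)//.
  by rewrite -(@RintegralB_bmeas _ _ _ mu circle mcircle fcircle).
apply: contraNneq g0 => Jp.
have E1 : 'D_e1 Y (0, s) = \int[mu]_(t in circle) g t.
  rewrite dY derive_blowup_axis gE /= /GRing.scale/= !mul0r !mul1r.
  by move: (\int[mu]_(t in circle) f1 t) (\int[mu]_(t in circle) f2 t) => x1 x2; ring.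
have E2 : 'D_e2 Y (0, s) = 0.
  rewrite dY derive_blowup_axis /= /GRing.scale/= !mul0r !mul1r !add0r.
  by move: ((pi * (1 + s ^+ 2))^-1) => z; rewrite /q /=; ring.
have aux (x1 x2 y1 y2 z j k : R) : x1 * y2 - x2 * y1 = z * j -> j = 0 ->
    y2 = 0 -> y1 = k -> 0 < x2 -> k = 0.
  move=> + j0 y0 <- x0; rewrite j0 y0 !mulr0 sub0r => /eqP.
  by rewrite oppr_eq0 mulf_eq0 gt_eqF// => /eqP.
apply/eqP; exact: (aux _ _ _ _ _ _ _ (AYE (0, s)) Jp E2 E1 (A2 s)).
Qed.

Lemma blowup_immersion p v : 'D_v F p = 0 -> v = 0.
Proof.
move=> D0; have dp := differentiable_blowup_plane p.
have Dp : 'D_v (fun q => (F q).1) p = 0 by rewrite derive_blowup_plane D0.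
exact: jac_neq0_injective dp (blowup_jac_neq0 p) Dp.
Qed.

End BlowUpGeometry.

(** * The extended surface *)

Section PlaneSurface.
Variable R : realType.

Lemma plane_second_countable : @second_countable (plane R).
Proof.
pose O (i : rat * rat * nat) : set (plane R) :=
  [set p | `|p - (ratr i.1.1, ratr i.1.2)| < i.2.+1%:R^-1].
exists (O @` setT); first exact: card_le_trans (card_image_le _ _) (countableP _).
split=> [_ [i _ <-]|x A xA]; first exact: open_norm_ball.
have /nbhs_normP[e e0 he] := xA.
have [n ne] : exists n : nat, 2 / e < n.+1%:R.
  by exists (Num.truncn (2 / e)); exact: truncnS_gt.
have n0 : 0 < n.+1%:R :> R by rewrite ltr0n.
have dense (y : R) : exists q : rat, `|y - ratr q| < n.+1%:R^-1.
  have [||z [/= h [q _ qE]]] := @dense_rat R (ball y n.+1%:R^-1).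
  - by exists y; apply: ballxx; rewrite invr_gt0.
  - exact: ball_open.
  - by exists q; rewrite qE.
have [q1 h1] := dense x.1; have [q2 h2] := dense x.2.
exists (O (q1, q2, n)).
  split; first by exists (q1, q2, n).
  by rewrite /O /= prod_normE gt_max /= h1 h2.
move=> y Oy; apply: he; rewrite /= .
have Ox : `|x - (ratr q1, ratr q2)| < n.+1%:R^-1 by rewrite prod_normE gt_max /= h1 h2.
have Oy' : `|(ratr q1, ratr q2) - y| < n.+1%:R^-1 by rewrite distrC; exact: Oy.
apply: le_lt_trans (ler_distD (ratr q1, ratr q2) _ _) _.
apply: lt_trans (ltrD Ox Oy') _.
have e0' : 0 < e := e0.
have -> : n.+1%:R^-1 + n.+1%:R^-1 = 2 / n.+1%:R :> R by ring.
by rewrite ltr_pdivrMr// mulrC -ltr_pdivrMr.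
Qed.

Lemma plane_hausdorff : hausdorff_space (plane R).
Proof. exact: norm_hausdorff. Qed.

Lemma plane_connected : connected [set: plane R].
Proof.
have -> : [set: plane R] = \bigcup_(p in [set: plane R]) ((fun t : R => t *: p) @` setT).
  by apply/seteqP; split=> // p _; exists p => //; exists 1 => //; rewrite scale1r.
apply: bigcup_connected => [|p _].
  by exists 0 => p _; exists 0 => //; rewrite scale0r.
apply: connected_continuous_connected.
  by apply/connected_intervalP.
by apply: continuous_subspaceT => t; exact: scalel_continuous.
Qed.

Lemma smooth_id_plane (V : normedModType R) (U : set V) : smooth_on U (id : V -> V).
Proof. by move=> n; apply: C_on_linear => // x; exact: cvg_id. Qed.

(** A single chart, the identity. The definition is left transparent so that conditions on charts
    reduce to statements about the plane. *)
Definition plane_surface : surface R.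
Proof.
apply: (@Surface R (plane R) unit (fun=> setT) (fun=> id) (fun=> id)).
- exact: plane_hausdorff.
- exact: plane_second_countable.
- by move=> m; exists tt.
- by move=> _; exact: openT.
- by move=> _; rewrite image_id; exact: openT.
- move=> _; rewrite image_id; split.
  + by split=> // x _; exists x.
  + by [].
  + by apply: continuous_subspaceT => x; exact: cvg_id.
  + by apply: continuous_subspaceT => x; exact: cvg_id.
- by move=> _ _; exact: smooth_id_plane.
Defined.

End PlaneSurface.

(** * The mean curvature equation: locality, reflection, continuity *)

Section ZeroMeanCurvature.
Variable R : realType.
Implicit Types (phi psi : plane R -> R) (p q : plane R) (U : set (plane R)).

Local Notation e1 := ((1, 0) : plane R).
Local Notation e2 := ((0, 1) : plane R).

Lemma derive_congr_open U phi psi v : open U -> {in U, phi =1 psi} ->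
  {in U, 'D_v phi =1 'D_v psi}.
Proof.
move=> oU e p; rewrite inE => Up; apply: near_eq_derive.
have : \forall q \near p, U q by exact: open_nbhs_nbhs.
by apply: filterS => q Uq; apply: e; rewrite inE.
Qed.

Lemma zmc_eq_congr U phi psi p : open U -> {in U, phi =1 psi} -> U p ->
  zmc_eq psi p -> zmc_eq phi p.
Proof.
move=> oU e Up; have d1 v := derive_congr_open v oU e.
have d2 v w := derive_congr_open w oU (d1 v).
have pU : p \in U by rewrite inE.
have E1 := d1 e1 p pU; have E2 := d1 e2 p pU.
have E11 := d2 e1 e1 p pU; have E12 := d2 e1 e2 p pU; have E22 := d2 e2 e2 p pU.
have aux (u w x y z u' w' x' y' z' : R) : u' = u -> w' = w -> x' = x ->
    y' = y -> z' = z ->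
    (1 - w ^+ 2) * x + 2 * u * w * y + (1 - u ^+ 2) * z = 0 ->
    (1 - w' ^+ 2) * x' + 2 * u' * w' * y' + (1 - u' ^+ 2) * z' = 0.
  by move=> -> -> -> -> ->.
exact: (aux _ _ _ _ _ _ _ _ _ _ E1 E2 E11 E12 E22).
Qed.

Lemma derive_reflect phi (c : plane R) v p : differentiable phi (c - p) ->
  'D_v (fun q => phi (c - q)) p = - 'D_v phi (c - p).
Proof.
move=> dphi.
have dN : is_diff p (fun q : plane R => c - q) (fun q => - q).
  have lN : linear (fun q : plane R => - q) by move=> k u w; rewrite opprD scalerN.
  have cN : continuous (fun q : plane R => - q) by move=> q; exact: opp_continuous.
  have h := is_diff_linear p lN cN.
  have := is_diffD (is_diff_cst c p) h.
  by rewrite add0r.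
have [dNd dNE] := dN.
have dc : differentiable (phi \o (fun q : plane R => c - q)) p.
  exact: differentiable_comp.
rewrite -[LHS]/('D_v (phi \o (fun q : plane R => c - q)) p) (deriveE _ dc).
by rewrite (diff_comp dNd dphi) dNE /= linearN deriveE.
Qed.

Lemma open_reflect U (c : plane R) : open U -> open [set q | U (c - q)].
Proof.
move=> oU; apply: (@open_comp _ _ (fun q => c - q) U) => // q _.
by apply: continuousB; [exact: cst_continuous|exact: cvg_id].
Qed.

(** A point reflection of the graph keeps first derivatives and negates second ones, and the
    equation is linear in the second derivatives. *)
Lemma zmc_eq_reflect U psi (c : plane R) (k : R) p : open U -> smooth_on U psi ->
  U (c - p) -> zmc_eq psi (c - p) -> zmc_eq (fun q => k - psi (c - q)) p.
Proof.
move=> oU S Up.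
have oV := @open_reflect U c oU.
pose V : set (plane R) := [set q | U (c - q)].
have [dpsi _] := S 1%N.
have D1 v q : U (c - q) -> 'D_v (fun q => k - psi (c - q)) q = 'D_v psi (c - q).
  move=> Uq.
  have dr : differentiable (fun q => psi (c - q)) q.
    apply: (@differentiable_comp _ _ _ _ (fun q => c - q) psi); last exact: dpsi.
    by apply: differentiableB.
  rewrite deriveB; [|exact: derivable_cst|exact: diff_derivable].
  by rewrite derive_cst sub0r derive_reflect ?opprK//; exact: dpsi.
have D2 v w q : U (c - q) ->
    'D_w ('D_v (fun q => k - psi (c - q))) q = - 'D_w ('D_v psi) (c - q).
  move=> Uq; have [_ /(_ v) [dv _]] := S 2%N.
  rewrite -derive_reflect; last exact: dv.
  apply: (derive_congr_open w oV); last by rewrite inE.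
  by move=> z; rewrite inE => Uz; exact: D1.
have E11 := D2 e1 e1 p Up; have E12 := D2 e1 e2 p Up; have E22 := D2 e2 e2 p Up.
have E1 := D1 e1 p Up; have E2 := D1 e2 p Up.
have aux (u w x y z u' w' x' y' z' : R) : u' = u -> w' = w -> x' = - x ->
    y' = - y -> z' = - z ->
    (1 - w ^+ 2) * x + 2 * u * w * y + (1 - u ^+ 2) * z = 0 ->
    (1 - w' ^+ 2) * x' + 2 * u' * w' * y' + (1 - u' ^+ 2) * z' = 0.
  by move=> -> -> -> -> -> h; rewrite -[RHS]oppr0 -h; ring.
exact: (aux _ _ _ _ _ _ _ _ _ _ E1 E2 E11 E12 E22).
Qed.

(** [E] is the left-hand side of the equation as a function; its continuity carries the equation to
    limit points. *)
Lemma continuous_zmc U phi : open U -> smooth_on U phi ->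
  exists E : plane R -> R, (forall p, U p -> {for p, continuous E}) /\
    (forall p, zmc_eq phi p <-> E p = 0).
Proof.
move=> oU S; have [_ S1] := S 1%N; have [_ S2] := S 2%N.
have c1 v p : U p -> {for p, continuous ('D_v phi)} by exact: S1.
have c2 v w p : U p -> {for p, continuous ('D_w ('D_v phi))}.
  by move=> Up; have [_ /(_ w)] := S2 v; apply.
have cc (k : R) p : {for p, continuous (fun _ : plane R => k)} by exact: cst_continuous.
eexists; split; last by move=> p; rewrite /zmc_eq /dx /dy; exact: iff_refl.
move=> p Up; have a1 := c1 e1 p Up; have a2 := c1 e2 p Up.
have b11 := c2 e1 e1 p Up; have b12 := c2 e1 e2 p Up; have b22 := c2 e2 e2 p Up.
exact: (continuousD (continuousD
  (continuousM (continuousB (cc 1 p) (continuousM a2 a2)) b11)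
  (continuousM (continuousM (continuousM (cc 2 p) a1) a2) b12))
  (continuousM (continuousB (cc 1 p) (continuousM a1 a1)) b22)).
Qed.

End ZeroMeanCurvature.

(** * The conditions on an extension across the segment *)

Section Extension.
Variables (R : realType) (Omega : set (plane R)) (psi : plane R -> R).
Variables (a b : L3 R) (F : plane R -> L3 R).
Hypotheses (oOmega : open Omega) (Spsi : smooth_on Omega psi).
Hypothesis zmc_psi : forall p, Omega p -> zmc_eq psi p.
Hypothesis ab_lightlike : lightlike (b - a).
Hypothesis SF : smooth_on setT F.
Hypothesis FN : forall p, F (- p) = a + b - F p.
Hypothesis F_axis : forall s, F (0, s) = b + (2^-1 + atan s / pi) *: (a - b).
Hypothesis JF : forall p, jac (fun q => (F q).1) p != 0.
Hypothesis bijF : set_bij (@half_plane R) (graph Omega psi) F.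
Hypothesis immF : forall p v, 'D_v F p = 0 -> v = 0.
Implicit Types (p q : plane R) (s t : R).

Local Notation f := (fun q : plane R => (F q).1).
Local Notation M := (plane_surface R).

Definition axis : set M := [set p : plane R | p.1 = 0].

Let oT : open [set: plane R] := openT.

Let Sf : smooth_on setT f.
Proof. by move=> n; exact: (C_on_fst oT (SF n)). Qed.

Let F_graph p : half_plane p -> Omega (f p) /\ (F p).2 = psi (f p).
Proof.
move=> Hp; have [sub _ _] := bijF; have [q Oq <-] := sub _ Hp.
by [].
Qed.

Let f_inj p q : half_plane p -> half_plane q -> f p = f q -> p = q.
Proof.
move=> Hp Hq fpq; have [_ inj _] := bijF.
apply: inj; rewrite ?inE//.
have [_ p2] := F_graph Hp; have [_ q2] := F_graph Hq.
by rewrite [F p]surjective_pairing [F q]surjective_pairing p2 q2 fpq.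
Qed.

Let continuous_F : continuous F.
Proof. by move=> p; exact: (SF 0%N). Qed.

Lemma zmc_eq_near_reflection p : p.1 < 0 ->
  [/\ Omega ((a + b).1 - f p), (F p).2 = (a + b).2 - psi ((a + b).1 - f p)
    & zmc_eq (fun q => (a + b).2 - psi ((a + b).1 - q)) (f p)].
Proof.
move=> p0; have Hp : half_plane (- p) by rewrite /half_plane /= oppr_gt0.
have [Op E2] := F_graph Hp.
have E : F p = a + b - F (- p) by rewrite -FN opprK.
have E1 : (a + b).1 - f p = f (- p) by rewrite /= E /= subKr.
split; first by rewrite E1.
  by rewrite E1 -E2 {1}E.
by apply: (zmc_eq_reflect _ oOmega Spsi); rewrite E1//; exact: zmc_psi.
Qed.

(** The height composed with a local inverse of the projection is the graph function. Off the axis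
    it is locally [psi] or its reflection; on the axis the equation is a limit from r > 0. *)
Lemma locally_zmc_graph_of_blowup : locally_zmc_graph (F : M -> L3 R).
Proof.
move=> m; have [N [g [[oN Nm _ oV] [gf Sg]]]] :=
  @inverse_function _ f setT m oT Sf (fun p _ => JF p) I.
pose phi := (fun q => (F q).2) \o g.
pose V := f @` N.
have Sphi : smooth_on V phi.
  move=> n; apply: (@C_on_comp _ _ n V setT) => //.
  exact: (C_on_snd oT (SF n)).
have cg q : V q -> {for q, continuous g} by exact: (Sg 0%N).
have phif p : N p -> phi (f p) = (F p).2 by move=> Np; rewrite /phi /= gf.
(* If [F] lies on the graph of another function [phi'] over a piece of [N], then [phi] equals [phi']
   near [f p], and the equation is local. *)
have zmc_open (P : set (plane R)) (phi' : plane R -> R) p : open P -> N p -> P p ->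
    (forall q, N q -> P q -> (F q).2 = phi' (f q)) ->
    zmc_eq phi' (f p) -> zmc_eq phi (f p).
  move=> oP Np Pp e; apply: (@zmc_eq_congr _ (V `&` g @^-1` P)).
  - rewrite openE => q [Vq Pq]; apply: filterI; first exact: open_nbhs_nbhs.
    by apply: cg => //; exact: open_nbhs_nbhs.
  - move=> q; rewrite inE => -[[q' Nq' <-]]; rewrite /= gf// => Pq'.
    by rewrite phif// e.
  - by split; [exists p|rewrite /= gf].
have zmc_pos p : N p -> 0 < p.1 -> zmc_eq phi (f p).
  move=> Np p0; apply: (zmc_open (@half_plane R) psi p) => //.
  - exact: open_half_plane.
  - by move=> q _ /F_graph[].
  - by apply: zmc_psi; have [] := F_graph p0.
have zmc_neg p : N p -> p.1 < 0 -> zmc_eq phi (f p).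
  move=> Np p0; have [_ _ z] := zmc_eq_near_reflection p0.
  apply: (zmc_open [set q : plane R | q.1 < 0] _ p) z => //.
  - apply: (@open_comp _ _ (fst : plane R -> R) [set x | x < 0]); last exact: open_lt.
    by move=> q _; exact: cvg_fst.
  - by move=> q _ q0; have [_ ->] := zmc_eq_near_reflection q0.
have [E [cE zE]] := continuous_zmc oV Sphi.
have zmc_axis p : N p -> p.1 = 0 -> zmc_eq phi (f p).
  (* A nonzero value of [E] would persist at a nearby point with the same s and with r > 0. *)
  move=> Np p0; apply/zE; apply/eqP; apply: contraT => Ep.
  have cEf : {for p, continuous (E \o f)}.
    apply: continuous_comp; last by apply: cE; exists p.
    by apply: differentiable_continuous; have [df _] := Sf 1%N; exact: df.
  have n1 : \forall q \near p, (E \o f) q != 0.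
    exact: (cvgr_neq0 _ cEf Ep).
  have n2 : \forall q \near p, N q by exact: open_nbhs_nbhs.
  have /nbhs_normP[e e0 he] : \forall q \near p, (E \o f) q != 0 /\ N q.
    by apply: filterS2 n1 n2 => q h1 h2; split.
  have e0' : 0 < e := e0.
  have [/= Eq Nq] : (E \o f) (e / 2, p.2) != 0 /\ N (e / 2, p.2).
    apply: he; rewrite /= prod_normE /= p0 subrr normr0 sub0r normrN.
    rewrite max_l// ger0_norm ?divr_ge0 ?(ltW e0')// ltr_pdivrMr//.
    by rewrite ltr_pMr// ltr1n.
  have /zE Ez := zmc_pos _ Nq (divr_gt0 e0' (ltr0n _ 2)).
  by move: Eq; rewrite Ez eqxx.
have bij : set_bij N (graph V phi) F.
  split.
  - move=> p Np; exists (f p); first by exists p.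
    by rewrite phif// -surjective_pairing.
  - by move=> p q; rewrite !inE => Np Nq Fpq; rewrite -(gf p Np) -(gf q Nq) /= Fpq.
  - move=> _ [_ [p Np <-] <-]; exists p => //.
    by rewrite phif// -surjective_pairing.
exists N, V, phi; split; [by []|exact: oV|exact: Sphi| |exact: bij].
move=> _ [p Np <-]; case: (ltgtP p.1 0) => p0.
- exact: zmc_neg.
- exact: zmc_pos.
- exact: zmc_axis.
Qed.

(** Since [F] maps the half plane bijectively onto a graph, its projection is injective there. The
    global inverse [G] therefore agrees with each local inverse from the inverse function theorem
    and inherits its smoothness. *)
Lemma diffeo_onto_graph_blowup :
  diffeo_onto_graph (@half_plane R : set M) Omega psi (F : M -> L3 R).
Proof.
split; first exact: bijF.
have [_ _ surF] := bijF.
pose G q : plane R := get [set p : plane R | half_plane p /\ f p = q].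
have GP q : Omega q -> half_plane (G q) /\ f (G q) = q.
  move=> Oq; have [p Hp Fp] := surF (q, psi q) (ex_intro2 _ _ q Oq erefl).
  by apply: (@getPex _ [set p : plane R | half_plane p /\ f p = q]); exists p; rewrite /= Fp.
have SG : smooth_on Omega G.
  move=> n; apply: C_on_local => q Oq; have [HG fG] := GP q Oq.
  have [N [g [[oN NG NH oV] [gf Sg]]]] := @inverse_function _ f (@half_plane R) (G q)
    (@open_half_plane R) (fun k => C_onS (@subsetT _ _) (Sf k)) (fun p _ => JF p) HG.
  exists (f @` N); first by exists (G q).
  apply: (C_on_congr oV) (Sg n) => r; rewrite inE => -[p Np <-].
  have Hp := NH _ Np; have [Ofp _] := F_graph Hp.
  have [HGp fGp] := GP _ Ofp.
  by rewrite gf//; exact: f_inj.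
exists G.
  split; first exact: (SG 0%N).
  by move=> i n; apply: C_onS (SG n) => q [].
move=> q Oq; have [HG fG] := GP q Oq; split=> //.
by have [_ E2] := F_graph HG; rewrite [F _]surjective_pairing E2 fG.
Qed.

(** Solves t = 1/2 + atan s / pi for s. In this parameter [F] runs affinely along the segment, from
    [b] to [a]. *)
Let axis_param (t : R) : plane R := (0, tan (pi * t - pi / 2)).

Let cos_axis t : 0 < t < 1 -> 0 < cos (pi * t - pi / 2).
Proof.
have pi0 := pi_gt0 R => /andP[t0 t1].
have h1 : 0 < pi * t by rewrite mulr_gt0.
have h2 : pi * t < pi by rewrite gtr_pMr.
by apply: cos_gt0_pihalf; apply/andP; split; lra.
Qed.

Let atan_axis t : 0 < t < 1 -> 2^-1 + atan (axis_param t).2 / pi = t.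
Proof.
have pi0 := pi_gt0 R => /andP[t0 t1].
have h1 : 0 < pi * t by rewrite mulr_gt0.
have h2 : pi * t < pi by rewrite gtr_pMr.
rewrite /axis_param /= tanK; last by rewrite in_itv/=; apply/andP; split; lra.
by move: (@pi R) pi0 => P P0; field; rewrite gt_eqF.
Qed.

Let axis_paramK (s : R) : axis_param (2^-1 + atan s / pi) = (0, s).
Proof.
have pi0 : pi != 0 :> R by rewrite gt_eqF// pi_gt0.
rewrite /axis_param; congr pair.
have -> : pi * (2^-1 + atan s / pi) - pi / 2 = atan s.
  by move: (atan s) => x; move: (@pi R) pi0 => P P0; field.
exact: atanK.
Qed.

Let atan_itv (s : R) : 0 < 2^-1 + atan s / pi < 1.
Proof.
have pi0 := pi_gt0 R; have := atan_gtNpi2 s; have := atan_ltpi2 s => h1 h2.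
have h3 : atan s / pi < 2^-1 by rewrite ltr_pdivrMr// mulrC.
have h4 : - 2^-1 < atan s / pi by rewrite ltr_pdivlMr// mulNr mulrC.
by apply/andP; split; lra.
Qed.

(** The derivative 1 + tan^2 is a polynomial in the tangent, which closes the induction. *)
Let C_on_tan n (U : set R) (h : R -> R) : open U ->
  (forall t, U t -> cos (h t) != 0) -> C_on n U h -> C_on n U (fun t => tan (h t)).
Proof.
move=> oU h0; elim: n => [|n IH] Ch.
  move=> t Ut; apply: (@continuous_comp _ _ _ h (@tan R)); first exact: Ch.
  exact/continuous_tan/h0.
have [dh Dh] := Ch.
have dtan t : U t -> differentiable (@tan R) (h t).
  by move=> Ut; apply/derivable1_diffP/derivable_tan/h0.
split=> [t Ut|v].
  by apply: (@differentiable_comp _ _ _ _ h (@tan R)); [exact: dh|exact: dtan].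
have C2 := C_onD oU (C_on_cst n U (1 : R)) (C_onX 2 oU (IH (C_onW Ch))).
apply: (C_on_congr oU) (C_onM oU C2 (Dh v)) => t; rewrite inE => Ut.
have dht := dh t Ut; have dt := dtan t Ut.
have dc : differentiable (@tan R \o h) t by exact: differentiable_comp.
have Dtan : 'd (@tan R) (h t) ('d h t v) = 'd h t v * (1 + tan (h t) ^+ 2).
  have dtan1 := derivable_tan (h0 t Ut).
  apply: etrans (congr1 (fun L => L ('d h t v)) (deriv1E dtan1)) _.
  have [_ E] := is_derive_tan (h0 t Ut).
  by rewrite /GRing.scale/= derive1E E -(cos2_tan2 (h0 t Ut)).
have E : 'D_v (@tan R \o h) t = 'd h t v * (1 + tan (h t) ^+ 2).
  exact: etrans (etrans (deriveE v dc) (congr1 (fun L => L v) (diff_comp dht dt))) Dtan.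
by rewrite [RHS]E (deriveE v dht) mulrC.
Qed.

Let U : set R := `]0, 1[%classic.

Let oU : open U. Proof. exact: interval_open. Qed.

Let cos_axis_neq0 t : U t -> cos (pi * t - pi / 2) != 0.
Proof. by rewrite /U /= in_itv/= => /cos_axis/gt_eqF ->. Qed.

Let C_on_angle n : C_on n U (fun t : R => pi * t - pi / 2).
Proof.
apply: C_onB => //; last exact: C_on_cst.
by apply: C_onMl => //; exact: smooth_id_plane.
Qed.

Let C_on_axis_param n : C_on n U axis_param.
Proof.
exact: (C_on_pair oU (C_on_cst n U (0 : R)) (C_on_tan oU cos_axis_neq0 (C_on_angle n))).
Qed.

Lemma embedded_axis : embedded_curve axis.
Proof.
have pi0 := pi_gt0 R.
have Uc := cos_axis_neq0; have Cl := C_on_angle; have Cs := C_on_axis_param.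
have Ct n := C_on_tan oU Uc (Cl n).
have cg : continuous (fun m : plane R => 2^-1 + atan m.2 / pi).
  move=> m; have ca : {for m, continuous (fun m : plane R => atan m.2)}.
    apply: (@continuous_comp _ _ _ (snd : plane R -> R) (@atan R)).
      exact: cvg_snd.
    exact: continuous_atan.
  have cc (x : R) : {for m, continuous (fun _ : plane R => x)} by exact: cst_continuous.
  exact: (continuousD (cc 2^-1) (continuousM ca (cc pi^-1))).
exists axis_param; split.
- split; first exact: (Cs 0%N).
  by move=> i n; apply: C_onS (Cs n) => t [].
- move=> i t t01 _; have Ut : U t by [].
  have [dt _] := Ct 1%N.
  have [dl _] := Cl 1%N; have [ds _] := Cs 1%N.
  have D1 : 'D_1 (fun t : R => pi * t - pi / 2) t = pi.
    rewrite deriveB; [|exact/diff_derivable/differentiableM|exact: derivable_cst].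
    by rewrite derive_cst subr0 deriveMl// derive_id /GRing.scale/= mulr1.
  have D2 : 'D_1 (fun t : R => tan (pi * t - pi / 2)) t != 0.
    have it := is_derive_tan (Uc t Ut).
    have il : is_derive t 1 (fun t : R => pi * t - pi / 2) pi.
      by split=> //; apply/derivable1_diffP/dl.
    have [_ E] := @is_derive1_comp _ (@tan R) (fun t : R => pi * t - pi / 2) t _ _ it il.
    rewrite -[X in X != 0]/('D_1 (@tan R \o (fun t : R => pi * t - pi / 2)) t) E.
    by rewrite mulf_neq0 ?invr_eq0 ?expf_neq0 ?Uc// gt_eqF.
  apply: contra D2 => /eqP; rewrite -[LHS]/('D_1 axis_param t).
  by rewrite derive_pair; [move=> [_ ->]|exact: ds].
- exists (fun m : plane R => 2^-1 + atan m.2 / pi); split.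
  + split.
    * by move=> t _.
    * move=> t t'; rewrite !inE/= !in_itv/= => t01 t01' e.
      by rewrite -(atan_axis t01) -(atan_axis t01') e.
    * move=> p p0; exists (2^-1 + atan p.2 / pi); first by rewrite /= in_itv/= atan_itv.
      by rewrite axis_paramK -p0 -surjective_pairing.
  + by move=> t; rewrite inE/= in_itv/= => /atan_axis.
  + apply: continuous_in_subspaceT => t; rewrite inE => Ut; exact: (Cs 0%N).
  + exact: continuous_subspaceT cg.
Qed.

(** A lightlike vector without time component would vanish. Hence the time coordinate alone
    parametrizes the segment, which yields the continuous inverse [u] below. *)
Let ab2_neq0 : b.2 - a.2 != 0.
Proof.
have [n0 l0] := ab_lightlike; apply/eqP => h.
move: l0; rewrite /lorentz /= h mul0r subr0 => /eqP.
rewrite -!expr2 paddr_eq0 ?sqr_ge0// !sqrf_eq0 => /andP[/eqP h1 /eqP h2].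
by move/eqP: n0; apply; rewrite [b]surjective_pairing [b.1]surjective_pairing
  [a]surjective_pairing [a.1]surjective_pairing; congr (_, _, _).
Qed.

Lemma homeomorphism_axis :
  homeomorphism_onto axis (segment a b `\` [set a; b]) (F : M -> L3 R).
Proof.
pose u (P : L3 R) : R := (b.2 - P.2) / (b.2 - a.2).
have uF s : u (F (0, s)) = 2^-1 + atan s / pi.
  rewrite /u F_axis /= /GRing.scale/=; move: (2^-1 + atan s / pi) => x.
  by field; exact: ab2_neq0.
have axE (p : plane R) : axis p -> p = (0, p.2).
  by move=> p0; rewrite [LHS]surjective_pairing p0.
(* The parameter of [segment] starts at [a], that of [F_axis] at [b]; hence the complement to 1. *)
have FE s : F (0, s) = (1 - (1 - (2^-1 + atan s / pi))) *: a + (1 - (2^-1 + atan s / pi)) *: b.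
  rewrite F_axis; move: (2^-1 + atan s / pi) => x.
  by rewrite subKr scalerBl scalerBr scale1r addrCA.
have cu : continuous u.
  move=> P; apply: (@continuousM _ _ (fun P : L3 R => b.2 - P.2) (fun=> (b.2 - a.2)^-1)).
    apply: (@continuousB _ _ _ (fun=> b.2) (snd : L3 R -> R)).
      exact: cst_continuous.
    exact: cvg_snd.
  exact: cst_continuous.
have segE P : (segment a b `\` [set a; b]) P ->
    exists2 x : R, 0 < 1 - x < 1 & P = (1 - x) *: a + x *: b.
  move=> [[x /= + <-] nab]; rewrite in_itv/= => /andP[x0 x1].
  have {}x0 : 0 < x.
    rewrite lt0r x0 andbT; apply: contra_notN nab => /eqP ->; left.
    by rewrite subr0 scale1r scale0r addr0.
  have {}x1 : x < 1.
    rewrite lt_neqAle x1 andbT; apply: contra_notN nab => /eqP ->; right.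
    by rewrite subrr scale0r scale1r add0r.
  by exists x => //; apply/andP; split; lra.
exists (axis_param \o u); split.
- split.
  + move=> p /axE ->; have /andP[h0 h1] := atan_itv p.2.
    split.
      rewrite FE; exists (1 - (2^-1 + atan p.2 / pi)) => //.
      by rewrite /= in_itv/=; apply/andP; split; lra.
    move=> [] /(congr1 u); rewrite uF /u => e; move: h0 h1; rewrite e.
      by rewrite divff// ltxx.
    by rewrite subrr mul0r ltxx.
  + move=> p q; rewrite !inE => /axE -> /axE ->; rewrite /= => /(congr1 u).
    by rewrite !uF => /(congr1 axis_param); rewrite !axis_paramK.
  + move=> P /segE[x x01 ->]; exists (axis_param (1 - x)) => //.
    by rewrite [axis_param _]surjective_pairing FE atan_axis// (subKr 1 x).
- by move=> p; rewrite inE => /axE ->; rewrite /= uF axis_paramK.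
- by apply: continuous_subspaceT; exact: continuous_F.
- apply: continuous_in_subspaceT => P; rewrite inE => /segE[x x01 PE].
  have uP : u P = 1 - x.
    by rewrite PE /u /= /GRing.scale/=; field; exact: ab2_neq0.
  apply: continuous_comp; first exact: cu.
  by rewrite uP; apply: (C_on_axis_param 0%N); rewrite /U /= in_itv.
Qed.


Lemma axis_frontier : axis `<=` frontier (@half_plane R : set M).
Proof.
move=> p p0; split.
  move=> A /nbhs_normP[e e0 he]; have e0' : 0 < e := e0.
  exists ((e / 2, p.2) : plane R); split; first by rewrite /half_plane /= divr_gt0.
  have {}p0 : p.1 = 0 := p0.
  apply: he; rewrite /= prod_normE /= p0 subrr normr0 sub0r normrN.
  rewrite max_l// ger0_norm ?divr_ge0 ?(ltW e0')// ltr_pdivrMr//.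
  by rewrite ltr_pMr// ltr1n.
by move=> /interior_subset; rewrite /half_plane /=; rewrite /axis /= in p0; rewrite p0 ltxx.
Qed.

Lemma blowup_extension :
  zmc_extension Omega psi a b (F : M -> L3 R) (@half_plane R : set M) axis.
Proof.
split.
- exact: plane_connected.
- by move=> i n; exact: C_onS (@subsetT _ _) (SF n).
- by move=> i p v _; exact: immF.
- exact: open_half_plane.
- exact: diffeo_onto_graph_blowup.
- exact: embedded_axis.
- exact: axis_frontier.
- exact: homeomorphism_axis.
- exact: locally_zmc_graph_of_blowup.
Qed.

End Extension.

Theorem theorem1 (R : realType) (Omega : set (plane R)) (psi : plane R -> R)
    (a b : L3 R)
    (Omega_jordan : bounded_jordan_domain Omega)
    (Omega_sc : @simply_connected R _ Omega)
    (psi_smooth : smooth_on Omega psi)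
    (psi_maximal : maximal_graph Omega psi)
    (neq_ab : a != b)
    (ab_lightlike : lightlike (b - a))
    (ab_bdry : segment a b `<=` bdry (graph Omega psi))
    (ab_shrinking : shrinking_singularities (graph Omega psi) a b) :
  exists (M : surface R) (F : M -> L3 R) (Mplus ell : set M),
    [/\ zmc_extension Omega psi a b F Mplus ell,
        point_symmetry (2^-1 *: (a + b)) @` range F = range F
      & spacelike_on (~` ell) F].
Proof.
have [oOmega _ _ _] := Omega_jordan.
have zmc_psi p : Omega p -> zmc_eq psi p by case/psi_maximal.
have [X [t0 [sg [f1 [f2 [f3 [[iX bsg [bf1 bf2 bf3]] XE]]]]]]] :=
  shrinking_blowup ab_shrinking.
pose F : plane R -> L3 R := blowup sg f1 f2 f3 a b.
have FN p : F (- p) = a + b - F p by exact: blowupN.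
have [_ [subX injX surX] _] := iX.
(* [XE] writes [F] on the half plane as [X] after the bijection [to_disk t0] onto the unit disk. *)
have bijF : set_bij (@half_plane R) (graph Omega psi) F.
  split=> [p Hp|p q|P /surX[w w1 <-]].
  - by rewrite /F -XE//; apply: subX; exact: to_disk_disk.
  - rewrite !inE => Hp Hq; rewrite /F -!XE// => Xpq.
    rewrite -(to_diskK t0 Hp) -(to_diskK t0 Hq); congr (of_disk t0 _).
    by apply: injX; rewrite ?inE//; exact: to_disk_disk.
  - exists (of_disk t0 w); first exact: of_disk_half_plane.
    by rewrite /F -XE ?of_diskK//; exact: of_disk_half_plane.
have SF : smooth_on setT F by exact: smooth_blowup.
exists (plane_surface R), F, (@half_plane R), (@axis R); split.
- apply: blowup_extension => //.
  + by move=> s; exact: blowup_axis.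
  + by move=> p; exact: (blowup_jac_neq0 bsg bf1 bf2 bf3 iX XE ab_lightlike).
  + by move=> p v; exact: (blowup_immersion bsg bf1 bf2 bf3 iX XE ab_lightlike).
(* The point symmetry of space corresponds to p -> - p in the parameter plane, so the image is
   carried onto itself. *)
- have sym p : point_symmetry (2^-1 *: (a + b)) (F p) = F (- p).
    by rewrite /point_symmetry scalerA divff// scale1r FN.
  apply/seteqP; split=> [_ [_ [p _ <-] <-]|_ [p _ <-]].
    by rewrite sym; exists (- p).
  exists (F (- p)); first by exists (- p).
  by rewrite sym opprK.
- move=> i p v _ p0 v0.
  apply: (blowup_spacelike bsg bf1 bf2 bf3 iX XE) => //.
  by apply/eqP.
Qed.
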